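(* If $\mathcal F$ admits query-weight exact-sum, the problem of finding $S\in\mathcal F$ with $\mathbb E[\mathrm{Top}_k(S)]\ge(1-O(\varepsilon))\,\mathrm{OPT}$ admits a PTAS for every $k\ge 1$. More precisely, there is an absolute constant $C$ such that for $k\le C/\varepsilon^2$ the running time is $n^{O(1/\varepsilon^6)}$ times a factor depending only on $\varepsilon$, times $\mathrm{poly}(\langle\mathcal F\rangle)$; for $k\ge C/\varepsilon^2$ it is $\mathrm{poly}(n,1/\varepsilon)$ query-weight exact-sum calls of magnitude $\mathrm{poly}(n,1/\varepsilon)$.
   Context: $X_1,\dots,X_n$ are independent nonnegative discrete random variables, each given by an explicit finite list of atoms and masses; $\mathcal F\subseteq 2^{[n]}$; $k\ge1$ is part of the input. $\mathrm{Top}_k(S)$ is the sum of the $k$ largest values among $(X_i)_{i\in S}$ (padded with zeros if $|S|<k$), and $\mathrm{OPT}=\max_{S\in\mathcal F}\mathbb E[\mathrm{Top}_k(S)]$. Query-weight exact-sum: let $\langle\mathcal F\rangle$ be the bit length of the encoding of $\mathcal F$. Given integer query weights $w_i$ of magnitude $M=\max_i|w_i|$ and a target $t$, decide whether some $S\in\mathcal F$ satisfies $\sum_{i\in S}w_i=t$ and return one such $S$ if so (vector targets are encoded by mixed radix). $\mathcal F$ admits query-weight exact-sum if this can be done in time $\mathrm{poly}(\langle\mathcal F\rangle)\,M^{O(1)}$. The magnitude of a call is the $M$ of its query weights.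
   Formalization: The running time for k ≤ C/ε² carries an extra factor polynomial in the encoding length of the atoms, masses, k and ε; for k ≥ C/ε² the work outside the exact-sum calls may also depend polynomially on that length, since the input lists must be read. *)

(* Defs.v *)
From mathcomp Require Import all_boot all_order all_algebra.

Set Implicit Arguments.
Unset Strict Implicit.
Unset Printing Implicit Defensive.

Import Order.TTheory GRing.Theory Num.Theory.
Local Open Scope ring_scope.

(* Machine model: N. Jones' WHILE language over binary trees, extended with a
   procedure call.  Every tree operation costs one step; up to a polynomial,
   time is Turing-machine time on the bit encoding. *)

Inductive data := Leaf | Node of data & data.

Fixpoint dsize (v : data) : nat :=
  if v is Node u w then (dsize u + dsize w).+1 else 1.

Inductive expr :=
  | EVar of nat
  | ELeaf
  | ENode of expr & expr
  | EHd of expr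
  | ETl of expr.

Inductive cmd :=
  | CSkip
  | CAssign of nat & expr
  | CSeq of cmd & cmd
  | CIf of expr & cmd & cmd
  | CWhile of expr & cmd
  | CCall of nat & expr.

Definition store := nat -> data.

Definition upd (s : store) (x : nat) (v : data) : store :=
  fun y => if y == x then v else s y.

Fixpoint eval (s : store) (e : expr) : data :=
  match e with
  | EVar x => s x
  | ELeaf => Leaf
  | ENode e1 e2 => Node (eval s e1) (eval s e2)
  | EHd e1 => if eval s e1 is Node u _ then u else Leaf
  | ETl e1 => if eval s e1 is Node _ v then v else Leaf
  end.

Fixpoint ecost (e : expr) : nat :=
  match e with
  | EVar _ | ELeaf => 1
  | ENode e1 e2 => (ecost e1 + ecost e2).+1
  | EHd e1 | ETl e1 => (ecost e1).+1
  end.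

Definition is_leaf (v : data) : bool := if v is Leaf then true else false.

(* [call v r m]: the procedure maps argument [v] to [r] in [m] steps.
   [exec call p s s' t qs]: [p] takes store [s] to [s'] with [t] steps of its
   own; [qs] lists the calls made, each as (argument, steps spent inside). *)
Inductive exec (call : data -> data -> nat -> Prop) :
    cmd -> store -> store -> nat -> seq (data * nat) -> Prop :=
  | ExSkip s : exec call CSkip s s 1 [::]
  | ExAssign s x e :
      exec call (CAssign x e) s (upd s x (eval s e)) (ecost e).+1 [::]
  | ExSeq p1 p2 s s1 s2 t1 t2 qs1 qs2 :
      exec call p1 s s1 t1 qs1 -> exec call p2 s1 s2 t2 qs2 ->
      exec call (CSeq p1 p2) s s2 (t1 + t2).+1 (qs1 ++ qs2)
  | ExIf e p1 p2 s s' t qs :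
      exec call (if is_leaf (eval s e) then p2 else p1) s s' t qs ->
      exec call (CIf e p1 p2) s s' (ecost e + t).+1 qs
  | ExWhileEnd e p s :
      is_leaf (eval s e) -> exec call (CWhile e p) s s (ecost e).+1 [::]
  | ExWhileStep e p s s1 s2 t1 t2 qs1 qs2 :
      ~~ is_leaf (eval s e) ->
      exec call p s s1 t1 qs1 -> exec call (CWhile e p) s1 s2 t2 qs2 ->
      exec call (CWhile e p) s s2 (ecost e + t1 + t2).+1 (qs1 ++ qs2)
  | ExCall x e s r m :
      call (eval s e) r m ->
      exec call (CCall x e) s (upd s x r) (ecost e).+1 [:: (eval s e, m)].

(* Variable 0 holds the input at the start and the output at the end. *)
Definition runs call (p : cmd) (v r : data) (t : nat) (qs : seq (data * nat)) :
    Prop :=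
  exists2 s, exec call p (upd (fun=> Leaf) 0 v) s t qs & s 0%N = r.

Definition runs_plain (p : cmd) (v r : data) (t : nat) : Prop :=
  runs (fun _ _ _ => False) p v r t [::].

Definition runs_with (E p : cmd) := runs (runs_plain E) p.

Definition total_time (t : nat) (qs : seq (data * nat)) : nat :=
  (t + sumn [seq q.2 | q <- qs])%N.

(* Encodings; numbers are in binary, least significant bit first. *)

Definition enc_bool (b : bool) : data := if b then Node Leaf Leaf else Leaf.

Definition enc_pair (u v : data) : data := Node u v.

Definition enc_seq T (enc : T -> data) (s : seq T) : data :=
  foldr (fun x => Node (enc x)) Leaf s.

Definition nat_bits (m : nat) : seq bool :=
  mkseq (fun i => odd (m %/ 2 ^ i)) (up_log 2 m.+1).

Definition enc_nat (m : nat) : data := enc_seq enc_bool (nat_bits m).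

Definition enc_int (z : int) : data := enc_pair (enc_bool (z < 0)) (enc_nat `|z|%N).

Definition enc_rat (q : rat) : data := enc_pair (enc_int (numq q)) (enc_int (denq q)).

Definition enc_set n (S : {set 'I_n}) : data :=
  enc_seq enc_bool [seq i \in S | i <- enum 'I_n].

Definition enc_option T (enc : T -> data) (o : option T) : data :=
  if o is Some x then Node (enc x) Leaf else Leaf.

(* Set families given by bit strings: polynomial bounds in the encoding length
   only make sense for a whole class of encoded families. *)
Record family_class := FamilyClass {
  is_code : pred (seq bool);
  ground : seq bool -> nat;
  family : forall c : seq bool, {set {set 'I_(ground c)}}
}.

Definition enc_query (c : seq bool) n (w : n.-tuple int) (z : int) : data :=
  enc_pair (enc_seq enc_bool c) (enc_pair (enc_seq enc_int w) (enc_int z)).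

Definition magnitude n (w : n.-tuple int) : nat := (\max_(x <- w) `|x|)%N.

Definition exact_sum_answer n (F : {set {set 'I_n}}) (w : n.-tuple int)
    (z : int) (o : option {set 'I_n}) : Prop :=
  match o with
  | Some A => A \in F /\ \sum_(i in A) tnth w i = z
  | None => forall A, A \in F -> \sum_(i in A) tnth w i <> z
  end.

Definition exact_sum_algorithm (Fam : family_class) (E : cmd) : Prop :=
  exists a : nat,
    forall (c : seq bool) (w : (ground Fam c).-tuple int) (z : int),
      is_code Fam c ->
      exists (o : option {set 'I_(ground Fam c)}) (t : nat),
        [/\ runs_plain E (enc_query c w z) (enc_option (@enc_set _) o) t,
            exact_sum_answer (family Fam c) w z o
          & (t <= a * (size c).+1 ^ a * (maxn 1 (magnitude w)) ^ a)%N].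

(* A distribution is a list of pairs (atom, mass). *)
Definition distr := seq (rat * rat).

Definition is_distr (D : distr) : bool :=
  all (fun x => (0 <= x.1) && (0 <= x.2)) D && (\sum_(x <- D) x.2 == 1).

Section TopK.
Variables (n : nat) (X : n.-tuple distr).

(* Sample space of the independent family: one atom index per variable, with
   the product law. *)
Definition outcome : finType := {dffun forall i : 'I_n, 'I_(size (tnth X i))}.

Definition atom_at (o : outcome) (i : 'I_n) : rat * rat :=
  tnth (in_tuple (tnth X i)) (o i).

Definition value (i : 'I_n) (o : outcome) : rat := (atom_at o i).1.

Definition prob (o : outcome) : rat := \prod_(i < n) (atom_at o i).2.

Definition expectation (Y : outcome -> rat) : rat := \sum_(o : outcome) prob o * Y o.

Definition top (k : nat) (S : {set 'I_n}) (o : outcome) : rat :=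
  \sum_(x <- take k (sort >=%R [seq value i o | i <- enum S])) x.

(* The default 0 is harmless: the values are nonnegative and [F] is nonempty
   wherever [opt] is used. *)
Definition opt (k : nat) (F : {set {set 'I_n}}) : rat :=
  \big[Num.max/0]_(S in F) expectation (top k S).

End TopK.

Definition instance (Fam : family_class) (c : seq bool)
    (X : (ground Fam c).-tuple distr) (k : nat) (eps : rat) : Prop :=
  [/\ is_code Fam c, (0 < ground Fam c)%N, family Fam c != set0,
      all is_distr X & (0 < k)%N /\ 0 < eps < 1].

Definition enc_data n (X : n.-tuple distr) (k : nat) (eps : rat) : data :=
  enc_pair (enc_seq (enc_seq (fun x => enc_pair (enc_rat x.1) (enc_rat x.2))) X)
    (enc_pair (enc_nat k) (enc_rat eps)).

Definition enc_instance n (c : seq bool) (X : n.-tuple distr) (k : nat)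
    (eps : rat) : data :=
  enc_pair (enc_seq enc_bool c) (enc_data X k eps).

(* On this instance [P], calling [E] as its procedure, halts after [t] own steps
   and calls [qs], and returns a (1 - K eps)-approximate solution. *)
Definition approximates (Fam : family_class) (E P : cmd) (K : rat)
    (c : seq bool) (X : (ground Fam c).-tuple distr) (k : nat) (eps : rat)
    (t : nat) (qs : seq (data * nat)) : Prop :=
  exists2 S : {set 'I_(ground Fam c)},
    runs_with E P (enc_instance c X k eps) (enc_set S) t qs
    & S \in family Fam c /\
      (1 - K * eps) * opt X k (family Fam c) <= expectation (top (X := X) k S).

(* For each fixed eps, polynomial time in the input length, uniformly in k. *)
Definition is_ptas (Fam : family_class) (E P : cmd) (K : rat) : Prop :=
  forall eps : rat, exists b : nat,
    forall (c : seq bool) (X : (ground Fam c).-tuple distr) (k : nat),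
      instance X k eps ->
      exists (t : nat) (qs : seq (data * nat)),
        approximates E P K X k eps t qs /\
        (total_time t qs <= b * (size c + dsize (enc_data X k eps)) ^ b)%N.

(* Besides [n ^ O(1/eps^6)], a factor depending on eps, and poly(|code|), the
   bound has the unavoidable factor polynomial in the length of the rest of the
   input, i.e. the atoms and masses. *)
Definition small_k_bound (a : nat) (f : rat -> nat) (Fam : family_class)
    (c : seq bool) (X : (ground Fam c).-tuple distr) (k : nat) (eps : rat)
    (t : nat) (qs : seq (data * nat)) : Prop :=
  (total_time t qs <=
     f eps * ground Fam c ^ Num.truncn (a%:R / eps ^+ 6)
     * (size c).+1 ^ a * dsize (enc_data X k eps) ^ a)%N.

(* poly(n, 1/eps) calls, each an exact-sum query on the given family of magnitude
   poly(n, 1/eps); the steps outside the calls may also depend polynomially on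
   the length of the numbers in the input, but not on the family. *)
Definition large_k_bound (d : nat) (Fam : family_class)
    (c : seq bool) (X : (ground Fam c).-tuple distr) (k : nat) (eps : rat)
    (t : nat) (qs : seq (data * nat)) : Prop :=
  let B : rat := d%:R * ((ground Fam c)%:R + eps^-1) ^+ d in
  (exists2 ws : seq ((ground Fam c).-tuple int * int),
     [seq q.1 | q <- qs] = [seq enc_query c v.1 v.2 | v <- ws]
     & (size ws)%:R <= B /\ forall v, v \in ws -> (magnitude v.1)%:R <= B)
  /\ t%:R <= d%:R * ((ground Fam c)%:R + eps^-1
                     + (dsize (enc_data X k eps))%:R) ^+ d :> rat.

(* Main.v *)
(* Choose N >= 1/eps and guess, up to a factor 2, the unit d of size about
   OPT / (N k).  Each variable is summarized by a vector of small integer digits,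
   packed in a base so large that sums over a set never carry; a set returned by
   an exact-sum query for the weight of an optimal set then has the same digit
   sums as the optimal set.

   For k <= N^2 the digits are roundings of the powers p^j, j < 100 N^2, of the
   tail probabilities p at the levels d, 2 d, ..., N^4 d, together with the mean
   excess over the top level.  By Newton's identities their sums determine, up to
   N^-4, the expectation of min(k, number of variables above the level), and
   E[Top_k] is the integral of this expectation over all levels.

   For k >= N^2 / 4, by concentration, E[Top_k] is the minimum over t of the convex
   function k t + sum_i E[(X_i - t)^+] up to a factor 1 - O(1/N).  Its values at
   t - d, t and t + d, where t is almost a minimizer for the optimal set, bound it
   from below everywhere, so mean excesses over these three thresholds suffice.

   Since E[Top_k] can be evaluated exactly, the best of all answers is kept.  No
   guess depends on the exact-sum algorithm, so one program serves all families. *)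
Require Import Defs.
From mathcomp Require Import all_boot all_order all_algebra.
From mathcomp Require Import zify ring lra.

Set Implicit Arguments.
Unset Strict Implicit.
Unset Printing Implicit Defensive.

Import Order.TTheory GRing.Theory Num.Theory.

(** * Programs for polynomial-time functions *)

(** An exact-sum query controls only quantities that are additive over the set, and E[Top_k] is not
    additive. Hence the power sums: E[min(k, count)] is a combination of elementary symmetric
    functions of the tail probabilities, and power sums determine these. About N^2 of them suffice,
    because the j-th one is at most lambda^j / j! for the expected count lambda, and a level with
    lambda far above N^2 >= k is saturated anyway. With N^4 levels this makes about N^6 digits, in a
    base polynomial in n for fixed N: the exponent 1/eps^6.

    The weight of an optimal set is unknown, so for every guess all targets from [cap] down to 0 are
    queried; [cap] bounds the magnitude and, up to the number of guesses, the number of calls. For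
    large k three digits of polynomial size suffice, hence polynomially many calls.

    Atoms and masses are multiplied by common denominators, so that all computations are on
    integers. Loop counts and exponents are lengths of lists, because the size of a binary number
    does not bound its value. *)

Structure encType := EncType { enc_sort :> Type; encode : enc_sort -> data }.
Canonical unit_encType := EncType (fun _ : unit => Leaf).
Canonical bool_encType := EncType enc_bool.
Canonical nat_encType := EncType enc_nat.
Canonical int_encType := EncType enc_int.
Canonical rat_encType := EncType enc_rat.
Canonical prod_encType (A B : encType) :=
  EncType (fun x : A * B => enc_pair (encode x.1) (encode x.2)).
Canonical list_encType (A : encType) := EncType (enc_seq (@encode A)).

Definition sz (A : encType) (a : A) : nat := dsize (encode a).

Lemma sz_gt0 (A : encType) (a : A) : (0 < sz a)%N.
Proof. by rewrite /sz; case: (encode a). Qed.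
#[global] Hint Resolve sz_gt0 : core.

Lemma sz_pair (A B : encType) (a : A) (b : B) :
  sz (a, b) = (sz a + sz b).+1.
Proof. by []. Qed.

Lemma sz_cons (A : encType) (a : A) s : sz (a :: s) = (sz a + sz s).+1.
Proof. by []. Qed.

Lemma sz_nil (A : encType) : sz ([::] : seq A) = 1%N.
Proof. by []. Qed.

Lemma size_sz (A : encType) (s : seq A) : (size s < sz s)%N.
Proof. by elim: s => //= a s IH; rewrite sz_cons; lia. Qed.

Lemma sz_seq_le (A : encType) (s : seq A) M :
  (forall i x0, (i < size s)%N -> (sz (nth x0 s i) <= M)%N) ->
  (sz s <= (size s * M.+1).+1)%N.
Proof.
elim: s => //= a s IH H; rewrite sz_cons.
have := H 0%N a isT => /= Ha.
have : (sz s <= (size s * M.+1).+1)%N by apply: IH => i x0 Hi; apply: (H i.+1).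
by rewrite mulSn; lia.
Qed.

(** One number is both coefficient and degree, so that a polynomial bound has a single witness and
    is monotone in it. *)
Definition pb (e n : nat) : nat := (e * n ^ e)%N.

Lemma pb_leq e e' n n' : (e <= e')%N -> (n <= n')%N -> (0 < n')%N -> (pb e n <= pb e' n')%N.
Proof.
move=> He Hn Hn'; rewrite /pb leq_mul //.
apply: (@leq_trans (n' ^ e)); last by rewrite leq_pexp2l.
by case: (e) => // k; rewrite leq_exp2r.
Qed.

Lemma pb_mono e n n' : (n <= n')%N -> (pb e n <= pb e n')%N.
Proof. by move=> Hn; rewrite /pb leq_mul //; case: e => // k; rewrite leq_exp2r. Qed.

Lemma leq_pb e n : (0 < e)%N -> (n <= pb e n)%N.
Proof.
by case: e n => // e [|n] _ //; rewrite /pb expnS mulnCA leq_pmulr // muln_gt0 /= expn_gt0.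
Qed.

Definition poly (T : nat -> nat) := exists e, forall n, (0 < n)%N -> (T n <= pb e n)%N.

Lemma poly_const c : poly (fun=> c).
Proof. by exists c => n Hn; rewrite /pb leq_pmulr // expn_gt0 Hn. Qed.

Lemma poly_id : poly id.
Proof. by exists 1%N => n Hn; rewrite /pb mul1n expn1. Qed.

Lemma poly_add T1 T2 : poly T1 -> poly T2 -> poly (fun n => T1 n + T2 n)%N.
Proof.
case=> e1 H1 [e2 H2]; exists (e1 + e2)%N => n Hn.
apply: leq_trans (leq_add (H1 n Hn) (H2 n Hn)) _.
rewrite /pb mulnDl leq_add // leq_mul // leq_pexp2l //; lia.
Qed.

Lemma poly_mul T1 T2 : poly T1 -> poly T2 -> poly (fun n => T1 n * T2 n)%N.
Proof.
case=> e1 H1 [e2 H2]; exists (e1 * e2 + e1 + e2)%N => n Hn.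
apply: leq_trans (leq_mul (H1 n Hn) (H2 n Hn)) _.
rewrite /pb mulnACA -expnD leq_mul //; first by lia.
by rewrite leq_pexp2l //; lia.
Qed.

Lemma poly_pb e T : poly T -> poly (fun n => pb e (T n)).
Proof.
case=> e1 H1; exists (e * e1 ^ e + e1 * e)%N => n Hn.
apply: leq_trans (pb_mono e (H1 n Hn)) _.
rewrite /pb expnMn -expnM mulnA leq_mul // ?leq_addr // leq_pexp2l //.
by rewrite leq_addl.
Qed.

Lemma poly_le T1 T2 : poly T2 -> (forall n, (0 < n)%N -> (T1 n <= T2 n)%N) -> poly T1.
Proof. by case=> e H Hle; exists e => n Hn; apply: leq_trans (Hle n Hn) (H n Hn). Qed.

Lemma poly_S T : poly T -> poly (fun n => (T n).+1).
Proof.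
move=> H; apply: poly_le (poly_add (poly_const 1) H) _ => n _; lia.
Qed.

Ltac solve_poly := lazymatch goal with
  | |- poly (fun n => n) => exact: poly_id
  | |- poly (fun n => S (@?T n)) => apply: (poly_S (T := T)); solve_poly
  | |- poly (fun n => addn (@?T n) (@?U n)) => apply: (poly_add (T1 := T) (T2 := U)); solve_poly
  | |- poly (fun n => muln (@?T n) (@?U n)) => apply: (poly_mul (T1 := T) (T2 := U)); solve_poly
  | |- poly (fun n => pb ?e (@?T n)) => apply: (poly_pb e (T := T)); solve_poly
  | |- poly (fun=> ?c) => exact: poly_const
  | _ => assumption
  end.

Definition regs := nat -> cmd.

(* [p x] reads its argument and leaves its result in register [x]; registers
   below [x] are preserved, so a caller keeps its own data there. *)
Definition pt (A B : encType) (f : A -> B) : Prop :=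
  exists (p : regs) (e : nat), forall call x s a, s x = encode a ->
    exists s' t, [/\ exec call (p x) s s' t [::], s' x = encode (f a),
      (forall y, (y < x)%N -> s' y = s y),
      (t <= pb e (sz a))%N & (sz (f a) <= pb e (sz a))%N].

Section PT.
Variables (A B C D : encType).

Lemma pt_ext (f g : A -> B) : pt f -> (forall a, f a = g a) -> pt g.
Proof.
move=> [p [e P]] H; exists p, e => call x s a E; have := P call x s a E.
by rewrite H.
Qed.

Lemma updE s x v : upd s x v x = v. Proof. by rewrite /upd eqxx. Qed.
Lemma updN s x v y : y != x -> upd s x v y = s y.
Proof. by rewrite /upd => /negbTE->. Qed.

Lemma pt_size (f : A -> B) : pt f -> exists e, forall a, (sz (f a) <= pb e (sz a))%N.
Proof.
case=> p [e P]; exists e => a.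
(* The size bound mentions neither the procedure nor the store, so any choice of the two extracts
   it. *)
by have [s' [t []]] := P (fun _ _ _ => False) 0%N (fun=> encode a) a erefl.
Qed.

Lemma pt_expr (f : A -> B) (ex : nat -> expr) c :
  (forall s x a, s x = encode a -> eval s (ex x) = encode (f a)) ->
  (forall x, ecost (ex x) < c)%N ->
  (exists e, forall a, (sz (f a) <= pb e (sz a))%N) -> pt f.
Proof.
move=> H Hc [e He]; exists (fun x => CAssign x (ex x)), (c + e)%N => call x s a E.
exists (upd s x (eval s (ex x))), (ecost (ex x)).+1; split.
- exact: ExAssign.
- by rewrite updE (H _ _ _ E).
- by move=> y Hy; rewrite updN // neq_ltn Hy.
- apply: leq_trans (Hc x) _; rewrite /pb.
  by apply: leq_trans (leq_addr e c) _; rewrite leq_pmulr // expn_gt0 sz_gt0.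
- by apply: leq_trans (He a) _; apply: pb_leq => //; lia.
Qed.

(** Covers every change of type that leaves the tree as it is, such as a pair read as a [cons] or a
    number read as its list of bits. *)
Lemma pt_recode (f : A -> B) : (forall a, encode (f a) = encode a) -> pt f.
Proof.
move=> H; apply: (@pt_expr _ (fun x => EVar x) 2) => [s x a|//|].
  by rewrite H.
by exists 1%N => a; rewrite /sz H /pb mul1n expn1.
Qed.

Fixpoint cexpr (d : data) : expr :=
  if d is Node u v then ENode (cexpr u) (cexpr v) else ELeaf.

Lemma eval_cexpr s d : eval s (cexpr d) = d.
Proof. by elim: d => //= u -> v ->. Qed.

Lemma pt_const (b : B) : pt (fun _ : A => b).
Proof.
apply: (@pt_expr _ (fun=> cexpr (encode b)) (ecost (cexpr (encode b))).+1) => [s x a _||].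
- by rewrite eval_cexpr.
- by [].
- by exists (sz b) => a; rewrite /pb leq_pmulr // expn_gt0 sz_gt0.
Qed.

Lemma pt_comp (g : B -> C) (f : A -> B) : pt g -> pt f -> pt (fun a => g (f a)).
Proof.
case=> q [e2 Q] [p [e1 P]].
have [e He] : poly (fun n => (pb e1 n + pb e2 (pb e1 n) + pb e2 (pb e1 n)).+1)%N.
  by solve_poly.
exists (fun x => CSeq (p x) (q x)), e => call x s a E.
have [s1 [t1 [X1 V1 F1 T1 S1]]] := P call x s a E.
have [s2 [t2 [X2 V2 F2 T2 S2]]] := Q call x s1 (f a) V1.
have /= Hn := He _ (sz_gt0 a); have M2 := pb_mono e2 S1.
exists s2, (t1 + t2).+1; split => //.
- exact: ExSeq X1 X2.
- by move=> y Hy; rewrite F2 // F1.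
- by lia.
- by lia.
Qed.

Lemma pt_pair (f : A -> B) (g : A -> C) : pt f -> pt g -> pt (fun a => (f a, g a)).
Proof.
case=> p [e1 P] [q [e2 Q]].
have [e He] : poly (fun n => (pb e1 n + pb e2 n) + 20)%N by solve_poly.
(* Each component works on a copy in a higher register: a program overwrites its argument, and only
   the registers below its own are safe. *)
exists (fun x => CSeq (CAssign x.+1 (EVar x)) (CSeq (p x.+1)
          (CSeq (CAssign x.+2 (EVar x)) (CSeq (q x.+2)
             (CAssign x (ENode (EVar x.+1) (EVar x.+2))))))), e => call x s a E.
pose s0 := upd s x.+1 (s x).
have [|s1 [t1 [X1 V1 F1 T1 S1]]] := P call x.+1 s0 a; first by rewrite /s0 updE.
pose s2 := upd s1 x.+2 (s1 x).
have [|s3 [t3 [X3 V3 F3 T3 S3]]] := Q call x.+2 s2 a.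
  by rewrite /s2 updE F1 // /s0 updN //; lia.
have /= Hn := He _ (sz_gt0 a).
eexists _, _; split.
- apply: (ExSeq (ExAssign call s x.+1 (EVar x))).
  apply: (ExSeq X1); apply: (ExSeq (ExAssign call s1 x.+2 (EVar x))).
  exact: (ExSeq X3 (ExAssign call s3 x _)).
- rewrite updE /= V3 F3 // /s2 updN; last by lia.
  by rewrite V1.
- move=> y Hy; rewrite updN; last by lia.
  rewrite F3; last by lia.
  rewrite /s2 updN; last by lia.
  rewrite F1; last by lia.
  by rewrite /s0 updN //; lia.
- by rewrite /=; lia.
- by rewrite sz_pair; lia.
Qed.

Lemma pt_if (b : A -> bool) (f g : A -> B) :
  pt b -> pt f -> pt g -> pt (fun a => if b a then f a else g a).
Proof.
case=> r [e0 R] [p [e1 P]] [q [e2 Q]].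
have [e He] : poly (fun n => (pb e0 n + pb e1 n + pb e2 n) + 20)%N by solve_poly.
exists (fun x => CSeq (CAssign x.+1 (EVar x)) (CSeq (r x.+1)
          (CIf (EVar x.+1) (p x) (q x)))), e => call x s a E.
pose s0 := upd s x.+1 (s x).
have [|s1 [t1 [X1 V1 F1 T1 S1]]] := R call x.+1 s0 a; first by rewrite /s0 updE.
have E1 : s1 x = encode a by rewrite F1 // /s0 updN //; lia.
have Fr y : (y < x)%N -> s1 y = s y.
  by move=> Hy; rewrite F1; [rewrite /s0 updN //; lia | lia].
have /= Hn := He _ (sz_gt0 a).
case Eb : (b a).
  have [s2 [t2 [X2 V2 F2 T2 S2]]] := P call x s1 a E1.
  eexists _, _; split.
  - apply: (ExSeq (ExAssign call s x.+1 (EVar x))); apply: (ExSeq X1).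
    by apply: ExIf; rewrite /= V1 Eb; exact: X2.
  - by [].
  - by move=> y Hy; rewrite F2 // Fr.
  - by rewrite /=; lia.
  - by lia.
have [s2 [t2 [X2 V2 F2 T2 S2]]] := Q call x s1 a E1.
eexists _, _; split.
- apply: (ExSeq (ExAssign call s x.+1 (EVar x))); apply: (ExSeq X1).
  by apply: ExIf; rewrite /= V1 Eb; exact: X2.
- by [].
- by move=> y Hy; rewrite F2 // Fr.
- by rewrite /=; lia.
- by lia.
Qed.

End PT.
Arguments pt_const {A B} b.
Arguments pt_comp {A B C g f}.

Lemma pt_id {A : encType} : pt (fun a : A => a).
Proof. by apply: pt_recode. Qed.

Section Proj.
Variables (A B C D : encType).

Lemma pt_fst (f : A -> B * C) : pt f -> pt (fun a => (f a).1).
Proof.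
move=> H; apply: (@pt_comp _ _ _ (fst) _ _ H).
apply: (@pt_expr _ _ _ (fun x => EHd (EVar x)) 3) => [s x a /= ->//|//|].
by exists 1%N => -[a b]; rewrite /pb mul1n expn1 sz_pair /=; lia.
Qed.

Lemma pt_snd (f : A -> B * C) : pt f -> pt (fun a => (f a).2).
Proof.
move=> H; apply: (@pt_comp _ _ _ (snd) _ _ H).
apply: (@pt_expr _ _ _ (fun x => ETl (EVar x)) 3) => [s x a /= ->//|//|].
by exists 1%N => -[a b]; rewrite /pb mul1n expn1 sz_pair /=; lia.
Qed.

Lemma pt_cons (f : A -> B) (g : A -> seq B) : pt f -> pt g -> pt (fun a => f a :: g a).
Proof.
move=> Hf Hg; apply: (@pt_comp _ _ _ (fun x => x.1 :: x.2) _ _ (pt_pair Hf Hg)).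
exact: pt_recode.
Qed.

Lemma pt_behead (f : A -> seq B) : pt f -> pt (fun a => behead (f a)).
Proof.
move=> H; apply: (@pt_comp _ _ _ (behead) _ _ H).
apply: (@pt_expr _ _ _ (fun x => ETl (EVar x)) 3) => [s x [|b l] /= ->//|//|].
by exists 1%N => -[|a b]; rewrite /pb mul1n expn1 // sz_cons /=; lia.
Qed.

Lemma pt_not (f : A -> bool) : pt f -> pt (fun a => ~~ f a).
Proof.
move=> H; apply: (pt_ext (pt_if H (pt_const false) (pt_const true))) => a.
by case: (f a).
Qed.

Lemma pt_and (f g : A -> bool) : pt f -> pt g -> pt (fun a => f a && g a).
Proof.
move=> H G; apply: (pt_ext (pt_if H G (pt_const false))) => a.
by case: (f a).
Qed.

Lemma pt_or (f g : A -> bool) : pt f -> pt g -> pt (fun a => f a || g a).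
Proof.
move=> H G; apply: (pt_ext (pt_if H (pt_const true) G)) => a.
by case: (f a).
Qed.

Lemma pt_nilp (f : A -> seq B) : pt f -> pt (fun a => nilp (f a)).
Proof.
move=> H; apply: (@pt_comp _ _ _ (fun l => nilp l) _ _ H).
exists (fun x => CIf (EVar x) (CAssign x ELeaf) (CAssign x (ENode ELeaf ELeaf))), 10%N.
move=> call x s l E.
exists (upd s x (encode (nilp l))), (if l is [::] then 6 else 4)%N; split.
- by case: l E => [|b l] E; apply: (@ExIf _ (EVar x)); rewrite /= E; exact: ExAssign.
- by rewrite updE.
- by move=> y Hy; rewrite updN // neq_ltn Hy.
- by apply: (@leq_trans 10); [case: (l) | rewrite /pb leq_pmulr // expn_gt0 sz_gt0].
- by apply: (@leq_trans 10); [case: (l) | rewrite /pb leq_pmulr // expn_gt0 sz_gt0].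
Qed.

End Proj.

(** The invariant is indexed by the exact number of rounds left, so termination, time and number of
    calls all follow by induction on it. [Good] describes the calls; with [Good] empty the loop
    makes none. *)
Lemma while_rule call (e : expr) (p : cmd) (Inv : nat -> store -> Prop)
    (Good : data * nat -> Prop) (T : nat) :
  (forall s, Inv 0%N s -> is_leaf (eval s e)) ->
  (forall m s, Inv m.+1 s -> ~~ is_leaf (eval s e) /\
     exists s' t qs, [/\ exec call p s s' t qs, Inv m s', (t <= T)%N,
       (size qs <= 1)%N & forall q, List.In q qs -> Good q]) ->
  forall m s, Inv m s -> exists s' t qs,
    [/\ exec call (CWhile e p) s s' t qs, Inv 0%N s',
      (t <= m.+1 * (T + ecost e).+1)%N, (size qs <= m)%N
      & forall q, List.In q qs -> Good q].
Proof.
move=> H0 HS; elim=> [|m IH] s I.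
  exists s, (ecost e).+1, [::]; split => //; first by apply: ExWhileEnd; exact: H0.
  by rewrite mul1n ltnS leq_addl.
have [Hl [s1 [t1 [q1 [X1 I1 T1 S1 G1]]]]] := HS _ _ I.
have [s2 [t2 [q2 [X2 I2 T2 S2 G2]]]] := IH _ I1.
exists s2, (ecost e + t1 + t2).+1, (q1 ++ q2); split => //.
- exact: ExWhileStep Hl X1 X2.
- by rewrite mulSn; lia.
- by rewrite size_cat; lia.
- by move=> q Hq; case: (List.in_app_or _ _ _ Hq) => [/G1//|/G2//].
Qed.

(** * Folds over lists *)

Section Fold.
Variables (A B S : encType).

(** A bound on all intermediate states has to be supplied: polynomial growth in each round could
    compound to exponential size. *)
Lemma pt_foldl (g : A -> S -> B -> S) (init : A -> S) (l : A -> seq B) :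
  pt (fun x : A * (S * B) => g x.1 x.2.1 x.2.2) -> pt init -> pt l ->
  (exists e, forall a i, (sz (foldl (g a) (init a) (take i (l a))) <= pb e (sz a))%N) ->
  pt (fun a => foldl (g a) (init a) (l a)).
Proof.
move=> [q [e2 Q]] Hi Hl [e3 H3].
have [p [e1 P]] := pt_pair Hl Hi.
pose T2 n := (pb e2 (n + (pb e3 n + pb e1 n + 2)) + 30)%N.
have [e He] : poly (fun n => (pb e1 n).+1 * (T2 n).+3.+2 + pb e1 n + pb e3 n + 20)%N.
  by rewrite /T2; solve_poly.
pose body x := CSeq (CAssign x.+2 (ENode (EVar x) (ENode (ETl (EVar x.+1)) (EHd (EHd (EVar x.+1))))))
  (CSeq (q x.+2) (CAssign x.+1 (ENode (ETl (EHd (EVar x.+1))) (EVar x.+2)))).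
exists (fun x => CSeq (CAssign x.+1 (EVar x)) (CSeq (p x.+1)
          (CSeq (CWhile (EHd (EVar x.+1)) (body x)) (CAssign x (ETl (EVar x.+1)))))), e.
move=> call x s a E.
pose s0 := upd s x.+1 (s x).
have [|s1 [t1 [X1 V1 F1 T1 S1]]] := P call x.+1 s0 a; first by rewrite /s0 updE.
have /= Hn := He _ (sz_gt0 a).
pose Inv m s' := [/\ s' x = encode a, (forall y, (y < x)%N -> s' y = s y), (m <= size (l a))%N
  & s' x.+1 = encode (drop (size (l a) - m) (l a),
               foldl (g a) (init a) (take (size (l a) - m) (l a)))].
have I1 : Inv (size (l a)) s1.
  split => //.
  - by rewrite F1 // /s0 updN //; lia.
  - by move=> y Hy; rewrite F1 ?/s0 ?updN //; lia.
  - by rewrite subnn drop0 take0.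
have Sl : (sz (l a) + sz (init a) < pb e1 (sz a))%N by move: S1; rewrite sz_pair.
have [||s2 [t2 [qs [X2 [E2 F2 _ V2] L2 _ Q2]]]] :=
  @while_rule call (EHd (EVar x.+1)) (body x) Inv (fun=> False) (T2 (sz a)) _ _ _ _ I1.
- by move=> s' [_ _ _ V]; rewrite /= V subn0 drop_size.
- move=> m s' [E' F' Hm V].
  set i := (size (l a) - m.+1)%N in V.
  have Hi' : (i < size (l a))%N by rewrite /i; lia.
  case El : (drop i (l a)) => [|b r].
    by have := congr1 size El; rewrite size_drop /=; lia.
  have Er : drop i.+1 (l a) = r by rewrite -addn1 addnC -drop_drop El /= drop0.
  have Et : take i.+1 (l a) = rcons (take i (l a)) b.
    by rewrite (take_nth b) //; congr rcons; rewrite -(addn0 i) -nth_drop El.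
  have Ei : (size (l a) - m)%N = i.+1 by rewrite /i; lia.
  rewrite El in V; split; first by rewrite /= V.
  set st := foldl _ _ _ in V.
  pose s3 := upd s' x.+2 (encode (a, (st, b))).
  have [|s4 [t4 [X4 V4 F4 T4 S4]]] := Q call x.+2 s3 (a, (st, b)); first by rewrite /s3 updE.
  rewrite /= in V4.
  have Hb : (sz b < sz (l a))%N.
    have := sz_cons b r; rewrite -El => H.
    have : (sz (drop i (l a)) <= sz (l a))%N.
      elim: (l a) (i) => [|c l' IH] [|j] //=; rewrite ?sz_cons; have := IH j; lia.
    lia.
  exists (upd s4 x.+1 (Node (encode r) (s4 x.+2))); eexists; exists [::]; split.
  - apply: (ExSeq (qs1 := [::])).
      have Es3 : s3 = upd s' x.+2 (eval s' (ENode (EVar x) (ENode (ETl (EVar x.+1)) (EHd (EHd (EVar x.+1)))))).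
        by rewrite /s3 /= E' V.
      by rewrite -/s3 in X4 *; have := ExAssign call s' x.+2 (ENode (EVar x) (ENode (ETl (EVar x.+1)) (EHd (EHd (EVar x.+1))))); rewrite -Es3; apply.
    apply: (ExSeq (qs1 := [::]) X4).
    have -> : Node (encode r) (s4 x.+2) = eval s4 (ENode (ETl (EHd (EVar x.+1))) (EVar x.+2)).
      by rewrite /= (F4 x.+1) // /s3 updN ?V //; lia.
    exact: ExAssign.
  - split; rewrite ?updE.
    + rewrite updN; last by lia.
      rewrite F4; last by lia.
      by rewrite /s3 updN //; lia.
    + move=> y Hy; rewrite updN; last by lia.
      rewrite F4; last by lia.
      by rewrite /s3 updN ?F' //; lia.
    + by lia.
    + by rewrite Ei Er Et foldl_rcons V4.
  - have B4 : (pb e2 (sz (a, (st, b))) <= pb e2 (sz a + (pb e3 (sz a) + pb e1 (sz a) + 2)))%N.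
      by apply: pb_mono; rewrite !sz_pair; have := H3 a i; rewrite -/st; lia.
    by rewrite /= /T2; lia.
  - by [].
  - by [].
have Eq : qs = [::] by case: qs X2 Q2 => // q0 qs _ Q2; case: (Q2 q0); left.
rewrite {}Eq in X2.
rewrite subn0 take_size in V2.
eexists; eexists; split.
- apply: (ExSeq (qs1 := [::]) (ExAssign call s x.+1 (EVar x))).
  by apply: (ExSeq (qs1 := [::]) X1); apply: (ExSeq (qs1 := [::]) X2); exact: ExAssign.
- by rewrite updE /= V2.
- by move=> y Hy; rewrite updN ?F2 //; lia.
- have Hs := size_sz (l a).
  have : ((size (l a)).+1 * (T2 (sz a) + 2).+1 <= (pb e1 (sz a)).+1 * (T2 (sz a)).+3.+2)%N.
    by apply: leq_mul; lia.
  by move: L2; rewrite /=; lia.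
- by have := H3 a (size (l a)); rewrite take_size; lia.
Qed.

(* The growth of the measure [ms] per step does not depend on the state, which
   keeps iterated sizes polynomial. *)
Lemma pt_foldl_meas (ms : S -> nat) (g : A -> S -> B -> S) (init : A -> S) (l : A -> seq B) e :
  pt (fun x : A * (S * B) => g x.1 x.2.1 x.2.2) -> pt init -> pt l ->
  (forall s, sz s <= pb e (ms s).+1)%N -> (forall s, ms s <= pb e (sz s))%N ->
  (forall a s b, ms (g a s b) <= ms s + pb e (sz a + sz b))%N ->
  pt (fun a => foldl (g a) (init a) (l a)).
Proof.
move=> Hg Hi Hl H1 H2 H3; apply: pt_foldl => //.
have [e1 E1] := pt_size Hi; have [e2 E2] := pt_size Hl.
have [e' He] : poly (fun n => pb e (pb e (pb e1 n) + pb e2 n * pb e (n + pb e2 n)).+1)%N.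
  by solve_poly.
exists e' => a i; apply: leq_trans (He _ (sz_gt0 a)); apply: leq_trans (H1 _) _.
apply: pb_mono; rewrite ltnS.
have {}H2 := H2 (init a); have := pb_mono e (E1 a) => Hp.
have [Hsl Hsz]: (size (take i (l a)) <= pb e2 (sz a))%N /\
   forall b, List.In b (take i (l a)) -> (sz b <= pb e2 (sz a))%N.
  split.
    rewrite size_take_min; have := size_sz (l a); have := E2 a; lia.
  move=> b Hb; apply: leq_trans (E2 a).
  elim: (l a) (i) Hb => [|c l' IH] [|j] //=; rewrite sz_cons => -[->|/IH]; lia.
set l0 := take _ _ in Hsl Hsz *.
suff : (ms (foldl (g a) (init a) l0) <= ms (init a) + size l0 * pb e (sz a + pb e2 (sz a)))%N.
  by move=> Hle; apply: (leq_trans Hle); apply: leq_add; [lia | rewrite leq_mul].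
elim/last_ind: l0 Hsz {Hsl} => [|l0 b IH] Hsz /=; first by lia.
rewrite foldl_rcons size_rcons mulSn.
have := H3 a (foldl (g a) (init a) l0) b.
have Hb : (sz b <= pb e2 (sz a))%N.
  by apply: Hsz; rewrite -cats1; apply: List.in_or_app; right; left.
have : (pb e (sz a + sz b) <= pb e (sz a + pb e2 (sz a)))%N by apply: pb_mono; lia.
have : (ms (foldl (g a) (init a) l0) <= ms (init a) + size l0 * pb e (sz a + pb e2 (sz a)))%N.
  by apply: IH => c Hc; apply: Hsz; rewrite -cats1; apply: List.in_or_app; left.
lia.
Qed.
End Fold.

Section CatReverse.
Variables (A B C S : encType).

Lemma pt_catrev (f g : A -> seq B) : pt f -> pt g -> pt (fun a => catrev (f a) (g a)).
Proof.
move=> Hf Hg.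
have H : pt (fun a => foldl (fun s b => b :: s) (g a) (f a)).
  apply: (@pt_foldl_meas _ _ (list_encType B) (@sz _) (fun=> fun s b => b :: s) g f 1%N) => //.
  - by apply: pt_cons; [apply: pt_snd | apply: pt_fst]; apply: pt_snd; exact: pt_id.
  - by move=> s; rewrite /pb mul1n expn1.
  - by move=> s; rewrite /pb mul1n expn1.
  - by move=> a s b; rewrite /pb mul1n expn1 sz_cons; have := sz_gt0 a; lia.
by apply: (pt_ext H) => a; elim: (f a) (g a) => //= b l IH r; rewrite IH.
Qed.

End CatReverse.

Section Reverse.
Variables (A B C S : encType).

Lemma pt_rev (f : A -> seq B) : pt f -> pt (fun a => rev (f a)).
Proof. by move=> H; apply: pt_catrev => //; exact: pt_const. Qed.

End Reverse.

Section FoldRight.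
Variables (A B C S : encType).

Lemma pt_foldr_meas (ms : S -> nat) (g : A -> B -> S -> S) (init : A -> S) (l : A -> seq B) e :
  pt (fun x : A * (S * B) => g x.1 x.2.2 x.2.1) -> pt init -> pt l ->
  (forall s, sz s <= pb e (ms s).+1)%N -> (forall s, ms s <= pb e (sz s))%N ->
  (forall a s b, ms (g a b s) <= ms s + pb e (sz a + sz b))%N ->
  pt (fun a => foldr (g a) (init a) (l a)).
Proof.
move=> Hg Hi Hl H1 H2 H3.
have := @pt_foldl_meas _ _ _ ms (fun a s b => g a b s) init (fun a => rev (l a)) e
   Hg Hi (pt_rev Hl) H1 H2 H3.
by move=> H; apply: (pt_ext H) => a; rewrite foldl_rev.
Qed.

End FoldRight.

Section Map.
Variables (A B C S : encType).

Lemma pt_map (g : A -> B -> C) (l : A -> seq B) :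
  pt (fun x : A * B => g x.1 x.2) -> pt l -> pt (fun a => [seq g a b | b <- l a]).
Proof.
move=> Hg Hl; have [e E] := pt_size Hg.
have [e' He] : poly (fun n => pb e n.+1 + n.+2)%N by solve_poly.
have H : pt (fun a => foldr (fun b s => g a b :: s) [::] (l a)).
  apply: (@pt_foldr_meas _ _ (list_encType _) (@sz _) (fun a b s => g a b :: s) _ _ (e' + 1)) => //.
  - apply: pt_cons; last by apply: pt_fst; apply: pt_snd; exact: pt_id.
    exact: (pt_ext (pt_comp Hg (pt_pair (pt_fst pt_id) (pt_snd (pt_snd pt_id))))).
  - exact: pt_const.
  - by move=> s; apply: leq_trans (leqnSn _) _; apply: leq_pb; rewrite addn1.
  - by move=> s; apply: leq_pb; rewrite addn1.
  - move=> a s b; rewrite sz_cons.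
    have := E (a, b); rewrite sz_pair /= => {}E.
    have /= := He (sz a + sz b)%N; rewrite addn_gt0 sz_gt0 => /(_ isT) He1.
    have : (pb e' (sz a + sz b) <= pb (e' + 1) (sz a + sz b))%N.
      by apply: pb_leq; rewrite ?leq_addr // addn_gt0 sz_gt0.
    lia.
by apply: (pt_ext H) => a; elim: (l a) => //= b s ->.
Qed.

Lemma pt_cat (f g : A -> seq B) : pt f -> pt g -> pt (fun a => f a ++ g a).
Proof.
move=> Hf Hg; apply: (pt_ext (pt_catrev (pt_rev Hf) Hg)) => a.
by rewrite catrevE revK.
Qed.

Lemma sz_cat (s t : seq B) : (sz (s ++ t)).+1 = (sz s + sz t)%N.
Proof. by elim: s => //= b s IH; rewrite !sz_cons; lia. Qed.

End Map.

Section Flatten.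
Variables (A B C S : encType).

Lemma pt_flatten (f : A -> seq (seq B)) : pt f -> pt (fun a => flatten (f a)).
Proof.
move=> Hf.
have H : pt (fun a => foldr (fun b s => b ++ s) [::] (f a)).
  apply: (@pt_foldr_meas _ _ (list_encType _) (@sz _) (fun=> fun b s => b ++ s) _ _ 1%N) => //.
  - by apply: pt_cat; [apply: pt_snd | apply: pt_fst]; apply: pt_snd; exact: pt_id.
  - exact: pt_const.
  - by move=> s; rewrite /pb mul1n expn1.
  - by move=> s; rewrite /pb mul1n expn1.
  - by move=> a s b; rewrite /pb mul1n expn1; have := sz_cat b s; lia.
exact: H.
Qed.
End Flatten.

(** * Binary arithmetic *)

Definition bval (s : seq bool) : nat := foldr (fun (b : bool) n => b + n.*2)%N 0%N s.
Definition bl (m : nat) : nat := size (nat_bits m).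

Lemma blE m : bl m = up_log 2 m.+1.
Proof. by rewrite /bl size_mkseq. Qed.

Lemma ltn_bl m : (m < 2 ^ bl m)%N.
Proof. by rewrite blE; apply: up_logP. Qed.

Lemma bl_min m e : (m < 2 ^ e)%N -> (bl m <= e)%N.
Proof. by move=> H; rewrite blE; apply: up_log_min. Qed.

Lemma nat_bits0 : nat_bits 0 = [::].
Proof. by rewrite /nat_bits up_log1. Qed.

Lemma bl_half m : (0 < m)%N -> bl m = (bl m./2).+1.
Proof.
move=> Hm; apply/eqP; rewrite eqn_leq; apply/andP; split.
  apply: bl_min; rewrite expnS; have := ltn_bl m./2; have := odd_double_half m.
  by move: (2 ^ _)%N => X; case: (odd m); lia.
have := ltn_bl m; case E : (bl m) => [|n]; first by lia.
rewrite ltnS expnS => H; apply: bl_min; move: H; have := odd_double_half m.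
by move: (2 ^ _)%N => X; lia.
Qed.

Lemma nat_bitsS m : (0 < m)%N -> nat_bits m = odd m :: nat_bits m./2.
Proof.
move=> Hm; rewrite /nat_bits -!blE bl_half // /mkseq /= divn1; congr cons.
rewrite -[1%N]addn0 iotaDl -map_comp; apply: eq_map => i /=.
by rewrite add1n expnS divnMA divn2.
Qed.

Lemma nat_bitsK m : bval (nat_bits m) = m.
Proof.
elim/ltn_ind: m => -[|m] IH; first by rewrite nat_bits0.
by rewrite nat_bitsS //= IH ?odd_double_half //; lia.
Qed.

Lemma bval_lt s : (bval s < 2 ^ size s)%N.
Proof. by elim: s => //= b s IH; rewrite expnS; case: b; lia. Qed.

(** Bits come least significant first, so the leading zeros of the number, absent from [nat_bits],
    sit at the end of the list. *)
Definition norm (s : seq bool) : seq bool :=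
  foldr (fun b r => if b || ~~ nilp r then b :: r else [::]) [::] s.

Lemma normE s : norm s = nat_bits (bval s).
Proof.
elim: s => [|b s IH] /=; first by rewrite nat_bits0.
have Hnil : nilp (norm s) = (bval s == 0%N).
  rewrite IH; case: (posnP (bval s)) => [->|H]; first by rewrite nat_bits0.
  by rewrite nat_bitsS //=; case: (bval s) H.
rewrite -/(norm s) Hnil; case: ifP => H.
  rewrite nat_bitsS; last by case: b H => //= /eqP; lia.
  by rewrite oddD odd_double addbF oddb half_bit_double IH.
by case: b H => //= /negbFE/eqP ->; rewrite nat_bits0.
Qed.

Lemma sz_bool (b : bool) : sz b = (if b then 3 else 1)%N.
Proof. by case: b. Qed.

Lemma sz_bits (s : seq bool) : (sz s <= 4 * size s + 1)%N.
Proof. by elim: s => //= b s IH; rewrite sz_cons sz_bool; case: b; lia. Qed.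

Lemma sz_nat (m : nat) : (sz m <= 4 * bl m + 1)%N.
Proof. exact: sz_bits. Qed.

Lemma bl_sz (m : nat) : (bl m < sz m)%N.
Proof. exact: (@size_sz _ (nat_bits m)). Qed.

Lemma ltn_sz (m : nat) : (m < 2 ^ sz m)%N.
Proof. by apply: leq_trans (ltn_bl m) _; rewrite leq_exp2l // ltnW ?bl_sz. Qed.

Lemma sz_nat_lt (m e : nat) : (m < 2 ^ e)%N -> (sz m <= 4 * e + 1)%N.
Proof. by move=> /bl_min; have := sz_nat m; lia. Qed.

Lemma sz_nat_mono (m n : nat) : (m <= n)%N -> (sz m <= 4 * sz n + 1)%N.
Proof. by move=> H; apply: sz_nat_lt; apply: leq_ltn_trans H (ltn_sz n). Qed.

Lemma blD m n : (bl (m + n) <= bl m + bl n)%N.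
Proof.
apply: bl_min; rewrite expnD; have := ltn_bl m; have := ltn_bl n.
by move: (2 ^ bl m)%N (2 ^ bl n)%N => x y; nia.
Qed.

Lemma blM m n : (bl (m * n) <= bl m + bl n)%N.
Proof.
apply: bl_min; rewrite expnD; have := ltn_bl m; have := ltn_bl n.
by move: (2 ^ bl m)%N (2 ^ bl n)%N => x y; nia.
Qed.

Section Bits.
Variables (A : encType).

Lemma pt_bits (f : A -> nat) : pt f -> pt (fun a => nat_bits (f a)).
Proof.
move=> H; apply: (@pt_comp _ nat_encType (list_encType bool_encType) nat_bits _ _ H).
exact: pt_recode.
Qed.

Lemma pt_bval (f : A -> seq bool) : pt f -> pt (fun a => bval (f a)).
Proof.
move=> H.
have Hn : pt (fun a => norm (f a)).
  apply: (@pt_foldr_meas _ bool_encType (list_encType bool_encType) (@sz _)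
    (fun _ b r => if b || ~~ nilp r then b :: r else [::]) (fun=> [::]) f 4%N) => //.
  - apply: pt_if; last exact: pt_const.
      apply: pt_or; first by apply: pt_snd; apply: pt_snd; exact: pt_id.
      by apply: pt_not; apply: pt_nilp; apply: pt_fst; apply: pt_snd; exact: pt_id.
    apply: pt_cons; first by apply: pt_snd; apply: pt_snd; exact: pt_id.
    by apply: pt_fst; apply: pt_snd; exact: pt_id.
  - exact: pt_const.
  - by move=> s; apply: leq_trans (leqnSn _) _; apply: leq_pb.
  - by move=> s; apply: leq_pb.
  - move=> a s b; apply: (@leq_trans (sz s + 4)); last first.
      by rewrite leq_add2l /pb leq_pmulr // expn_gt0 addn_gt0 sz_gt0.
    by case: ifP => _; rewrite ?sz_cons ?sz_nil ?sz_bool; [case: b; lia | lia].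
(* The tree of the number [bval s] is the tree of the list [norm s], so the program for [norm] is
   the one sought. *)
case: Hn => p [e P]; exists p, e => call x s a E; have := P call x s a E.
by rewrite normE.
Qed.

(** On the empty list [EHd] yields [Leaf], so only a default encoded by [Leaf] can be returned this
    way. *)
Lemma pt_head (B : encType) (d : B) (f : A -> seq B) :
  encode d = Leaf -> pt f -> pt (fun a => head d (f a)).
Proof.
move=> Hd H; apply: (@pt_comp _ _ _ (fun l => head d l) _ _ H).
apply: (@pt_expr _ _ _ (fun x => EHd (EVar x)) 3) => [s x [|b l] /= ->//|//|].
exists 1%N => -[|a b]; rewrite /pb mul1n expn1 //=; first by rewrite /sz Hd.
by rewrite sz_cons; lia.
Qed.
End Bits.

Ltac ptp := repeat first [exact: pt_id | apply: pt_fst | apply: pt_snd ].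

(** * Ripple-carry arithmetic *)

Section Ripple.
Variables (o cr : bool -> bool -> bool -> bool).

(** [o] gives the output bit and [cr] the carry, so one circuit serves addition, subtraction and
    comparison. Missing bits count as zeros, and [fuel] fixes the number of positions. *)
Fixpoint ripple (fuel : seq bool) c (x y : seq bool) : seq bool :=
  if fuel is _ :: f then
    o c (head false x) (head false y) ::
      ripple f (cr c (head false x) (head false y)) (behead x) (behead y)
  else [::].

Fixpoint rcarry (fuel : seq bool) c (x y : seq bool) : bool :=
  if fuel is _ :: f then
    rcarry f (cr c (head false x) (head false y)) (behead x) (behead y)
  else c.

Definition rstep (st : (bool * (seq bool * seq bool)) * seq bool) (_ : bool) :=
  let c := st.1.1 in let x := st.1.2.1 in let y := st.1.2.2 in
  ((cr c (head false x) (head false y), (behead x, behead y)),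
   o c (head false x) (head false y) :: st.2).

Lemma rstepE fuel c x y out :
  let st := foldl rstep ((c, (x, y)), out) fuel in
  st.1.1 = rcarry fuel c x y /\ st.2 = catrev (ripple fuel c x y) out.
Proof. by elim: fuel c x y out => //= b fuel IH c x y out; apply: IH. Qed.

Lemma pt_bool3 (A : encType) (h : bool -> bool -> bool -> bool) (f g k : A -> bool) :
  pt f -> pt g -> pt k -> pt (fun a => h (f a) (g a) (k a)).
Proof.
move=> F G K.
have P a b : pt (fun x => if k x then h a b true else h a b false).
  by apply: pt_if => //; exact: pt_const.
have P2 a : pt (fun x => if g x then (if k x then h a true true else h a true false)
       else (if k x then h a false true else h a false false)) by apply: pt_if.
apply: (pt_ext (pt_if F (P2 true) (P2 false))) => x.
by case: (f x); case: (g x); case: (k x).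
Qed.

Lemma pt_rfold (A : encType) (c : A -> bool) (x y fuel : A -> seq bool) :
  pt c -> pt x -> pt y -> pt fuel ->
  pt (fun a => foldl rstep ((c a, (x a, y a)), [::]) (fuel a)).
Proof.
move=> Hc Hx Hy Hf.
apply: (@pt_foldl_meas _ bool_encType (prod_encType (prod_encType bool_encType
   (prod_encType (list_encType bool_encType) (list_encType bool_encType))) (list_encType bool_encType))
   (@sz _) (fun=> rstep) (fun a => ((c a, (x a, y a)), [::])) fuel 10%N) => //.
- have Q1 : pt (fun t : A * (bool * (seq bool * seq bool) * seq bool * bool) => t.2.1.1.1) by ptp.
  have Q2 : pt (fun t : A * (bool * (seq bool * seq bool) * seq bool * bool) => t.2.1.1.2.1) by ptp.
  have Q3 : pt (fun t : A * (bool * (seq bool * seq bool) * seq bool * bool) => t.2.1.1.2.2) by ptp.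
  apply: pt_pair.
    apply: pt_pair; last by apply: pt_pair; exact: pt_behead.
    by apply: pt_bool3 => //; apply: pt_head.
  apply: pt_cons; last by ptp.
  by apply: pt_bool3 => //; apply: pt_head.
- by apply: pt_pair; [apply: pt_pair => //; exact: pt_pair | exact: pt_const].
- by move=> s; apply: leq_trans (leqnSn _) _; apply: leq_pb.
- by move=> s; apply: leq_pb.
- move=> a [[c0 [x0 y0]] out] b; apply: (@leq_trans (sz (c0, (x0, y0), out) + 10)); last first.
    by rewrite leq_add2l /pb leq_pmulr // expn_gt0 addn_gt0 sz_gt0.
  have Hb (s : seq bool) : (sz (behead s) <= sz s)%N by case: s => //= b' s; rewrite sz_cons; lia.
  rewrite /rstep /= !sz_pair sz_cons !sz_bool; have := Hb x0; have := Hb y0.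
  by case: ifP; case: ifP; case: (c0); lia.
Qed.

Lemma pt_ripple (A : encType) (c : A -> bool) (x y fuel : A -> seq bool) :
  pt c -> pt x -> pt y -> pt fuel ->
  pt (fun a => ripple (fuel a) (c a) (x a) (y a)).
Proof.
move=> Hc Hx Hy Hf; apply: (pt_ext (pt_rev (pt_snd (pt_rfold Hc Hx Hy Hf)))) => a.
have [_ ->] := rstepE (fuel a) (c a) (x a) (y a) [::].
by rewrite -/(rev _) revK.
Qed.

Lemma pt_rcarry (A : encType) (c : A -> bool) (x y fuel : A -> seq bool) :
  pt c -> pt x -> pt y -> pt fuel ->
  pt (fun a => rcarry (fuel a) (c a) (x a) (y a)).
Proof.
move=> Hc Hx Hy Hf; apply: (pt_ext (pt_fst (pt_fst (pt_rfold Hc Hx Hy Hf)))) => a.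
by have [-> _] := rstepE (fuel a) (c a) (x a) (y a) [::].
Qed.
End Ripple.

Lemma size_ripple o cr fuel c x y : size (ripple o cr fuel c x y) = size fuel.
Proof. by elim: fuel c x y => //= b f IH c x y; rewrite IH. Qed.

Definition xor3 (a b c : bool) := a (+) b (+) c.
Definition maj3 (a b c : bool) := (a && b) || (a && c) || (b && c).
(** The borrow of the one-bit subtraction [b - c - a], where [a] is the incoming borrow. *)
Definition brw3 (a b c : bool) := (~~ b && (a || c)) || (a && c).

Lemma bval_cons x : bval x = (head false x + (bval (behead x)).*2)%N.
Proof. by case: x. Qed.

Lemma drop_beheadr n (x : seq bool) : drop n.+1 x = drop n (behead x).
Proof. by case: x => //=; case: n. Qed.

(** The bits not yet consumed appear with their weight, so the identity holds for every [fuel] and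
    the induction goes through; with enough fuel they vanish. *)
Lemma ripple_addE fuel c x y :
  (bval (ripple xor3 maj3 fuel c x y) +
    2 ^ size fuel * (rcarry maj3 fuel c x y + bval (drop (size fuel) x) + bval (drop (size fuel) y))
   = c + bval x + bval y)%N.
Proof.
elim: fuel c x y => [|b f IH] c x y /=; first by rewrite !drop0 mul1n; lia.
rewrite expnS (bval_cons x) (bval_cons y) !drop_beheadr.
set a := head false x; set d := head false y.
move: (IH (maj3 c a d) (behead x) (behead y)); rewrite -!mul2n -mulnA.
have : (xor3 c a d + 2 * maj3 c a d = c + a + d)%N by case: c; case: a; case: d.
lia.
Qed.

Lemma ripple_subE fuel c x y :
  (bval (ripple xor3 brw3 fuel c x y) + c + bval y +
    2 ^ size fuel * bval (drop (size fuel) x) =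
   bval x + 2 ^ size fuel * (rcarry brw3 fuel c x y + bval (drop (size fuel) y)))%N.
Proof.
elim: fuel c x y => [|b f IH] c x y /=; first by rewrite !drop0 !mul1n; lia.
rewrite expnS (bval_cons x) (bval_cons y) !drop_beheadr.
set a := head false x; set d := head false y.
move: (IH (brw3 c a d) (behead x) (behead y)); rewrite -!mul2n -!mulnA.
have : (xor3 c a d + c + d = a + 2 * brw3 c a d)%N by case: c; case: a; case: d.
lia.
Qed.

Section AddSub.
Variables (A : encType).
Implicit Types (f g : A -> nat).

Lemma pt_addn f g : pt f -> pt g -> pt (fun a => f a + g a)%N.
Proof.
move=> Hf Hg.
have H : pt (fun a => bval (ripple xor3 maj3 (true :: nat_bits (f a) ++ nat_bits (g a)) false
             (nat_bits (f a)) (nat_bits (g a)))).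
  apply: pt_bval; apply: pt_ripple; first exact: pt_const.
  - exact: pt_bits.
  - exact: pt_bits.
  by apply: pt_cons; [exact: pt_const | apply: pt_cat; exact: pt_bits].
apply: (pt_ext H) => a; set x := nat_bits _; set y := nat_bits (g a).
have := ripple_addE (true :: x ++ y) false x y.
rewrite !drop_oversize /=; try by rewrite size_cat; lia.
rewrite /x /y !nat_bitsK; set r := bval _; set c := rcarry _ _ _ _ _.
have := ltn_bl (f a); have := ltn_bl (g a); rewrite /bl -/x -/y.
rewrite size_cat expnS expnD.
have : (0 < 2 ^ size x)%N by rewrite expn_gt0.
have : (0 < 2 ^ size y)%N by rewrite expn_gt0.
move: (2 ^ size x)%N (2 ^ size y)%N => X Y; case: c; last by lia.
nia.
Qed.

(** By [ripple_subE] the output is the difference plus [2 ^ L] times the final borrow, for [L]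
    positions in all, and it lies between 0 and [2 ^ L]. *)
Lemma leq_carry x y :
  (bval y <= bval x)%N = ~~ rcarry brw3 (x ++ y) false x y.
Proof.
have := ripple_subE (x ++ y) false x y.
rewrite !drop_oversize /= ?size_cat; try lia.
have := bval_lt (ripple xor3 brw3 (x ++ y) false x y).
have -> : size (ripple xor3 brw3 (x ++ y) false x y) = (size x + size y)%N.
  by rewrite -size_cat size_ripple.
by case: (rcarry _ _ _ _ _) => /=; lia.
Qed.

Lemma pt_leq f g : pt f -> pt g -> pt (fun a => f a <= g a)%N.
Proof.
move=> Hf Hg.
have H : pt (fun a => ~~ rcarry brw3 (nat_bits (g a) ++ nat_bits (f a)) false
             (nat_bits (g a)) (nat_bits (f a))).
  apply: pt_not; apply: (@pt_rcarry xor3); first exact: pt_const.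
  - exact: pt_bits.
  - exact: pt_bits.
  by apply: pt_cat; exact: pt_bits.
by apply: (pt_ext H) => a; rewrite -leq_carry !nat_bitsK.
Qed.

Lemma pt_subn f g : pt f -> pt g -> pt (fun a => f a - g a)%N.
Proof.
move=> Hf Hg.
have H : pt (fun a => if (g a <= f a)%N then
   bval (ripple xor3 brw3 (nat_bits (f a) ++ nat_bits (g a)) false
             (nat_bits (f a)) (nat_bits (g a))) else 0%N).
  apply: pt_if; [exact: pt_leq | | exact: pt_const].
  apply: pt_bval; apply: pt_ripple; first exact: pt_const.
  - exact: pt_bits.
  - exact: pt_bits.
  by apply: pt_cat; exact: pt_bits.
apply: (pt_ext H) => a; case: leqP => Hle; last by lia.
have := ripple_subE (nat_bits (f a) ++ nat_bits (g a)) false (nat_bits (f a)) (nat_bits (g a)).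
have := leq_carry (nat_bits (f a)) (nat_bits (g a)); rewrite !nat_bitsK Hle.
case: (rcarry _ _ _ _ _) => //= _.
by rewrite !drop_oversize /= ?size_cat; lia.
Qed.

Lemma pt_ltn f g : pt f -> pt g -> pt (fun a => f a < g a)%N.
Proof. by move=> Hf Hg; apply: (pt_ext (pt_not (pt_leq Hg Hf))) => a; rewrite ltnNge. Qed.

Lemma pt_eqn f g : pt f -> pt g -> pt (fun a => f a == g a)%N.
Proof.
move=> Hf Hg; apply: (pt_ext (pt_and (pt_leq Hf Hg) (pt_leq Hg Hf))) => a.
by rewrite eqn_leq.
Qed.

Lemma pt_succ f : pt f -> pt (fun a => (f a).+1).
Proof. by move=> Hf; apply: (pt_ext (pt_addn Hf (pt_const 1%N))) => a; rewrite addn1. Qed.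

Lemma pt_pred f : pt f -> pt (fun a => (f a).-1).
Proof. by move=> Hf; apply: (pt_ext (pt_subn Hf (pt_const 1%N))) => a; rewrite subn1. Qed.
End AddSub.

(** Shift-and-add multiplication: the second component is the multiplicand, doubled once per bit. *)
Definition mstep (st : nat * nat) (b : bool) : nat * nat :=
  ((if b then st.1 + st.2 else st.1), st.2 + st.2)%N.

Lemma mstepE s acc y :
  foldl mstep (acc, y) s = (acc + bval s * y, 2 ^ size s * y)%N.
Proof.
elim: s acc y => [|b s IH] acc y /=; first by rewrite mul0n addn0 mul1n.
by rewrite IH expnS -muln2; case: b => /=; congr pair; ring.
Qed.

(** Long division: [st] holds the quotient and the remainder so far, and [b] is the next bit, most
    significant first. *)
Definition dstep (d : nat) (st : nat * nat) (b : bool) : nat * nat :=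
  let r := (st.2 + st.2 + b)%N in
  if (d <= r)%N then ((st.1 + st.1).+1, r - d)%N else ((st.1 + st.1)%N, r).

Lemma dstepE d s q r : (r < d)%N ->
  let st := foldr (fun b st => dstep d st b) (q, r) s in
  (st.1 * d + st.2 = 2 ^ size s * (q * d + r) + bval s)%N /\ (st.2 < d)%N.
Proof.
move=> Hr; elim: s => [|b s [IH1 IH2]] /=; first by lia.
move: IH1 IH2; case: (foldr _ _ _) => q1 r1 /= IH1 IH2.
rewrite expnS -mulnA /dstep /=; case: (leqP d (r1 + r1 + b)) => H /=; split;
  rewrite ?(mulSn (q1 + q1)) ?(mulnDl q1);
  move: IH1; move: (_ ^ _ * _)%N (q1 * d)%N => X Y; case: b H => /=; rewrite ?mulSn ?mul0n; lia.
Qed.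

Section MulDiv.
Variables (A : encType).
Implicit Types (f g : A -> nat).

Lemma pt_muln f g : pt f -> pt g -> pt (fun a => f a * g a)%N.
Proof.
move=> Hf Hg.
have H : pt (fun a => (foldl mstep (0%N, g a) (nat_bits (f a))).1).
  apply: pt_fst; apply: (@pt_foldl _ bool_encType _ (fun=> mstep)
     (fun a => (0%N, g a)) (fun a => nat_bits (f a))).
  - apply: pt_pair; last by apply: pt_addn; ptp.
    by apply: pt_if; ptp; apply: pt_addn; ptp.
  - by apply: pt_pair => //; exact: pt_const.
  - exact: pt_bits.
  have [e1 E1] := pt_size Hf; have [e2 E2] := pt_size Hg.
  have [e He] : poly (fun n => 8 * (pb e1 n + pb e2 n) + 10)%N by solve_poly.
  exists e => a i; apply: leq_trans (He _ (sz_gt0 a)).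
  set s : seq bool := take _ _; rewrite mstepE sz_pair.
  have Hs : (size s <= bl (f a))%N by rewrite /s size_take_min geq_minr.
  have B1 : (sz (0 + bval s * g a)%N <= 4 * (size s + bl (g a)) + 1)%N.
    apply: sz_nat_lt; rewrite expnD; have := bval_lt s; have := ltn_bl (g a).
    by move: (2 ^ size s)%N (2 ^ bl (g a))%N => X Y; nia.
  have B2 : (sz (2 ^ size s * g a)%N <= 4 * (size s + bl (g a)) + 1)%N.
    apply: sz_nat_lt; rewrite expnD ltn_mul2l expn_gt0 /=; exact: ltn_bl.
  have := bl_sz (f a); have := bl_sz (g a); have := E1 a; have := E2 a; lia.
by apply: (pt_ext H) => a; rewrite mstepE nat_bitsK add0n.
Qed.

Lemma pt_divn f g : pt f -> pt g -> pt (fun a => f a %/ g a)%N.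
Proof.
move=> Hf Hg.
(* A zero divisor is replaced by 1 to keep the remainder bounded along the loop; the value 0 that
   [divn] then has comes from the outer test. *)
have Hge : pt (fun a => if g a == 0%N then 1%N else g a).
  by apply: pt_if; [apply: pt_eqn => //; exact: pt_const | exact: pt_const |].
set g' := (fun a => if g a == 0%N then 1%N else g a) in Hge.
have Hg' a : (0 < g' a)%N by rewrite /g'; case: ifP => //; case: (g a).
have H : pt (fun a => if g a == 0%N then 0%N
          else (foldl (dstep (g' a)) (0%N, 0%N) (rev (nat_bits (f a)))).1).
  apply: pt_if; [by apply: pt_eqn => //; exact: pt_const | exact: pt_const |].
  apply: pt_fst; apply: (@pt_foldl _ bool_encType _ (fun a => dstep (g' a))
     (fun a => (0%N, 0%N)) (fun a => rev (nat_bits (f a)))).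
  - have P1 : pt (fun x : A * (nat * nat * bool) => x.2.1.2 + x.2.1.2 + x.2.2)%N.
      apply: pt_addn; first by apply: pt_addn; ptp.
      apply: (pt_ext (pt_if (b := fun x : A * (nat * nat * bool) => x.2.2)
          _ (pt_const 1%N) (pt_const 0%N))); first by ptp.
      by move=> x; case: x.2.2.
    have P2 : pt (fun x : A * (nat * nat * bool) => g' x.1).
      by apply: (@pt_comp _ _ _ g' fst) => //; ptp.
    apply: pt_if; first exact: pt_leq.
      apply: pt_pair; last exact: pt_subn.
      by apply: pt_succ; apply: pt_addn; ptp.
    by apply: pt_pair => //; apply: pt_addn; ptp.
  - exact: pt_const.
  - by apply: pt_rev; exact: pt_bits.
  have [e1 E1] := pt_size Hf; have [e2 E2] := pt_size Hge.
  have [e He] : poly (fun n => 8 * (pb e1 n + pb e2 n) + 10)%N by solve_poly.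
  exists e => a i; apply: leq_trans (He _ (sz_gt0 a)).
  set s : seq bool := take _ _; rewrite -[s]revK foldl_rev.
  have [] := @dstepE (g' a) (rev s) 0 0 (Hg' a).
  case: (foldr _ _ _) => q r /= Hq Hr; rewrite sz_pair.
  have Hs : (size s <= bl (f a))%N by rewrite /s size_take_min size_rev geq_minr.
  have B1 : (sz q <= 4 * size s + 1)%N.
    apply: sz_nat_lt; have := bval_lt (rev s); rewrite size_rev; have := Hg' a.
    by move: Hq; rewrite mul0n addn0 muln0 add0n; nia.
  have B2 : (sz r <= 4 * bl (g' a) + 1)%N.
    by apply: sz_nat_lt; apply: ltn_trans Hr (ltn_bl _).
  have := bl_sz (f a); have := bl_sz (g' a); have := E1 a; have := E2 a; lia.
apply: (pt_ext H) => a; rewrite foldl_rev; case: eqP => [->|/eqP Hn]; first by rewrite divn0.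
have [] := @dstepE (g' a) (nat_bits (f a)) 0 0 (Hg' a).
have -> : g' a = g a by rewrite /g' (negbTE Hn).
case: (foldr _ _ _) => q r /=; rewrite nat_bitsK mul0n addn0 muln0 add0n => <- Hr.
by rewrite divnMDl ?(divn_small Hr) ?addn0 //; lia.
Qed.
End MulDiv.

Lemma pt_size2 (A B C : encType) (g : A -> B -> C) :
  pt (fun x : A * B => g x.1 x.2) ->
  exists e, forall a b, (sz (g a b) <= pb e (sz a + sz b))%N.
Proof.
move=> /pt_size[e E].
have [e' He] : poly (fun n => pb e n.+1) by solve_poly.
exists e' => a b; apply: leq_trans (E (a, b)) _.
by rewrite sz_pair; apply: He; rewrite addn_gt0 sz_gt0.
Qed.

Section NatFold.
Variables (A B : encType).

Lemma pt_foldl_nat (g : A -> nat -> B -> nat) (init : A -> nat) (l : A -> seq B) e :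
  pt (fun x : A * (nat * B) => g x.1 x.2.1 x.2.2) -> pt init -> pt l ->
  (forall a s b, bl (g a s b) <= bl s + pb e (sz a + sz b))%N ->
  pt (fun a => foldl (g a) (init a) (l a)).
Proof.
move=> Hg Hi Hl H.
apply: (@pt_foldl_meas _ _ nat_encType bl g init l (e + 5)) => //.
- move=> s; apply: leq_trans (sz_nat s) _; apply: (@leq_trans (5 * (bl s).+1)); first lia.
  rewrite /pb; apply: leq_mul; first lia.
  by rewrite addnS expnS leq_pmulr // expn_gt0.
- by move=> s; apply: leq_trans (ltnW (bl_sz s)) _; apply: leq_pb; lia.
- move=> a s b; apply: leq_trans (H a s b) _; rewrite leq_add2l.
  by apply: pb_leq; rewrite ?leq_addr // addn_gt0 sz_gt0.
Qed.

End NatFold.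

Section SumProd.
Variables (A B : encType).

Lemma pt_foldr_nat (g : A -> B -> nat -> nat) (init : A -> nat) (l : A -> seq B) e :
  pt (fun x : A * (nat * B) => g x.1 x.2.2 x.2.1) -> pt init -> pt l ->
  (forall a s b, bl (g a b s) <= bl s + pb e (sz a + sz b))%N ->
  pt (fun a => foldr (g a) (init a) (l a)).
Proof.
move=> Hg Hi Hl H.
have := @pt_foldl_nat _ _ (fun a s b => g a b s) init (fun a => rev (l a)) e Hg Hi (pt_rev Hl) H.
by move=> H1; apply: (pt_ext H1) => a; rewrite foldl_rev.
Qed.

Lemma pt_sum (g : A -> B -> nat) (l : A -> seq B) :
  pt (fun x : A * B => g x.1 x.2) -> pt l -> pt (fun a => \sum_(b <- l a) g a b)%N.
Proof.
move=> Hg Hl; have [e E] := pt_size2 Hg.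
have Hg' : pt (fun x : A * (nat * B) => g x.1 x.2.2).
  exact: (pt_comp (f := fun x : A * (nat * B) => (x.1, x.2.2)) Hg
      (pt_pair (pt_fst pt_id) (pt_snd (pt_snd pt_id)))).
have H : pt (fun a => foldr (fun b s => g a b + s)%N 0%N (l a)).
  apply: (@pt_foldr_nat (fun a b s => g a b + s)%N (fun=> 0%N) l e) => //.
  - by apply: pt_addn; ptp.
  - exact: pt_const.
  - move=> a s b; apply: leq_trans (blD _ _) _; rewrite addnC leq_add2l.
    by apply: leq_trans (ltnW (bl_sz _)) (E a b).
by apply: (pt_ext H) => a; elim: (l a) => [|b s IH]; rewrite ?big_nil ?big_cons //= IH.
Qed.

Lemma pt_prod (g : A -> B -> nat) (l : A -> seq B) :
  pt (fun x : A * B => g x.1 x.2) -> pt l -> pt (fun a => \prod_(b <- l a) g a b)%N.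
Proof.
move=> Hg Hl; have [e E] := pt_size2 Hg.
have Hg' : pt (fun x : A * (nat * B) => g x.1 x.2.2).
  exact: (pt_comp (f := fun x : A * (nat * B) => (x.1, x.2.2)) Hg
      (pt_pair (pt_fst pt_id) (pt_snd (pt_snd pt_id)))).
have H : pt (fun a => foldr (fun b s => g a b * s)%N 1%N (l a)).
  apply: (@pt_foldr_nat (fun a b s => g a b * s)%N (fun=> 1%N) l e) => //.
  - by apply: pt_muln; ptp.
  - exact: pt_const.
  - move=> a s b; apply: leq_trans (blM _ _) _; rewrite addnC leq_add2l.
    by apply: leq_trans (ltnW (bl_sz _)) (E a b).
by apply: (pt_ext H) => a; elim: (l a) => [|b s IH]; rewrite ?big_nil ?big_cons //= IH.
Qed.

Lemma pt_filter (p : A -> B -> bool) (l : A -> seq B) :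
  pt (fun x : A * B => p x.1 x.2) -> pt l -> pt (fun a => [seq b <- l a | p a b]).
Proof.
move=> Hp Hl.
have Hp' : pt (fun x : A * (seq B * B) => p x.1 x.2.2).
  exact: (pt_comp (f := fun x : A * (seq B * B) => (x.1, x.2.2)) Hp
      (pt_pair (pt_fst pt_id) (pt_snd (pt_snd pt_id)))).
have H : pt (fun a => foldr (fun b s => if p a b then b :: s else s) [::] (l a)).
  apply: (@pt_foldr_meas _ _ (list_encType _) (@sz _)
    (fun a b s => if p a b then b :: s else s) (fun=> [::]) l 1%N) => //.
  - by apply: pt_if => //; [apply: pt_cons|]; ptp.
  - exact: pt_const.
  - by move=> s; rewrite /pb mul1n expn1.
  - by move=> s; rewrite /pb mul1n expn1.
  - move=> a s b; rewrite /pb mul1n expn1; have := sz_gt0 a.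
    by case: ifP; rewrite ?sz_cons; lia.
exact: H.
Qed.
End SumProd.

Section Zip.
Variables (A B C : encType) (d : C).
Hypothesis Hd : encode d = Leaf.

(** The fold runs along the first list, and its state carries the reversed output and what is left
    of the second list. *)
Definition zstep (st : seq (B * C) * seq C) (b : B) :=
  if nilp st.2 then st else ((b, head d st.2) :: st.1, behead st.2).

Lemma zstepE (l : seq B) r out :
  (foldl zstep (out, r) l).1 = catrev (zip l r) out.
Proof.
elim: l r out => [|b l IH] [|c r] out //=; last by rewrite -IH.
by elim: l {IH} => //=.
Qed.

Lemma pt_zip (f : A -> seq B) (g : A -> seq C) :
  pt f -> pt g -> pt (fun a => zip (f a) (g a)).
Proof.
move=> Hf Hg.
have H : pt (fun a => foldl zstep ([::], g a) (f a)).
  apply: (@pt_foldl_meas _ _ (prod_encType (list_encType (prod_encType B C)) (list_encType C))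
    (@sz _) (fun=> zstep) (fun a => ([::], g a)) f 5%N) => //.
  - apply: pt_if; first by apply: pt_nilp; ptp.
      by ptp.
    apply: pt_pair; last by apply: pt_behead; ptp.
    apply: pt_cons; last by ptp.
    by apply: pt_pair; [ptp | apply: pt_head => //; ptp].
  - by apply: pt_pair => //; exact: pt_const.
  - by move=> s; apply: leq_trans (leqnSn _) _; apply: leq_pb.
  - by move=> s; apply: leq_pb.
  - move=> a [out r] b; apply: (@leq_trans (sz (out, r) + (sz a + sz b) * 5)); last first.
      rewrite leq_add2l mulnC /pb leq_mul2l /= -{1}[(sz a + sz b)%N]expn1 leq_pexp2l //.
      by rewrite addn_gt0 sz_gt0.
    rewrite /zstep /=; case: r => [|c r] /=; first by lia.
    by have := sz_gt0 a; rewrite !sz_pair !sz_cons sz_pair; lia.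
apply: (pt_ext (pt_rev (pt_fst H))) => a.
by rewrite zstepE -/(rev _) revK.
Qed.
End Zip.

(** * Iteration counted in unary *)

Section Traject.
Variables (A U : encType).

Lemma pt_traject (g : A -> nat -> nat) (x : A -> nat) (fuel : A -> seq U) :
  pt (fun y : A * nat => g y.1 y.2) -> pt x -> pt fuel ->
  (exists e, forall a i, (i <= size (fuel a))%N -> (sz (iter i (g a) (x a)) <= pb e (sz a))%N) ->
  pt (fun a => traject (g a) (x a) (size (fuel a))).
Proof.
move=> Hg Hx Hf [e He].
pose tstep a (st : nat * seq nat) (_ : U) := (g a st.1, st.1 :: st.2).
have E (a : A) (l : seq U) y out :
    foldl (tstep a) (y, out) l = (iter (size l) (g a) y, catrev (traject (g a) y (size l)) out).
  by elim: l y out => //= b l IH y out; rewrite IH -iterSr.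
have H : pt (fun a => foldl (tstep a) (x a, [::]) (fuel a)).
  apply: (@pt_foldl _ _ (prod_encType nat_encType (list_encType nat_encType)) tstep
     (fun a => (x a, [::])) fuel) => //.
  - apply: pt_pair; last by apply: pt_cons; ptp.
    exact: (pt_comp (f := fun x : A * (nat * seq nat * U) => (x.1, x.2.1.1)) Hg
      (pt_pair (pt_fst pt_id) (pt_fst (pt_fst (pt_snd pt_id))))).
  - by apply: pt_pair => //; exact: pt_const.
  have [e1 E1] := pt_size Hf.
  have [e2 E2] : poly (fun n => pb e n + (pb e1 n * (pb e n).+1).+1 + 1)%N by solve_poly.
  exists e2 => a i; apply: leq_trans (E2 _ (sz_gt0 a)).
  rewrite E sz_pair; set s := take _ _.
  have Hs : (size s <= size (fuel a))%N by rewrite /s size_take_min geq_minr.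
  have /= B1 := He a _ Hs.
  have B2 : (sz (catrev (traject (g a) (x a) (size s)) [::]) <=
     (size s * (pb e (sz a)).+1).+1)%N.
    have El : size (rev (traject (g a) (x a) (size s))) = size s by rewrite size_rev size_traject.
    rewrite -{2}El; apply: sz_seq_le => j y0; rewrite El => Hj.
    rewrite nth_rev ?size_traject // (set_nth_default (x a)) ?size_traject; last by lia.
    by rewrite nth_traject; [apply: He; lia | lia].
  have : (size s * (pb e (sz a)).+1 <= pb e1 (sz a) * (pb e (sz a)).+1)%N.
    rewrite leq_mul2r /=; have := size_sz (fuel a); have := E1 a; lia.
  by lia.
apply: (pt_ext (pt_rev (pt_snd H))) => a.
by rewrite E /= -/(rev _) revK.
Qed.

Lemma pt_traject_addn (d x : A -> nat) (fuel : A -> seq U) :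
  pt d -> pt x -> pt fuel -> pt (fun a => traject (addn (d a)) (x a) (size (fuel a))).
Proof.
move=> Hd Hx Hf; apply: pt_traject => //.
  apply: pt_addn; last by ptp.
  exact: (pt_comp (f := fun x : A * nat => x.1) Hd (pt_fst pt_id)).
have [e1 E1] := pt_size Hf; have [e2 E2] := pt_size Hd; have [e3 E3] := pt_size Hx.
have [e He] : poly (fun n => 4 * (pb e1 n + pb e2 n + pb e3 n) + 1)%N by solve_poly.
exists e => a i Hi; apply: leq_trans (He _ (sz_gt0 a)).
rewrite iter_addn; apply: leq_trans (sz_nat _) _; rewrite leq_add2r leq_mul2l /=.
apply: leq_trans (blD _ _) _; apply: leq_trans (leq_add (blM _ _) (leqnn _)) _.
have := bl_sz (d a); have := bl_sz (x a); have := E1 a; have := E2 a; have := E3 a.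
have : (bl i <= sz (fuel a))%N.
  apply: bl_min; apply: ltn_trans (ltn_expl _ (ltnSn 1)).
  by apply: leq_ltn_trans Hi (size_sz _).
lia.
Qed.

Lemma pt_traject_muln (d : A -> nat) (fuel : A -> seq U) :
  pt d -> pt fuel -> pt (fun a => traject (muln (d a)) 1%N (size (fuel a))).
Proof.
move=> Hd Hf; apply: (@pt_traject (fun a => muln (d a)) (fun=> 1%N)) => //.
- apply: pt_muln; last by ptp.
  exact: (pt_comp (f := fun x : A * nat => x.1) Hd (pt_fst pt_id)).
- exact: pt_const.
have [e1 E1] := pt_size Hf; have [e2 E2] := pt_size Hd.
have [e He] : poly (fun n => 4 * (pb e1 n * pb e2 n + 1) + 1)%N by solve_poly.
exists e => a i Hi; apply: leq_trans (He _ (sz_gt0 a)).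
apply: leq_trans (sz_nat _) _; rewrite leq_add2r leq_mul2l /=.
have Hi' : (i <= pb e1 (sz a))%N by have := size_sz (fuel a); have := E1 a; lia.
have Hb : (bl (d a) <= pb e2 (sz a))%N by have := bl_sz (d a); have := E2 a; lia.
apply: (@leq_trans (i * bl (d a) + 1)); last by rewrite leq_add2r leq_mul.
elim: i {Hi Hi'} => [|i IH] /=; first by apply: bl_min.
by apply: leq_trans (blM _ _) _; rewrite mulSn -addnA leq_add2l.
Qed.

End Traject.

Section Misc.
Variables (A B : encType).

Lemma pt_sizen (f : A -> seq B) : pt f -> pt (fun a => size (f a)).
Proof.
move=> Hf; apply: (pt_ext (pt_sum (g := fun=> fun=> 1%N) _ Hf)) => [|a]; first exact: pt_const.
by rewrite big_const_seq count_predT iter_addn_0 mul1n.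
Qed.

Lemma pt_expn (f : A -> nat) (u : A -> seq B) :
  pt f -> pt u -> pt (fun a => f a ^ size (u a))%N.
Proof.
move=> Hf Hu; apply: (pt_ext (pt_prod (g := fun a _ => f a) _ Hu)) => [|a].
  exact: (pt_comp (f := fun x : A * B => x.1) Hf (pt_fst pt_id)).
by rewrite big_const_seq count_predT iter_muln_1.
Qed.

End Misc.

(** * Truncated sums of independent trials *)

Section Bernoulli.
Local Open Scope ring_scope.
Implicit Types (ps qs : seq rat) (f g : nat -> rat).

(* Expectation of [f] at the number of successes of independent trials with
   success probabilities [ps]. *)
Fixpoint ebern ps f : rat :=
  if ps is p :: ps' then (1 - p) * ebern ps' f + p * ebern ps' (fun c => f c.+1)
  else f 0%N.

Definition in01 (p : rat) := (0 <= p) && (p <= 1).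

Lemma eq_ebern ps f g : f =1 g -> ebern ps f = ebern ps g.
Proof.
elim: ps f g => [|p ps IH] f g H /=; first exact: H.
by rewrite (IH f g) // (IH (fun c => f c.+1) (fun c => g c.+1)).
Qed.

Lemma ebern_lin ps f g a b :
  ebern ps (fun c => a * f c + b * g c) = a * ebern ps f + b * ebern ps g.
Proof.
elim: ps f g => [|p ps IH] f g //=.
by rewrite IH (IH (fun c => f c.+1)); ring.
Qed.

Lemma ebern_cst ps a : ebern ps (fun=> a) = a.
Proof. by elim: ps => //= p ps ->; ring. Qed.

Lemma ebern_mono ps f g : all in01 ps -> (forall c, f c <= g c) -> ebern ps f <= ebern ps g.
Proof.
elim: ps f g => [|p ps IH] f g /=; first by move=> _ H; apply: H.
case/andP => /andP[p0 p1] Hps H; apply: lerD; apply: ler_wpM2l => //; last first.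
- by apply: IH.
- by apply: IH.
- by rewrite subr_ge0.
Qed.

Definition lam ps : rat := \sum_(p <- ps) p.

Lemma lam_ge0 ps : all in01 ps -> 0 <= lam ps.
Proof.
rewrite /lam; elim: ps => [|p ps IH] /=; first by rewrite big_nil.
by case/andP => /andP[p0 _] /IH H; rewrite big_cons addr_ge0.
Qed.

(** Variance plus squared bias. All concentration estimates below rest on this identity. *)
Lemma ebern_sqr ps x :
  ebern ps (fun c => (c%:R - x) ^+ 2) = \sum_(p <- ps) p * (1 - p) + (lam ps - x) ^+ 2.
Proof.
rewrite /lam; elim: ps x => [|p ps IH] x /=; first by rewrite !big_nil; ring.
rewrite !big_cons IH (@eq_ebern _ _ (fun c => (c%:R - (x - 1)) ^+ 2)); last first.
  by move=> c; rewrite -addn1 natrD; ring.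
rewrite IH; move: (\sum_(p <- ps) p * _) (\sum_(p <- ps) p) => A B; ring.
Qed.

Lemma ebern_id ps : ebern ps (fun c => c%:R) = lam ps.
Proof.
rewrite /lam; elim: ps => [|p ps IH] /=; first by rewrite big_nil.
rewrite big_cons IH (@eq_ebern _ _ (fun c => 1 * c%:R + 1 * (fun=> 1) c)); last first.
  by move=> c; rewrite -addn1 natrD; ring.
by rewrite ebern_lin ebern_cst IH; ring.
Qed.

Lemma var_le ps : all in01 ps -> \sum_(p <- ps) p * (1 - p) <= lam ps.
Proof.
rewrite /lam; elim: ps => [|p ps IH] /=; first by rewrite !big_nil.
case/andP => /andP[p0 p1] /IH H; rewrite !big_cons; apply: lerD => //.
by rewrite ler_piMr //; lra.
Qed.

Lemma ebern_quad ps (a b : rat) : all in01 ps -> 0 <= a ->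
  ebern ps (fun c => a * (c%:R - lam ps) ^+ 2 + b) <= a * lam ps + b.
Proof.
move=> H a0.
rewrite (@eq_ebern _ _ (fun c => a * (c%:R - lam ps) ^+ 2 + b * (fun=> 1) c)); last first.
  by move=> c; rewrite mulr1.
rewrite ebern_lin ebern_cst mulr1 lerD2r ler_wpM2l // ebern_sqr subrr expr0n /= addr0.
exact: var_le.
Qed.

Definition etrunc k ps := ebern ps (fun c => (minn k c)%:R).

Lemma minn_leR k c : (minn k c)%:R <= c%:R :> rat.
Proof. by rewrite ler_nat geq_minr. Qed.

Lemma minn_lekR k c : (minn k c)%:R <= k%:R :> rat.
Proof. by rewrite ler_nat geq_minl. Qed.

Lemma etrunc_ge0 k ps : all in01 ps -> 0 <= etrunc k ps.
Proof.
move=> H; rewrite -(ebern_cst ps 0); apply: ebern_mono => // c; exact: ler0n.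
Qed.

Lemma etrunc_lek k ps : all in01 ps -> etrunc k ps <= k%:R.
Proof.
move=> H; rewrite -[leRHS](ebern_cst ps); apply: ebern_mono => // c; exact: minn_lekR.
Qed.

Lemma etrunc_lelam k ps : all in01 ps -> etrunc k ps <= lam ps.
Proof.
move=> H; rewrite -ebern_id; apply: ebern_mono => // c; exact: minn_leR.
Qed.

(** Only the mean and the variance of the count are at hand, so the loss by truncation is dominated
    by a quadratic in [c - lam ps], whose expectation is at most [a * lam ps + b]. *)
Lemma etrunc_lam_defect k ps (a b : rat) : all in01 ps -> 0 <= a ->
  (forall c : nat, c%:R - (minn k c)%:R <= a * (c%:R - lam ps) ^+ 2 + b) ->
  lam ps - (a * lam ps + b) <= etrunc k ps.
Proof.
move=> H a0 Hab; have := ebern_mono H Hab.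
rewrite (@eq_ebern _ _ (fun c => 1 * c%:R + (-1) * (minn k c)%:R)); last first.
  by move=> c; ring.
rewrite ebern_lin ebern_id -/(etrunc k ps); have := ebern_quad b H a0; lra.
Qed.

Lemma etrunc_k_defect k ps (a b : rat) : all in01 ps -> 0 <= a ->
  (forall c : nat, k%:R - (minn k c)%:R <= a * (c%:R - lam ps) ^+ 2 + b) ->
  k%:R - (a * lam ps + b) <= etrunc k ps.
Proof.
move=> H a0 Hab; have := ebern_mono H Hab.
rewrite (@eq_ebern _ _ (fun c => k%:R * (fun=> 1) c + (-1) * (minn k c)%:R)); last first.
  by move=> c; ring.
rewrite ebern_lin ebern_cst -/(etrunc k ps); have := ebern_quad b H a0; lra.
Qed.

Lemma minnRP k c : ((minn k c)%:R = c%:R :> rat /\ (c%:R : rat) <= k%:R) \/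
  ((minn k c)%:R = k%:R :> rat /\ (k%:R : rat) <= c%:R).
Proof.
by case: (leqP k c) => H; [right|left]; rewrite !ler_nat; split => //; exact: ltnW.
Qed.

(** Replaces a square root: a deviation is bounded by its square through the arithmetic-geometric
    mean inequality, with a free scale [t]. *)
Lemma amgm (y t : rat) : 0 < t -> y <= (4 * t)^-1 * y ^+ 2 + t.
Proof.
move=> t0; have -> : (4 * t)^-1 * y ^+ 2 + t = y + (4 * t)^-1 * (y - 2 * t) ^+ 2.
  by field; lra.
by rewrite lerDl mulr_ge0 ?sqr_ge0 // invr_ge0; lra.
Qed.

(** Cases by the position of the mean [L]. Up to [2 k] the scale in [amgm] is [e k], and
    [1 <= 4 e^2 k] makes the coefficient of the quadratic at most [e]. Beyond [2 k] the scale
    [L - k] gives a loss of at most 1/2, which is at most [e k]. *)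
Lemma etrunc_large k ps (e : rat) : all in01 ps -> 0 < e <= 2^-1 ->
  1 <= 4 * e ^+ 2 * k%:R -> (1 - 3 * e) * Num.min k%:R (lam ps) <= etrunc k ps.
Proof.
move=> H /andP[e0 e1] Hk; set L := lam ps; have L0 : 0 <= L := lam_ge0 H.
have k0 : 0 < k%:R :> rat.
  by rewrite ltr0n; case: (k) Hk => //; rewrite mulr0; lra.
have ek0 : 0 < e * k%:R by apply: mulr_gt0.
have i1 : (4 * (e * k%:R))^-1 <= e.
  rewrite -[leLHS]mul1r ler_pdivrMr; last by lra.
  by apply: le_trans Hk _; rewrite expr2 le_eqVlt; apply/orP; left; apply/eqP; ring.
have i0 : 0 <= (4 * (e * k%:R))^-1 by rewrite invr_ge0; lra.
have iL : (4 * (e * k%:R))^-1 * L <= e * L by apply: ler_wpM2r.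
have pos (n : nat) : 0 <= n%:R :> rat by exact: ler0n.
have [Lk|kL] := leP L k%:R.
  have [far|near] := leP L (k%:R - e * k%:R).
    have B : forall c : nat, c%:R - (minn k c)%:R <= (4 * (e * k%:R))^-1 * (c%:R - L) ^+ 2 + 0.
      move=> c; have [[-> _]|[-> ck]] := minnRP k c.
        by rewrite subrr addr0 mulr_ge0 ?sqr_ge0.
      have := @amgm (c%:R - L) (e * k%:R) ek0; lra.
    by have := etrunc_lam_defect H i0 B; rewrite -/L; nra.
  have B : forall c : nat, c%:R - (minn k c)%:R <= (4 * (e * k%:R))^-1 * (c%:R - L) ^+ 2 + e * k%:R.
    move=> c; have [[-> _]|[-> ck]] := minnRP k c.
      by rewrite subrr; have := mulr_ge0 i0 (sqr_ge0 (c%:R - L)); lra.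
    have := @amgm (c%:R - L) (e * k%:R) ek0; lra.
  have := etrunc_lam_defect H i0 B; rewrite -/L.
  have : e * k%:R <= e * (2 * L) by rewrite ler_wpM2l //; nra.
  lra.
have ek2 : 2^-1 <= e * k%:R by nra.
have [near|far] := leP L (2 * k%:R).
  have B : forall c : nat, k%:R - (minn k c)%:R <= (4 * (e * k%:R))^-1 * (c%:R - L) ^+ 2 + e * k%:R.
    move=> c; have [[-> ck]|[-> ck]] := minnRP k c; last first.
      by rewrite subrr; have := mulr_ge0 i0 (sqr_ge0 (c%:R - L)); lra.
    have := @amgm (L - c%:R) (e * k%:R) ek0; rewrite -sqrrN opprB; lra.
  have := etrunc_k_defect H i0 B; rewrite -/L; nra.
have a0 : 0 < L - k%:R by lra.
have j0 : 0 <= (4 * (L - k%:R))^-1 by rewrite invr_ge0; lra.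
have B : forall c : nat, k%:R - (minn k c)%:R <= (4 * (L - k%:R))^-1 * (c%:R - L) ^+ 2 + 0.
  move=> c; have [[-> ck]|[-> ck]] := minnRP k c; last first.
    by rewrite subrr; have := mulr_ge0 j0 (sqr_ge0 (c%:R - L)); lra.
  have := @amgm (L - c%:R) (L - k%:R) a0; rewrite -sqrrN opprB; lra.
have := etrunc_k_defect H j0 B; rewrite -/L addr0.
have : (4 * (L - k%:R))^-1 * L <= 2^-1.
  rewrite mulrC ler_pdivrMr; lra.
lra.
Qed.

(** Chebyshev's inequality: a count below [k] deviates from the mean by more than [lam ps - k],
    which is at least half the mean. *)
Lemma etrunc_saturated k ps : all in01 ps -> 2 * k%:R < lam ps ->
  k%:R - 4 * k%:R / lam ps <= etrunc k ps.
Proof.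
move=> H; set L := lam ps => kL.
have k0 : 0 <= k%:R :> rat by exact: ler0n.
have a0 : 0 < L - k%:R by lra.
have L0 : 0 < L by lra.
have j0 : 0 <= k%:R / (L - k%:R) ^+ 2 by rewrite divr_ge0 ?sqr_ge0.
have B : forall c : nat, k%:R - (minn k c)%:R <= k%:R / (L - k%:R) ^+ 2 * (c%:R - L) ^+ 2 + 0.
  move=> c; have [[-> ck]|[-> ck]] := minnRP k c; last first.
    by rewrite subrr addr0 mulr_ge0 ?sqr_ge0.
  have c0 : 0 <= c%:R :> rat by exact: ler0n.
  rewrite addr0 mulrAC ler_pdivlMr ?exprn_gt0 //.
  apply: (@le_trans _ _ (k%:R * (L - k%:R) ^+ 2)); first by rewrite ler_wpM2r ?sqr_ge0 //; lra.
  by apply: ler_wpM2l => //; nra.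
have := etrunc_k_defect H j0 B; rewrite -/L addr0.
suff : k%:R / (L - k%:R) ^+ 2 * L <= 4 * k%:R / L by lra.
rewrite mulrAC ler_pdivrMr ?exprn_gt0 // mulrAC ler_pdivlMr //.
have : L ^+ 2 <= 4 * (L - k%:R) ^+ 2 by nra.
by move/(ler_wpM2l k0); lra.
Qed.

(** Bonferroni: truncation loses at most the number of pairs of successes, [c (c - 1) / 2], whose
    expectation is at most half the squared mean. *)
Lemma etrunc_lower2 k ps : (0 < k)%N -> all in01 ps ->
  lam ps - lam ps ^+ 2 / 2 <= etrunc k ps.
Proof.
move=> k0 H; have L0 := lam_ge0 H.
have B : forall c : nat, c%:R - (minn k c)%:R <= 2^-1 * c%:R ^+ 2 + - 2^-1 * c%:R :> rat.
  move=> c; case: (leqP k c) => Hc; last first.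
    rewrite subrr; case: c {Hc} => [|c]; first by rewrite expr0n /= !mulr0 addr0.
    rewrite -(addn1 c) natrD; have : 0 <= c%:R :> rat by exact: ler0n.
    by have := sqr_ge0 (c%:R : rat); lra.
  have : 1 <= k%:R :> rat by rewrite ler1n.
  case: c Hc => [|[|c]] Hc; try lia.
    by have -> : k = 1%N by lia; lra.
  rewrite -(addn2 c) natrD; have : 0 <= c%:R :> rat by exact: ler0n.
  by have := sqr_ge0 (c%:R : rat); lra.
have := ebern_mono H B.
rewrite (@eq_ebern _ _ (fun c => 1 * c%:R + (-1) * (minn k c)%:R)); last by move=> c; ring.
rewrite !ebern_lin ebern_id -/(etrunc k ps).
rewrite (@eq_ebern _ _ (fun c => (c%:R - 0) ^+ 2)); last by move=> c; rewrite subr0.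
by rewrite ebern_sqr subr0; have := var_le H; lra.
Qed.

(** Second moment method: [min(k, c)] is at least [1 - (1 - u c)^2] for every count [c], and
    [u = 1 / (1 + lam ps)] is the best choice. *)
Lemma etrunc_lower1 k ps : (0 < k)%N -> all in01 ps ->
  lam ps / (1 + lam ps) <= etrunc k ps.
Proof.
move=> k0 H; have L0 := lam_ge0 H; set L := lam ps in L0 *.
pose u := (1 + L)^-1; have u0 : 0 < u by rewrite invr_gt0; lra.
have Eu : u * (1 + L) = 1 by rewrite mulVf //; lra.
have B : forall c : nat, 2 * u * c%:R + - u ^+ 2 * c%:R ^+ 2 <= (minn k c)%:R.
  move=> [|c]; first by rewrite minn0 expr0n /= !mulr0 addr0.
  apply: (@le_trans _ _ 1); last by rewrite ler1n; lia.
  by have := sqr_ge0 (1 - u * c.+1%:R); lra.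
have := ebern_mono H B; rewrite -/(etrunc k ps) ebern_lin ebern_id.
rewrite (@eq_ebern _ _ (fun c => (c%:R - 0) ^+ 2)); last by move=> c; rewrite subr0.
rewrite ebern_sqr subr0 -/L; have := var_le H; rewrite -/L => V.
have : u ^+ 2 * (\sum_(p <- ps) p * (1 - p)) <= u ^+ 2 * L by rewrite ler_wpM2l ?sqr_ge0.
have -> : L / (1 + L) = u * L by rewrite mulrC.
have : u ^+ 2 * (L + L ^+ 2) = u * L.
  by rewrite expr2 -[in RHS](mulr1 (u * L)) -Eu; ring.
lra.
Qed.
End Bernoulli.

(** * Elementary symmetric functions and power sums *)

Section Newton.
Local Open Scope ring_scope.
Implicit Types (ps qs : seq rat) (f g : nat -> rat).

Definition diff f : nat -> rat := fun c => f c.+1 - f c.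

Fixpoint elsym ps (j : nat) : rat :=
  if ps is p :: ps' then elsym ps' j + (if j is i.+1 then p * elsym ps' i else 0)
  else (j == 0%N)%:R.

Definition psum ps (j : nat) : rat := \sum_(p <- ps) p ^+ j.

Lemma elsym0 ps : elsym ps 0 = 1.
Proof. by elim: ps => //= p ps ->; rewrite addr0. Qed.

(** Newton's forward differences: [f c] is the sum over [j] of the binomial coefficient of [c] and
    [j] times the j-th difference at 0, and the expectation of that coefficient is [elsym ps j].
    Terms beyond [size ps] vanish. *)
Lemma ebern_elsym ps f m : (size ps < m)%N ->
  ebern ps f = \sum_(j < m) elsym ps j * iter j diff f 0%N.
Proof.
elim: ps f m => [|p ps IH] f m /= Hm.
  rewrite (bigD1 (Ordinal Hm)) //= mul1r big1 ?addr0 // => i.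
  by rewrite -val_eqE /= => /negbTE->; rewrite mul0r.
have -> : (1 - p) * ebern ps f + p * ebern ps (fun c => f c.+1) =
   ebern ps f + p * ebern ps (diff f).
  rewrite (@eq_ebern _ (diff f) (fun c => 1 * f c.+1 + (-1) * f c)); last by move=> c; rewrite /diff; ring.
  by rewrite ebern_lin; ring.
case: m Hm => // m Hm; rewrite (IH f m.+1) ?(IH (diff f) m) //; last by lia.
rewrite [LHS]addrC [X in _ + X]big_ord_recl [RHS]big_ord_recl /= addr0 addrCA; congr (_ + _).
rewrite mulr_sumr -big_split /=; apply: eq_bigr => i _.
by rewrite -iterSr /bump /=; ring.
Qed.

Lemma iter_diff_le f (k : rat) : (forall c, `|f c| <= k) ->
  forall j c, `|iter j diff f c| <= 2 ^+ j * k.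
Proof.
move=> H; elim=> [|j IH] c /=; first by rewrite mul1r.
rewrite {1}/diff; apply: le_trans (ler_normB _ _) _.
by have := IH c; have := IH c.+1; rewrite exprS; lra.
Qed.

Lemma elsym_ge0 ps j : all in01 ps -> 0 <= elsym ps j.
Proof.
elim: ps j => [|p ps IH] j /=; first by rewrite ler0n.
case/andP => /andP[p0 _] H; apply: addr_ge0; first exact: IH.
by case: j => // j; rewrite mulr_ge0 // IH.
Qed.

Lemma psum_lam ps j : all in01 ps -> (0 < j)%N -> 0 <= psum ps j <= lam ps.
Proof.
rewrite /psum /lam; move=> H j0; elim: ps H => [|p ps IH] /=; first by rewrite !big_nil lexx.
case/andP => /andP[p0 p1] /IH /andP[A B]; rewrite !big_cons; apply/andP; split.
  by rewrite addr_ge0 // exprn_ge0.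
by apply: lerD => //; case: j j0 {IH A B} => // j _; rewrite exprS ler_piMr // exprn_ile1.
Qed.

Lemma binom2_le (x y : rat) j : 0 <= x -> 0 <= y -> x ^+ j.+1 + j.+1%:R * y * x ^+ j <= (x + y) ^+ j.+1.
Proof.
move=> x0 y0; elim: j => [|j IH]; first by rewrite !expr1 expr0 mulr1 mul1r.
rewrite [leRHS]exprS; apply: le_trans (ler_wpM2l (addr_ge0 x0 y0) IH).
rewrite -[j.+2]addn1 natrD [x ^+ (j.+1 + 1)]exprD expr1 -[x ^+ j.+1 in X in _ + X <= _]mulr1.
rewrite !(exprS x j).
have E : 0 <= x ^+ j by exact: exprn_ge0.
have jj : 0 <= j.+1%:R :> rat by exact: ler0n.
have : 0 <= j.+1%:R * y ^+ 2 * x ^+ j by rewrite !mulr_ge0 // sqr_ge0.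
by lra.
Qed.

(** Expanding the power of the sum yields every squarefree monomial [j!] times. In the induction the
    first two terms of the binomial expansion suffice. *)
Lemma elsym_fact ps j : all in01 ps -> elsym ps j * j`!%:R <= lam ps ^+ j.
Proof.
rewrite /lam; elim: ps j => [|p ps IH] j /=.
  by case: j => [|j]; rewrite ?mul1r ?big_nil ?mul0r ?fact0 // exprn_ge0.
case/andP => /andP[p0 p1] H; rewrite big_cons.
case: j => [|j]; first by rewrite addr0 expr0; have := IH 0%N H; rewrite expr0.
have L0 : 0 <= \sum_(p <- ps) p by exact: lam_ge0.
rewrite addrC [X in _ <= X ^+ _]addrC; apply: le_trans (binom2_le j L0 p0).
have := IH j.+1 H; have := IH j H => A B.
have : p * (j.+1%:R * (elsym ps j * j`!%:R)) <= p * (j.+1%:R * (\sum_(p <- ps) p) ^+ j).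
  by rewrite !ler_wpM2l.
rewrite factS natrM mulrDl; rewrite factS natrM in B; lra.
Qed.

(** Induction on the list. A new entry [p] turns [e_a] into [e_a + p e_(a-1)]; the terms with pure
    powers of [p] telescope and leave [p e_j]. *)
Lemma newton ps j : j%:R * elsym ps j =
  \sum_(i < j) (-1) ^+ i * elsym ps (j - i.+1) * psum ps i.+1.
Proof.
elim: ps j => [|p ps IH] j /=.
  rewrite big1; last by move=> i _; rewrite /psum big_nil mulr0.
  by case: j => [|j]; rewrite ?mul0r ?mulr0.
case: j => [|j]; first by rewrite big_ord0 mul0r.
under eq_bigr => i _ do rewrite /psum big_cons -/(psum ps i.+1).
pose e (a : nat) := elsym ps a.
have E (i : 'I_j.+1) : (-1) ^+ i * (e (j.+1 - i.+1)%N + (if (j.+1 - i.+1)%N is i0.+1 then p * e i0 else 0))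
   * (p ^+ i.+1 + psum ps i.+1) =
   (-1) ^+ i * e (j.+1 - i.+1)%N * psum ps i.+1
   + (if (i < j)%N then p * ((-1) ^+ i * e (j - i.+1)%N * psum ps i.+1) else 0)
   + ((-1) ^+ i * e (j - i)%N * p ^+ i.+1 +
      (if (i < j)%N then (-1) ^+ i * e (j - i.+1)%N * p ^+ i.+2 else 0)).
  rewrite subSS; case: (ltnP i j) => Hi.
    have -> : (j - i = (j - i.+1).+1)%N by lia.
    by rewrite (exprS p i.+1); ring.
  have -> : (j - i = 0)%N by lia.
  by rewrite !addr0 mulrDr addrC.
rewrite (eq_bigr _ (fun i _ => E i)) {E}.
rewrite !big_split /= -(IH j.+1).
have -> : \sum_(i < j.+1) (if (i < j)%N then p * ((-1) ^+ i * e (j - i.+1)%N * psum ps i.+1) else 0)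
  = p * (j%:R * e j).
  rewrite big_ord_recr /= ltnn addr0 (IH j) mulr_sumr; apply: eq_bigr => i _.
  by rewrite ltn_ord.
have -> : \sum_(i < j.+1) (if (i < j)%N then (-1) ^+ i * e (j - i.+1)%N * p ^+ i.+2 else 0)
  = - \sum_(i < j) (-1) ^+ i.+1 * e (j - i.+1)%N * p ^+ i.+2.
  rewrite big_ord_recr /= ltnn addr0 -sumrN; apply: eq_bigr => i _.
  by rewrite ltn_ord (exprS (-1)); ring.
rewrite [X in _ + (X + _)]big_ord_recl /= expr0 subn0.
have -> : \sum_(i < j) (-1) ^+ bump 0 i * e (j - bump 0 i)%N * p ^+ (bump 0 i).+1 =
  \sum_(i < j) (-1) ^+ i.+1 * e (j - i.+1)%N * p ^+ i.+2.
  by apply: eq_bigr => i _; rewrite /bump /= add1n.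
by rewrite -/(e j.+1) -/(e j) -(addn1 j) natrD; ring.
Qed.

(* Newton's identities determine the elementary symmetric functions from the
   power sums, with error growing only geometrically in the degree. *)
Lemma elsym_perturb ps qs (eta L : rat) m : all in01 ps -> all in01 qs ->
  0 <= eta -> lam ps <= L -> lam qs <= L ->
  (forall i, (0 < i)%N -> (i < m)%N -> `|psum ps i - psum qs i| <= eta) ->
  forall j, (j < m)%N -> `|elsym ps j - elsym qs j| <= eta * (L + 1) ^+ j.
Proof.
move=> Hp Hq eta0 Lp Lq D; set R := L + 1.
have L0 : 0 <= L by apply: le_trans (lam_ge0 Hp) Lp.
have R1 : 1 <= R by rewrite /R; lra.
have RX n : 1 <= R ^+ n by exact: exprn_ege1.
have eq_le n : elsym qs n <= R ^+ n.
  have := elsym_fact n Hq; have E0 := elsym_ge0 n Hq.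
  have F1 : 1 <= n`!%:R :> rat by rewrite ler1n fact_gt0.
  have : lam qs ^+ n <= R ^+ n 
    by apply: lerXn2r; rewrite ?nnegrE ?lam_ge0 // /R; lra.
  nra.
elim/ltn_ind => j IH Hj.
case: j IH Hj => [|j] IH Hj; first by rewrite !elsym0 subrr normr0 expr0 mulr1.
have j0 : 0 < j.+1%:R :> rat by rewrite ltr0n.
have Eq : j.+1%:R * (elsym ps j.+1 - elsym qs j.+1) =
   \sum_(i < j.+1) (-1) ^+ i * (elsym ps (j.+1 - i.+1) * psum ps i.+1 - elsym qs (j.+1 - i.+1) * psum qs i.+1).
  rewrite mulrBr !newton -sumrB; apply: eq_bigr => i _; ring.
rewrite -(ler_pM2l j0) -[X in X * `|_|]ger0_norm ?ler0n // -normrM Eq.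
apply: le_trans (ler_norm_sum _ _ _) _.
have -> : j.+1%:R * (eta * R ^+ j.+1) = \sum_(i < j.+1) eta * R ^+ j.+1.
  by rewrite sumr_const card_ord mulr_natl.
apply: ler_sum => i _; rewrite normrM normrX normrN1 expr1n mul1r subSS.
set a := (j - i)%N; have Ha : (a <= j)%N by exact: leq_subr.
have -> : elsym ps a * psum ps i.+1 - elsym qs a * psum qs i.+1 =
   (elsym ps a - elsym qs a) * psum ps i.+1 + elsym qs a * (psum ps i.+1 - psum qs i.+1) by ring.
apply: le_trans (ler_normD _ _) _; rewrite !normrM.
have /andP[s0 sL] := psum_lam Hp (ltn0Sn i).
rewrite (ger0_norm s0) (ger0_norm (elsym_ge0 a Hq)).
have A1 : `|elsym ps a - elsym qs a| * psum ps i.+1 <= (eta * R ^+ a) * L.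
  apply: ler_pM => //; last by apply: le_trans sL Lp.
  exact: IH Ha (leq_ltn_trans Ha (ltnW Hj)).
have A2 : elsym qs a * `|psum ps i.+1 - psum qs i.+1| <= R ^+ a * eta.
  apply: ler_pM => //; first exact: elsym_ge0.
  exact: D (ltn0Sn i) (leq_ltn_trans (ltn_ord i) Hj).
apply: (@le_trans _ _ (eta * R ^+ a.+1)); first by rewrite exprS {1}/R; lra.
by rewrite ler_wpM2l // ler_weXn2l.
Qed.

(** An elementary substitute for Stirling's formula: [j ^ j] is at most the falling factorial of
    [2 j] of length [j], which is [j!] times a binomial coefficient below [4 ^ j]. *)
Lemma expn_fact j : (j ^ j <= 4 ^ j * j`!)%N.
Proof.
have H1 : (j ^ j <= (2 * j) ^_ j)%N.
  have -> : (j ^ j = \prod_(i < j) j)%N by rewrite prod_nat_const card_ord.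
  rewrite ffact_prod.
  by apply: leq_prod => i _; have := ltn_ord i; lia.
have H2 : ('C(2 * j, j) <= 4 ^ j)%N.
  have -> : (4 ^ j = (1 + 1) ^ (2 * j))%N by rewrite expnM.
  rewrite expnDn.
  have Hj : (j < (2 * j).+1)%N by lia.
  by rewrite (bigD1 (Ordinal Hj)) //= !exp1n !muln1 leq_addr.
by apply: leq_trans H1 _; rewrite -bin_ffact leq_mul2r H2 orbT.
Qed.
End Newton.

(** * Truncated means at a single level *)

Section Level.
Local Open Scope ring_scope.
Implicit Types (ps qs : seq rat).

(** [elsym ps j] is at most [R^j / j!], hence at most [4^-j] once [j >= 16 R]. The factor [2 ^+ j]
    makes room for the j-th difference of a bounded function. *)
Lemma elsym_tail ps (R j : nat) : all in01 ps -> (0 < R)%N -> lam ps <= R%:R -> (16 * R <= j)%N ->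
  2 ^+ j * elsym ps j <= 2 ^- j.
Proof.
move=> H R0 HL Hj.
have E0 := elsym_ge0 j H.
have A : elsym ps j * j`!%:R <= R%:R ^+ j.
  by apply: le_trans (elsym_fact j H) _; apply: lerXn2r; rewrite ?nnegrE ?lam_ge0.
have B : ((16 * R) ^ j <= 4 ^ j * j`!)%N.
  by apply: leq_trans (expn_fact j); case: (j) Hj => // i Hi; rewrite leq_exp2r.
rewrite -(ler_nat rat) natrM !natrX natrM in B.
rewrite exprMn in B.
have RX : 0 < R%:R ^+ j :> rat by rewrite exprn_gt0 // ltr0n.
have C : 16 ^+ j * elsym ps j <= 4 ^+ j.
  rewrite -(ler_pM2r RX).
  have : elsym ps j * (16 ^+ j * R%:R ^+ j) <= elsym ps j * (4 ^+ j * j`!%:R) by rewrite ler_wpM2l.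
  have : 4 ^+ j * (elsym ps j * j`!%:R) <= 4 ^+ j * R%:R ^+ j :> rat by rewrite ler_wpM2l ?exprn_ge0.
  by lra.
have T0 : 0 < 2 ^+ j :> rat by exact: exprn_gt0.
rewrite -div1r ler_pdivlMr //.
have E16 : 16 ^+ j = (2 ^+ j) ^+ 4 :> rat by rewrite -exprM mulnC exprM -natrX.
have E4 : 4 ^+ j = (2 ^+ j) ^+ 2 :> rat by rewrite -exprM mulnC exprM -natrX.
rewrite E16 E4 in C.
have T2 : 0 < (2 ^+ j) ^+ 2 :> rat by exact: exprn_gt0.
by rewrite -(ler_pM2l T2); lra.
Qed.

Lemma geo_half (m d : nat) : \sum_(i < d) 2 ^- (m + i) <= 2 * 2 ^- m :> rat.
Proof.
suff -> : \sum_(i < d) 2 ^- (m + i) = 2 * 2 ^- m - 2 * 2 ^- (m + d) :> rat.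
  by rewrite gerBl mulr_ge0 // invr_ge0 exprn_ge0.
elim: d => [|d IH]; first by rewrite big_ord0 addn0 subrr.
rewrite big_ord_recr /= IH addnS exprS invfM.
by lra.
Qed.

Lemma etrunc_elsym k ps (R m : nat) : all in01 ps -> (0 < R)%N -> lam ps <= R%:R -> (16 * R <= m)%N ->
  `|etrunc k ps - \sum_(j < m) elsym ps j * iter j diff (fun c => (minn k c)%:R) 0%N| <= 2 * k%:R * 2 ^- m.
Proof.
move=> H R0 HL Hm; rewrite /etrunc (@ebern_elsym _ _ (m + (size ps).+1)); last by lia.
rewrite big_split_ord /= addrAC subrr add0r.
apply: le_trans (ler_norm_sum _ _ _) _.
apply: (@le_trans _ _ (\sum_(i < (size ps).+1) k%:R * 2 ^- (m + i))); last first.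
  by rewrite -mulr_sumr -mulrA mulrCA ler_wpM2l // geo_half.
apply: ler_sum => i _; rewrite normrM ger0_norm ?elsym_ge0 //.
have D := @iter_diff_le (fun c => (minn k c)%:R) k%:R _ (m + i) 0.
apply: le_trans (ler_wpM2l (elsym_ge0 _ H) (D _)) _.
  by move=> c; rewrite ger0_norm ?minn_lekR.
rewrite mulrA mulrC ler_wpM2l // mulrC; apply: (@elsym_tail _ R) => //; lia.
Qed.

Lemma pow2_bound k u : (k <= u -> 4 <= u -> 8 * k * u ^ 2 <= 2 ^ (100 * u))%N.
Proof.
move=> ku u4; have h : (u < 2 ^ u)%N by exact: ltn_expl.
apply: (@leq_trans (2 ^ (u + (u + u) + 3))); last by rewrite leq_exp2l //; lia.
rewrite !expnD; move: (2 ^ u)%N h => x ux.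
have -> : (x * (x * x) * 2 ^ 3 = 8 * x * x ^ 2)%N by rewrite -mulnn; lia.
by rewrite leq_mul ?leq_sqr ?(ltnW ux) // leq_mul // ltnW // (leq_ltn_trans ku).
Qed.

(** One of the two factors [(24 M) ^- m] cancels [(12 M) ^+ m] and leaves [2 ^- m] against the [m]
    terms; the other one pays for [x] and for the accuracy. *)
Lemma perturb_bound (M x : rat) (m : nat) : (3 <= m)%N -> 1 <= M -> 0 <= x <= M ->
  m%:R * ((24 * M) ^- (2 * m) * (12 * M) ^+ m * x) <= (2 * M ^+ 2)^-1.
Proof.
move=> m3 M1 /andP[x0 xM].
have gen1 (b : rat) : b ^- (2 * m) = (b ^+ m)^-1 * (b ^+ m)^-1.
  by rewrite mul2n -addnn exprD invfM.
have gen2 (b c : rat) : 0 <= c -> c <= b -> 1 <= b -> c ^+ 3 <= b ^+ m.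
  move=> c0 cb b1; apply: (@le_trans _ _ (b ^+ 3)); last by rewrite ler_weXn2l.
  by apply: lerXn2r; rewrite ?nnegrE // (le_trans c0).
have gen3 (b : rat) : (b / 2) ^+ m = b ^+ m / 2 ^+ m by exact: expr_div_n.
have -> : 12 * M = (24 * M) / 2 by field.
rewrite gen1 gen3.
have H3 : (2 * M) ^+ 3 <= (24 * M) ^+ m by apply: gen2; lra.
move: ((24 * M) ^+ m) H3 => Y H3.
have M3 : 0 < M ^+ 3 by apply: exprn_gt0; lra.
have {}H3 : 8 * M ^+ 3 <= Y by apply: le_trans H3; rewrite le_eqVlt; apply/orP; left; apply/eqP; ring.
have Y0 : 0 < Y by lra.
have mM : m%:R <= 2 ^+ m :> rat by rewrite -natrX ler_nat ltnW // ltn_expl.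
move: (2 ^+ m) mM => Z mM.
have m0 : 1 <= m%:R :> rat by rewrite ler1n; lia.
have Z0 : 0 < Z by lra.
have -> : m%:R * (Y^-1 * Y^-1 * (Y / Z) * x) = (m%:R / Z) * (x / Y).
  by field; rewrite !gt_eqF.
apply: (@le_trans _ _ (x / Y)).
  by rewrite ler_piMl ?divr_ge0 ?(ltW Y0) // ler_pdivrMr // mul1r.
have M2 : 0 < 2 * M ^+ 2 by rewrite mulr_gt0 // exprn_gt0 //; lra.
rewrite ler_pdivrMr // mulrC ler_pdivlMr //.
have : x * (2 * M ^+ 2) <= M * (2 * M ^+ 2) by rewrite ler_wpM2r // ltW.
lra.
Qed.

(** Either [qs] has mean at least [4 N^2] and nearly reaches the maximum [k] by saturation, or both
    means are below [6 N^2] and the expansions in [elsym], cut at [m], are close. *)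
Lemma level k (N m : nat) ps qs : (2 <= N)%N -> (0 < k <= N ^ 2)%N -> m = (100 * N ^ 2)%N ->
  all in01 ps -> all in01 qs ->
  (forall i, (0 < i)%N -> (i < m)%N ->
     `|psum ps i - psum qs i| <= (24 * (N ^ 2)%:R) ^- (2 * m)) ->
  (1 - N%:R^-1) * etrunc k ps - N%:R ^- 4 <= etrunc k qs.
Proof.
move=> N2 /andP[k0 kN] Hm Hp Hq D.
pose n : rat := N%:R; have n2 : 2 <= n by rewrite (ler_nat _ 2).
have nN0 : n != 0 by rewrite gt_eqF //; lra.
pose M : rat := (N ^ 2)%:R; have EM : M = n ^+ 2 by rewrite /M natrX.
have M4 : 4 <= M by rewrite EM; nra.
have kM : k%:R <= M by rewrite ler_nat.
have k1 : 1 <= k%:R :> rat by rewrite ler1n.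
have Fp := etrunc_lek k Hp; have Fp0 := etrunc_ge0 k Hp.
have in0 : 0 < n^-1 by rewrite invr_gt0; lra.
have in1 : n^-1 <= 1 by rewrite invf_le1; lra.
have in4 : 0 < n ^- 4 by rewrite invr_gt0 exprn_gt0 //; lra.
have [sat|unsat] := leP (4 * M) (lam qs).
  have S := @etrunc_saturated k qs Hq _.
  have : k%:R - 4 * k%:R / lam qs <= etrunc k qs by apply: S; lra.
  have : 4 * k%:R / lam qs <= n^-1 * k%:R.
    rewrite ler_pdivrMr; last by lra.
    have : 4 * n <= lam qs by nra.
    have : n^-1 * k%:R * (4 * n) = 4 * k%:R by field.
    have : 0 <= n^-1 * k%:R by apply: mulr_ge0; lra.
    by move=> a0 <- h; rewrite ler_wpM2l.
  have : n^-1 * k%:R - n^-1 * etrunc k ps <= k%:R - etrunc k ps.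
    have -> : n^-1 * k%:R - n^-1 * etrunc k ps = n^-1 * (k%:R - etrunc k ps) by ring.
    by rewrite ler_piMl // subr_ge0.
  by rewrite -/n; lra.
(* [16 R = 96 N^2 <= m] is the origin of the constant 100. Both means are bounded by [R - 1], so
   that [L + 1] in [elsym_perturb] is [R]. *)
pose R : nat := (6 * N ^ 2)%N; have ER : R%:R = 6 * M :> rat by rewrite natrM.
set eta := (24 * M) ^- (2 * m).
have N4 : (4 <= N ^ 2)%N by rewrite -[4%N]/(2 ^ 2)%N leq_exp2r.
have m3 : (3 <= m)%N by rewrite Hm; move: (N ^ 2)%N N4; clear; lia.
have m1 : (1 < m)%N by move: m3; clear; lia.
have X1 : 1 <= 24 * M by lra.
have gen (x : rat) j : 1 <= x -> 0 < x ^- j <= 1.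
  move=> x1; have x0 : 0 < x by apply: lt_le_trans x1.
  have y0 : 0 < x ^+ j by apply: exprn_gt0.
  by rewrite invr_gt0 y0 invf_le1 // exprn_ege1.
have /andP[eta0 eta1] : 0 < eta <= 1 by apply: gen.
have Lq : lam qs <= R%:R - 1 by rewrite ER; lra.
have Lp : lam ps <= R%:R - 1.
  have := D 1%N isT m1; rewrite /psum.
  under eq_bigr do rewrite expr1.
  under [X in _ - X]eq_bigr do rewrite expr1.
  rewrite -/(lam ps) -/(lam qs) -/M -/eta ler_norml => /andP[_]; rewrite ER; lra.
have R0 : (0 < R)%N by rewrite /R; move: (N ^ 2)%N N4; clear; lia.
have HmR : (16 * R <= m)%N by rewrite Hm /R; move: (N ^ 2)%N; clear; lia.
have Lp' : lam ps <= R%:R by lra.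
have Lq' : lam qs <= R%:R by lra.
have Tp := etrunc_elsym k Hp R0 Lp' HmR; have Tq := etrunc_elsym k Hq R0 Lq' HmR.
set f := (fun c => (minn k c)%:R) in Tp Tq.
have P := elsym_perturb Hp Hq (ltW eta0) Lp Lq D; rewrite subrK in P.
have S : `|\sum_(j < m) elsym ps j * iter j diff f 0%N - \sum_(j < m) elsym qs j * iter j diff f 0%N|
    <= m%:R * (eta * (2 * R%:R) ^+ m * k%:R).
  rewrite -sumrB; apply: le_trans (ler_norm_sum _ _ _) _.
  set cst := eta * _ * _; have -> : m%:R * cst = \sum_(j < m) cst by rewrite sumr_const card_ord mulr_natl.
  apply: ler_sum => j _; rewrite {}/cst.
  rewrite -mulrBl normrM.
  have Df := @iter_diff_le f k%:R _ j 0%N.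
  apply: (@le_trans _ _ (eta * R%:R ^+ j * (2 ^+ j * k%:R))).
    apply: ler_pM => //; first exact: P.
    by apply: Df => c; rewrite ger0_norm ?minn_lekR // ler0n.
  rewrite mulrACA -!mulrA; apply: ler_wpM2l; first exact: ltW.
  have R2 : 1 <= 2 * R%:R :> rat by rewrite ER; lra.
  have := @ler_weXn2l _ (2 * R%:R : rat) R2 j m (ltnW (ltn_ord j)).
  rewrite [X in X <= _]exprMn => h.
  by rewrite mulrA ler_wpM2r.
have EM2 : n ^+ 4 = M ^+ 2 by rewrite EM -exprM.
have B1 : m%:R * (eta * (2 * R%:R) ^+ m * k%:R) <= 2^-1 * n ^- 4.
  have -> : 2 * R%:R = 12 * M by rewrite ER; ring.
  rewrite EM2 -invfM; apply: perturb_bound => //; last by rewrite ler0n.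
  by apply: le_trans M4.
have B2 : 4 * k%:R * 2 ^- m <= 2^-1 * n ^- 4.
  have := pow2_bound kN N4; rewrite -Hm -(ler_nat rat) natrM natrM !natrX -/n -EM => h.
  have T0 : 0 < 2 ^+ m :> rat by rewrite exprn_gt0.
  have S0 : 0 < M ^+ 2 by rewrite exprn_gt0 //; lra.
  have gen3 (a b z : rat) : 0 < b -> 0 < z -> 8 * a * b <= z -> 4 * a / z <= 2^-1 / b.
    move=> b0 z0 H; rewrite ler_pdivrMr // mulrAC ler_pdivlMr //.
    by move: H; rewrite -!mulrA; move: (a * b) => y H; lra.
  by rewrite EM2; apply: gen3.
have : etrunc k ps - etrunc k qs <= n ^- 4.
  move: Tp Tq S; rewrite !ler_norml => /andP[_ t1] /andP[t2 _] /andP[_ t3].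
  by lra.
have : 0 <= n^-1 * etrunc k ps by rewrite mulr_ge0 // ltW.
by rewrite -/n; lra.
Qed.
End Level.

(** * Integrals over levels *)

Section Blocks.
Local Open Scope ring_scope.

(** Lower and upper Riemann sums of a decreasing function; their difference telescopes. *)
Lemma block_sum (f : nat -> rat) d : (forall x y, (x <= y)%N -> f y <= f x) ->
  forall L, \sum_(1 <= l < L.+1) d%:R * f (l * d)%N <= \sum_(1 <= x < (L * d).+1) f x
  /\ \sum_(1 <= x < (L * d).+1) f x <=
     d%:R * (f 0%N - f (L * d)%N) + \sum_(1 <= l < L.+1) d%:R * f (l * d)%N.
Proof.
move=> H; elim=> [|L [IH1 IH2]]; first by rewrite mul0n !big_geq // subrr mulr0 addr0.
have Hs : \sum_(1 <= x < (L.+1 * d).+1) f x =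
   \sum_(1 <= x < (L * d).+1) f x + \sum_((L * d).+1 <= x < (L * d).+1 + d) f x.
  by rewrite -big_cat_nat //=; [rewrite mulSn addSn addnC | lia].
have Hc : \sum_((L * d).+1 <= x < (L * d).+1 + d) f x = \sum_(i < d) f ((L * d).+1 + i)%N.
  rewrite -{1}[(L * d).+1]add0n big_addn addKn big_mkord.
  by apply: eq_bigr => i _; rewrite addnC.
have A : d%:R * f (L.+1 * d)%N <= \sum_(i < d) f ((L * d).+1 + i)%N.
  rewrite mulr_natl -[X in _ *+ X]card_ord -sumr_const; apply: ler_sum => i _; apply: H.
  by rewrite mulSn; have := ltn_ord i; lia.
have B : \sum_(i < d) f ((L * d).+1 + i)%N <= d%:R * f (L * d)%N.
  rewrite mulr_natl -[X in _ *+ X]card_ord -sumr_const; apply: ler_sum => i _; apply: H; lia.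
rewrite Hs Hc [X in X <= _ /\ _]big_nat_recr //= [X in _ /\ _ <= _ + X]big_nat_recr //=.
by split; lra.
Qed.
End Blocks.

(** * Transfer of E[Top_k] between sets, for small and for large k *)

Section Sums.
Local Open Scope ring_scope.
Variables (T : Type) (p : T -> nat -> rat).
Hypothesis p01 : forall i x, in01 (p i x).
Hypothesis pmono : forall i x y, (x <= y)%N -> p i y <= p i x.
Implicit Types s : seq T.

Definition row s x := [seq p i x | i <- s].

Lemma row01 s x : all in01 (row s x).
Proof. by elim: s => //= i s ->; rewrite p01. Qed.
Hint Resolve row01 : core.

Lemma lam_row s x : lam (row s x) = \sum_(i <- s) p i x.
Proof. by rewrite /lam big_map. Qed.

Lemma lam_mono s x y : (x <= y)%N -> lam (row s y) <= lam (row s x).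
Proof. by move=> H; rewrite !lam_row; apply: ler_sum => i _; apply: pmono. Qed.

(** Stochastic domination, raising the success probabilities one at a time. *)
Lemma etrunc_row_mono k s x y : (x <= y)%N -> etrunc k (row s y) <= etrunc k (row s x).
Proof.
move=> H; rewrite /etrunc.
suff gen f : (forall c, f c <= f c.+1) -> ebern (row s y) f <= ebern (row s x) f.
  by apply: gen => c; rewrite ler_nat; lia.
elim: s f => //= i s IH f Hf.
have D (z : rat) (w : nat) : (1 - z) * ebern (row s w) f + z * ebern (row s w) (fun c => f c.+1)
   = ebern (row s w) f + z * (ebern (row s w) (fun c => f c.+1) - ebern (row s w) f) by ring.
have J (z : nat) : ebern (row s z) f <= ebern (row s z) (fun c => f c.+1) by apply: ebern_mono.
have A := IH f Hf; have B := IH (fun c => f c.+1) (fun c => Hf c.+1).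
have Pm := pmono i H; have /andP[y0 y1] := p01 i y; have /andP[x0 x1] := p01 i x.
apply: (@le_trans _ _ ((1 - p i y) * ebern (row s x) f + p i y * ebern (row s x) (fun c => f c.+1))).
  by apply: lerD; rewrite ler_wpM2l // subr_ge0.
by rewrite !D lerD2l ler_wpM2r // subr_ge0.
Qed.

(* Top_k has expectation [phi], written as an integral over integer levels. *)
Definition phi X k s : rat := \sum_(1 <= x < X.+1) etrunc k (row s x).

Definition excess X s t : rat := \sum_(t.+1 <= x < X.+1) lam (row s x).

Lemma excess_ge0 X s t : 0 <= excess X s t.
Proof. by apply: sumr_ge0 => x _; apply: lam_ge0. Qed.

Lemma excess_cat X s a b : (a <= b <= X)%N ->
  excess X s a = \sum_(a.+1 <= x < b.+1) lam (row s x) + excess X s b.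
Proof. by move=> H; rewrite /excess -big_cat_nat //=; lia. Qed.

Lemma excess_mono X s a b : (a <= b)%N -> excess X s b <= excess X s a.
Proof.
move=> H; have [bX|Xb] := leqP b X; last first.
  by rewrite {1}/excess big_geq ?excess_ge0 //; lia.
rewrite (@excess_cat X s a b) ?H // lerDr; apply: sumr_ge0 => x _; exact: lam_ge0.
Qed.

Lemma excess_lip X s a b : (a <= b <= X)%N ->
  (b - a)%:R * lam (row s b) <= excess X s a - excess X s b /\
  excess X s a - excess X s b <= (b - a)%:R * lam (row s a).
Proof.
move=> H; rewrite (@excess_cat X s a b) // addrK.
have C c : (b - a)%:R * c = \sum_(a.+1 <= x < b.+1) c :> rat.
  by rewrite sumr_const_nat subSS mulr_natl.
rewrite !C; split; apply: ler_sum_nat => x Hx; apply: lam_mono; lia.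
Qed.

(** Three losses, each of order [P / N] for [P = phi X k s]. The grid of mesh [d] costs
    [k d <= P / N]. [level] costs a factor [1 - 1/N], and [N^-4] at each of [N^4] levels, which adds
    up to [d]. Above the top level the mean count is [O(1/N)], so that truncation hardly matters and
    the excess decides. *)
Theorem phi_small X k (N m w d : nat) s s' :
  (4 <= N)%N -> (0 < k <= N ^ 2)%N -> m = (100 * N ^ 2)%N -> w = (N ^ 4)%N ->
  (0 < d)%N -> (w * d <= X)%N ->
  (N * k * d)%:R <= phi X k s <= 2 * (N * k * d)%:R ->
  (forall l i, (0 < l <= w)%N -> (0 < i < m)%N ->
     `|psum (row s (l * d)) i - psum (row s' (l * d)) i| <= (24 * (N ^ 2)%:R) ^- (2 * m)) ->
  excess X s (w * d) - (k * d)%:R <= excess X s' (w * d) ->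
  (1 - 6 / N%:R) * phi X k s <= phi X k s'.
Proof.
move=> N4 Hk Hm Hw d0 HX /andP[V1 V2] D Ht.
have /andP[k0 kN] := Hk.
have N2 : (2 <= N)%N by apply: leq_trans N4.
have w0 : (0 < w)%N by rewrite Hw expn_gt0 (leq_trans _ N4).
have m1 : (1 < m)%N.
  by rewrite Hm; have : (0 < N ^ 2)%N by [rewrite expn_gt0 (leq_trans _ N4)]; move: (N ^ 2)%N; clear; lia.
have wR : w%:R = N%:R ^+ 4 :> rat by rewrite Hw natrX.
have u1 : 1 <= (N ^ 2)%:R :> rat by rewrite ler1n expn_gt0 (leq_trans _ N4).
have uR : (N ^ 2)%:R = N%:R ^+ 2 :> rat by rewrite natrX.
pose n : rat := N%:R; have n4 : 4 <= n by rewrite (ler_nat _ 4).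
have nn0 : 0 < n by lra.
have nN0 : n != 0 by rewrite gt_eqF.
pose e := n^-1; have e0 : 0 < e by rewrite invr_gt0; lra.
have e1 : e <= 4^-1 by rewrite lef_pV2 // posrE; lra.
have en : e * n = 1 by rewrite mulVf.
rewrite -/n -/e.
set T0 := (w * d)%N in Ht HX *.
have dd : 0 < d%:R :> rat by rewrite ltr0n.
have kk : 1 <= k%:R :> rat by rewrite ler1n.
have Lv := @level k N m _ _ N2 Hk Hm.
have kn : k%:R <= n ^+ 2 by rewrite -uR ler_nat.
clear Hw Hm; rewrite -/n in wR uR.
rewrite !natrM -/n in V1 V2.
set P := phi X k s in V1 V2 *.
have Split s0 : phi X k s0 = \sum_(1 <= x < T0.+1) etrunc k (row s0 x)
    + \sum_(T0.+1 <= x < X.+1) etrunc k (row s0 x).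
  by rewrite /phi -big_cat_nat //=; lia.
have [_ U] := block_sum d (fun x y => @etrunc_row_mono k s x y) w.
have [W _] := block_sum d (fun x y => @etrunc_row_mono k s' x y) w.
rewrite -/T0 in U W.
have Lev : (1 - e) * (\sum_(1 <= l < w.+1) d%:R * etrunc k (row s (l * d))) - d%:R
   <= \sum_(1 <= l < w.+1) d%:R * etrunc k (row s' (l * d)).
  have -> : (1 - e) * (\sum_(1 <= l < w.+1) d%:R * etrunc k (row s (l * d))) - d%:R =
     \sum_(1 <= l < w.+1) d%:R * ((1 - e) * etrunc k (row s (l * d)) - n ^- 4).
    rewrite mulr_sumr; under [RHS]eq_bigr do rewrite mulrBr.
    rewrite sumrB sumr_const_nat subSS subn0 -[X in _ = _ - X]mulr_natr wR; congr (_ - _).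
      by apply: eq_bigr => l _; ring.
    by field.
  apply: ler_sum_nat => l Hl; rewrite ler_pM2l //.
  have Hl' : (0 < l <= w)%N by exact: Hl.
  apply: (Lv _ _ (row01 s (l * d)) (row01 s' (l * d))) => i i0 im.
  by apply: D; [exact: Hl' | apply/andP; split].
have mono_s0 s0 x : (x <= T0)%N -> etrunc k (row s0 T0) <= etrunc k (row s0 x).
  exact: etrunc_row_mono.
have T0R : T0%:R = n ^+ 4 * d%:R :> rat by rewrite natrM wR.
(* The reason for [N^4] levels: truncated means decrease, so [N^4 d] times the one at the top is at
   most [2 N k d], where [k <= N^2]. *)
have FT : etrunc k (row s T0) <= 2 * e.
  have : T0%:R * etrunc k (row s T0) <= P.
    apply: (@le_trans _ _ (\sum_(1 <= x < T0.+1) etrunc k (row s x))).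
      rewrite mulr_natl -[X in _ *+ X](subn0 T0) -subSS -sumr_const_nat.
      by apply: ler_sum_nat => x /andP[_ Hx]; apply: mono_s0.
    by rewrite /P Split lerDl sumr_ge0 // => x _; apply: etrunc_ge0.
  rewrite T0R => h.
  have h2 : n ^+ 4 * d%:R * etrunc k (row s T0) <= n ^+ 4 * d%:R * (2 * e).
    apply: le_trans h (le_trans V2 _).
    have -> : n ^+ 4 * d%:R * (2 * e) = 2 * (n * n ^+ 2 * d%:R) by rewrite /e; field.
    have : n * k%:R <= n * n ^+ 2 by rewrite ler_pM2l.
    by move/(ler_wpM2r (ltW dd)); rewrite ler_pM2l.
  by move: h2; rewrite ler_pM2l // mulr_gt0 // exprn_gt0.
have LT : lam (row s T0) <= 4 * e.
  have := etrunc_lower1 k0 (row01 s T0) => /le_trans /(_ FT).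
  have L0 := lam_ge0 (row01 s T0).
  by rewrite ler_pdivrMr; [nra | lra].
have eta_e : (24 * (N ^ 2)%:R) ^- (2 * m) <= e.
  have gen (b : rat) : n <= b -> b ^- (2 * m) <= e.
    move=> nb; have b0 : 0 < b by lra.
    rewrite /e lef_pV2 ?posrE ?exprn_gt0 //.
    have b1 : 1 <= b by lra.
    have m2 : (1 <= 2 * m)%N by move: m1; clear; lia.
    by have := ler_weXn2l b1 m2; rewrite expr1 => h; apply: le_trans nb h.
  apply: gen; rewrite uR.
  have gen2 (x : rat) : 1 <= x -> n <= x * n ^+ 2.
    move=> x1; have h1 : 0 <= (x - 1) * n ^+ 2 by rewrite mulr_ge0 ?sqr_ge0 // subr_ge0.
    have h2 : 1 * n <= n * n by rewrite ler_wpM2r; lra.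
    by lra.
  by apply: gen2; rewrite ler1n.
(* The first power sum is the mean, so the mean of [s'] at the top level is small as well. *)
have LT' : lam (row s' T0) <= 5 * e.
  have := D w 1%N; rewrite leqnn w0 m1 /=.
  move=> /(_ isT isT) /le_trans /(_ eta_e).
  rewrite /psum; under eq_bigr do rewrite expr1.
  under [X in _ - X]eq_bigr do rewrite expr1.
  rewrite -/(lam _) -/(lam _) -/T0 ler_norml => /andP[h _]; lra.
have Tail : (1 - 3 * e) * excess X s' T0 <= \sum_(T0.+1 <= x < X.+1) etrunc k (row s' x).
  rewrite /excess mulr_sumr; apply: ler_sum_nat => x /andP[/ltnW Hx _].
  apply: le_trans (etrunc_lower2 k0 (row01 s' x)).
  have L0 := lam_ge0 (row01 s' x).
  have : lam (row s' x) <= 5 * e by apply: le_trans LT'; apply: lam_mono.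
  by move=> h; nra.
have Tails : \sum_(T0.+1 <= x < X.+1) etrunc k (row s x) <= excess X s T0.
  by apply: ler_sum => x _; apply: etrunc_lelam.
rewrite natrM in Ht.
have F0 : etrunc k (row s 0) <= k%:R by apply: etrunc_lek.
have F1 : 0 <= etrunc k (row s T0) by apply: etrunc_ge0.
have kde : k%:R * d%:R <= e * P.
  have := ler_wpM2l (ltW e0) V1; have -> : e * (n * k%:R * d%:R) = (e * n) * (k%:R * d%:R) by ring.
  by rewrite en mul1r.
have U2 : \sum_(1 <= x < T0.+1) etrunc k (row s x) - d%:R * k%:R <=
   \sum_(1 <= l < w.+1) d%:R * etrunc k (row s (l * d)).
  have : d%:R * (etrunc k (row s 0) - etrunc k (row s T0)) <= d%:R * k%:R by rewrite ler_pM2l //; lra.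
  by lra.
rewrite [phi X k s']Split.
have E1 : (1 - e) * (\sum_(1 <= x < T0.+1) etrunc k (row s x) - d%:R * k%:R) <=
  (1 - e) * (\sum_(1 <= l < w.+1) d%:R * etrunc k (row s (l * d))).
  by rewrite ler_wpM2l //; lra.
have E2 : (1 - 3 * e) * (\sum_(T0.+1 <= x < X.+1) etrunc k (row s x) - k%:R * d%:R) <=
  (1 - 3 * e) * excess X s' T0.
  by rewrite ler_wpM2l //; lra.
have := Split s; rewrite -/P => EP.
set A := \sum_(1 <= x < T0.+1) etrunc k (row s x) in EP E1 U2 *.
set B := \sum_(T0.+1 <= x < X.+1) etrunc k (row s x) in EP E2 Tails *.
have A0 : 0 <= A by apply: sumr_ge0 => x _; apply: etrunc_ge0.
have eA0 : 0 <= e * A by apply: mulr_ge0 => //; exact: ltW.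
have dk : d%:R <= k%:R * d%:R :> rat by rewrite ler_peMl // ltW.
have edk : 0 <= e * (k%:R * d%:R) by rewrite !mulr_ge0 // ltW.
have EPe : e * P = e * A + e * B by rewrite EP; ring.
have -> : (1 - 6 * e) * P = A + B - 6 * (e * A + e * B) by rewrite EP; ring.
clear - E1 E2 Lev Tail Ht W Tails kde dk edk EPe eA0 e0 e1.
lra.
Qed.

(** Means decrease with the level, so the minimum switches from [k] to the mean only once, at
    [t]. *)
Lemma min_sum X k s : exists2 t, (t <= X)%N &
  \sum_(1 <= x < X.+1) Num.min k%:R (lam (row s x)) = (k * t)%:R + excess X s t.
Proof.
elim: X => [|X [t tX IH]].
  by exists 0%N => //; rewrite /excess !big_geq // muln0 addr0.
have [Hl|Hl] := leP k%:R (lam (row s X.+1)).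
  exists X.+1 => //; rewrite /excess [X in _ = _ + X]big_geq // addr0.
  rewrite (@eq_big_nat _ _ _ _ _ _ (fun=> k%:R)); last first.
    move=> x /andP[_ Hx]; have : k%:R <= lam (row s x) by apply: le_trans Hl (lam_mono s _).
    by move=> /min_idPl.
  by rewrite sumr_const_nat subSS subn0 natrM mulr_natr.
exists t; first exact: leqW.
rewrite big_nat_recr //= IH /excess [in RHS]big_nat_recr //= addrA.
by congr (_ + _); rewrite minElt ltNge ltW.
Qed.

(** The slopes of the excess are the negated means, which increase with the level. *)
Lemma excess_convex X s a b c : (a <= b)%N -> (b <= c <= X)%N ->
  (b - a)%:R * (excess X s b - excess X s c) <= (c - b)%:R * (excess X s a - excess X s b).
Proof.
move=> ab /andP[bc cX].
have abX : (a <= b <= X)%N by rewrite ab (leq_trans bc).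
have bcX : (b <= c <= X)%N by rewrite bc.
have [A _] := excess_lip s abX; have [_ B] := excess_lip s bcX.
have h1 := @ler_wpM2l rat _ (ler0n _ (b - a)) _ _ B.
have h2 := @ler_wpM2l rat _ (ler0n _ (c - b)) _ _ A.
by apply: le_trans h1 (le_trans _ h2); rewrite mulrCA.
Qed.

Theorem phi_large X k (N d t : nat) s s' :
  (4 <= N)%N -> (0 < k)%N -> (N ^ 2 <= 4 * k)%N -> (0 < d)%N ->
  (t == 0%N) || (d <= t)%N -> (t + d <= X)%N ->
  (N * k * d)%:R <= phi X k s ->
  (k * t)%:R + excess X s t <= (k * (t - d))%:R + excess X s (t - d) ->
  (k * t)%:R + excess X s t <= (k * (t + d))%:R + excess X s (t + d) ->
  (forall u, u \in [:: (t - d)%N; t; (t + d)%N] ->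
     `|excess X s u - excess X s' u| <= (k * d)%:R / N%:R) ->
  (1 - 11 / N%:R) * phi X k s <= phi X k s'.
Proof.
move=> N4 k0 Nk d0 td HX V OL OR D.
pose n : rat := N%:R; have n4 : 4 <= n by rewrite (ler_nat _ 4).
have nn0 : 0 < n by lra.
have nN0 : n != 0 by rewrite gt_eqF.
pose e := n^-1; have e0 : 0 < e by rewrite invr_gt0.
have e1 : e <= 4^-1 by rewrite lef_pV2 // posrE.
have en : e * n = 1 by rewrite mulVf.
have dd : 0 < d%:R :> rat by rewrite ltr0n.
have kk : 1 <= k%:R :> rat by rewrite ler1n.
have kn : n ^+ 2 <= 4 * k%:R by rewrite -natrX -natrM ler_nat.
have e24 : 1 <= 4 * e ^+ 2 * k%:R.
  have -> : 4 * e ^+ 2 * k%:R = e ^+ 2 * (4 * k%:R) by ring.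
  have E1 : e ^+ 2 * n ^+ 2 = 1 by rewrite -exprMn en expr1n.
  by rewrite -[X in X <= _]E1; apply: ler_wpM2l kn; exact: sqr_ge0.
rewrite -/n -/e in D *.
set P := phi X k s in V *.
set KD : rat := (k * d)%:R in D.
have KD0 : 0 < KD by rewrite ltr0n muln_gt0 k0.
have VKD : KD <= e * P.
  have := ler_wpM2l (ltW e0) V.
  by rewrite -mulnA natrM -/n -/KD mulrA en mul1r.
have Dm : `|excess X s (t - d) - excess X s' (t - d)| <= KD * e.
  by apply: D; rewrite !inE eqxx.
have Dt : `|excess X s t - excess X s' t| <= KD * e by apply: D; rewrite !inE eqxx orbT.
have Dp : `|excess X s (t + d) - excess X s' (t + d)| <= KD * e.
  by apply: D; rewrite !inE eqxx !orbT.
move: Dm Dt Dp; rewrite !ler_norml.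
move=> /andP[m1 m2] /andP[t1 t2] /andP[p1 p2].
set g : rat := (k * t)%:R + excess X s t in OL OR.
(* Every threshold gives an upper bound: bound the truncated mean by [k] up to [t] and by the mean
   above. *)
have ubP : P <= g.
  rewrite /P /phi (@le_trans _ _ (\sum_(1 <= x < X.+1) Num.min k%:R (lam (row s x)))) //.
    by apply: ler_sum => x _; rewrite le_min etrunc_lek ?etrunc_lelam.
  have tX : (t <= X)%N by apply: leq_trans HX; exact: leq_addr.
  rewrite /g (@big_cat_nat _ _ _ t.+1) //=; apply: lerD; last first.
    by apply: ler_sum => x _; rewrite ge_min lexx orbT.
  apply: (@le_trans _ _ (\sum_(1 <= x < t.+1) k%:R)).
    by apply: ler_sum => x _; rewrite ge_min lexx.
  by rewrite sumr_const_nat subSS subn0 natrM mulr_natr.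
have g0 : 0 <= g by rewrite addr_ge0 ?excess_ge0.
have eg0 : 0 <= e * g by rewrite mulr_ge0 // ltW.
have eP : e * P <= e * g by rewrite ler_wpM2l // ltW.
have eKD : KD * e <= 4^-1 * (e * g).
  have : KD * e <= (e * g) * 4^-1 by apply: ler_pM => //; lra.
  lra.
have KDt : (k * (t + d))%:R = (k * t)%:R + KD :> rat by rewrite mulnDr natrD.
have Eg : g = (k * t)%:R + excess X s t by [].
have OR' : excess X s t - excess X s (t + d) <= KD by move: OR; rewrite KDt Eg; lra.
(* Beyond [t + d] convexity extends the slope measured on [[t, t + d]], which is at least
   [- k (1 + 2 e)]; left of [t - d] the slope measured on [[t - d, t]] extends likewise. In between,
   monotonicity loses only [O(k d)]. *)
have lb tau : (tau <= X)%N -> (1 - 6 * e) * g <= (1 + 2 * e) * ((k * tau)%:R + excess X s' tau).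
  move=> tauX; set g' : rat := (k * tau)%:R + _.
  have g'0 : 0 <= g' by rewrite addr_ge0 ?excess_ge0.
  have eg'0 : 0 <= e * g' by rewrite mulr_ge0 // ltW.
  have [hi|lo] := leqP (t + d) tau.
    have hX : (t + d <= tau <= X)%N by rewrite hi.
    have C := excess_convex s' (leq_addr d t) hX.
    rewrite addKn in C.
    set z : rat := (tau - (t + d))%:R in C; have z0 : 0 <= z by exact: ler0n.
    have Ez : (k * tau)%:R = (k * t)%:R + KD + k%:R * z :> rat.
      by rewrite -KDt -natrM -natrD -mulnDr subnKC.
    have zk : k%:R * z <= (k * tau)%:R :> rat by rewrite Ez; have := ler0n rat (k * t); lra.
    have h : z * (excess X s' t - excess X s' (t + d)) <= z * (KD + 2 * (KD * e)).
      by apply: ler_wpM2l => //; lra.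
    have h2 : d%:R * (excess X s' (t + d) - excess X s' tau) <= d%:R * (z * (k%:R * (1 + 2 * e))).
      apply: le_trans C (le_trans h _); rewrite /KD natrM le_eqVlt; apply/orP; left; apply/eqP; ring.
    rewrite ler_pM2l // in h2.
    have h3 : e * (k%:R * z) <= e * g'.
      rewrite ler_wpM2l ?(ltW e0) //; apply: le_trans zk _; rewrite lerDl; exact: excess_ge0.
    rewrite /g' in eg'0 h3 *; rewrite Ez in eg'0 h3 *; lra.
  have [mid|low] := leqP (t - d) tau.
    have M1 : excess X s' (t + d) <= excess X s' tau by apply: excess_mono; exact: ltnW.
    have M2 : (k * t)%:R - KD <= (k * tau)%:R :> rat.
      rewrite lerBlDr -natrD -mulnDr ler_nat leq_mul2l addnC -leq_subLR mid orbT //.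
    rewrite /g'; rewrite /g' in eg'0; lra.
  have dt : (d <= t)%N by case/orP: td => [/eqP t0|//]; move: low; rewrite t0 sub0n ltn0.
  have hX : (t - d <= t <= X)%N by rewrite leq_subr (leq_trans _ HX) ?leq_addr.
  have C := excess_convex s' (ltnW low) hX.
  rewrite subKn // in C.
  set z : rat := (t - d - tau)%:R in C; have z0 : 0 <= z by exact: ler0n.
  have Ez : (k * (t - d))%:R = (k * tau)%:R + k%:R * z :> rat.
    by rewrite -natrM -natrD -mulnDr subnKC // ltnW.
  have Et : (k * t)%:R = (k * (t - d))%:R + KD :> rat by rewrite -natrD -mulnDr subnK.
  have OL' : KD <= excess X s (t - d) - excess X s t by move: OL; rewrite Eg Et; lra.
  have zk : k%:R * z <= (k * t)%:R :> rat by rewrite Et Ez; have := ler0n rat (k * tau); lra.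
  have h : z * (KD - 2 * (KD * e)) <= z * (excess X s' (t - d) - excess X s' t).
    by apply: ler_wpM2l => //; lra.
  have h2 : d%:R * (z * (k%:R * (1 - 2 * e))) <= d%:R * (excess X s' tau - excess X s' (t - d)).
    apply: le_trans (le_trans _ h) C; rewrite /KD natrM le_eqVlt; apply/orP; left; apply/eqP; ring.
  rewrite ler_pM2l // in h2.
  have h3 : e * (k%:R * z) <= e * g.
    rewrite ler_wpM2l ?(ltW e0) //; apply: le_trans zk _; rewrite lerDl; exact: excess_ge0.
  rewrite /g'; rewrite /g' in eg'0; lra.
(* At the switching level [tau] the dual value of [s'] is exactly the sum of the minima of [k] and
   the means, which [etrunc_large] compares with [phi]. *)
have [tau tauX Etau] := min_sum X k s'.
have big : (1 - 3 * e) * ((k * tau)%:R + excess X s' tau) <= phi X k s'.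
  rewrite -Etau mulr_sumr; apply: ler_sum => x _; apply: etrunc_large => //.
  by rewrite e0 /=; lra.
have := lb tau tauX; move: big; set h : rat := (k * tau)%:R + _ => big lbt.
have eP0 : 0 <= e * P by apply: le_trans (ltW KD0) VKD.
have : (1 - 8 * e) * g <= h.
  rewrite -(ler_pM2l (_ : 0 < 1 + 2 * e)); last by lra.
  apply: le_trans lbt; have : 0 <= e * (e * g) by rewrite mulr_ge0 // ltW.
  clear; lra.
move=> h8.
have P0 : 0 <= P by apply: sumr_ge0 => x _; exact: etrunc_ge0.
have [neg|pos] := leP (1 - 11 * e) 0.
  apply: (@le_trans _ _ 0); first by rewrite mulr_le0_ge0.
  by apply: sumr_ge0 => x _; exact: etrunc_ge0.
have : (1 - 3 * e) * ((1 - 8 * e) * g) <= (1 - 3 * e) * h by rewrite ler_wpM2l //; lra.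
have : (1 - 11 * e) * P <= (1 - 11 * e) * g by apply: ler_wpM2l ubP; exact: ltW.
have : 0 <= e * (e * g) by rewrite mulr_ge0 // ltW.
clear - big; lra.
Qed.
End Sums.

(** * Expectation of Top_k *)

Section Link.
Local Open Scope ring_scope.

(** Reduced to the distributive law over a common index type, by tagging each atom with its
    variable. *)
Lemma distr_dffun (R : comNzRingType) (I : finType) (T_ : I -> finType)
    (F : forall i, T_ i -> R) :
  \prod_i \sum_(j : T_ i) F i j = \sum_(f : {dffun forall i, T_ i}) \prod_i F i (f i).
Proof.
rewrite (reindex (@dffun_of_fprod _ T_)); last exact/onW_bij/dffun_of_fprod_bij.
have -> : \sum_(t : fprod T_) \prod_i F i ((dffun_of_fprod t) i) =
    \sum_(t : fprod T_) \prod_(i in I) ([ffun j => F i j] : {ffun T_ i -> R}) (t i).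
  by apply: eq_bigr => t _; apply: eq_bigr => i _; rewrite !ffunE.
rewrite big_fprod -(bigA_distr_big_dep (fun i => tagged_with T_ i)
   (fun i j => untag 0 (fun x => ([ffun j => F i j] : {ffun T_ i -> R}) x) j)).
apply: eq_bigr => i _.
rewrite -(@big_tag _ 0 +%R I T_ (fun i j => ([ffun j => F i j] : {ffun T_ i -> R}) j) i).
by apply: eq_bigr => j _; rewrite ffunE.
Qed.

(** The product is the generating polynomial of the number of successes. *)
Lemma ebern_poly ps (f : nat -> rat) M : (size ps < M)%N ->
  \sum_(c < M) (\prod_(p <- ps) ((1 - p)%:P + p *: 'X) : {poly rat})`_c * f c = ebern ps f.
Proof.
elim: ps f M => [|p ps IH] f M /= HM.
  rewrite big_nil (bigD1 (Ordinal HM)) //= coef1 mul1r big1 ?addr0 // => c.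
  by rewrite -val_eqE /= coef1 => /negbTE->; rewrite mul0r.
case: M HM => // M HM; rewrite ltnS in HM.
rewrite big_cons; set G := \prod_(_ <- _) _ in IH *.
rewrite -(IH f M.+1 (leqW HM)) -(IH (fun c => f c.+1) M HM).
have E c : (((1 - p)%:P + p *: 'X) * G)`_c = (1 - p) * G`_c + p * (if c == 0%N then 0 else G`_c.-1).
  by rewrite mulrDl coefD mul_polyC -scalerAl !coefZ coefXM.
under eq_bigr => c _ do rewrite E mulrDl.
rewrite big_split /= !mulr_sumr; congr (_ + _); first by apply: eq_bigr => c _; rewrite mulrA.
rewrite big_ord_recl /= mulr0 mul0r add0r; apply: eq_bigr => c _.
by rewrite /bump /= mulrA.
Qed.

(** An upward closed property holds on an initial segment of a decreasing list. *)
Lemma count_take_sorted (s : seq rat) (a : pred rat) k :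
  sorted >=%R s -> (forall x y, x <= y -> a x -> a y) ->
  count a (take k s) = minn k (count a s).
Proof.
move=> H Ha; elim: s k H => [|x s IH] [|k] //= H.
  by rewrite min0n.
have Hs := path_sorted H; rewrite IH //.
case ax : (a x); first by lia.
have -> : count a s = 0%N; last by lia.
apply/eqP; rewrite -leqn0 leqNgt -has_count; apply/hasP => -[y ys ay].
have tr : transitive (>=%R : rel rat) by move=> u v w /= h1 h2; apply: le_trans h2 h1.
have := order_path_min tr H => /allP /(_ y ys) /= yx.
by move: ax; rewrite (Ha _ _ yx ay).
Qed.

Lemma count_sumR (s : seq rat) (a : pred rat) : \sum_(v <- s) (a v)%:R = (count a s)%:R :> rat.
Proof. by elim: s => [|v s IH]; rewrite ?big_nil // big_cons IH /= natrD. Qed.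

Lemma layer_cake (sg v : rat) (w X : nat) : sg * v = w%:R -> (w <= X)%N ->
  sg * v = \sum_(1 <= x < X.+1) (x%:R <= sg * v)%R%:R.
Proof.
move=> -> wX; under eq_bigr do rewrite ler_nat.
rewrite (@big_cat_nat _ _ _ w.+1) //= ?ltnS // [X in _ + X]big_nat_cond [X in _ + X]big1.
  rewrite addr0 (@eq_big_nat _ _ _ _ _ _ (fun=> 1)); last by move=> x; rewrite ltnS => /andP[_ ->].
  by rewrite sumr_const_nat subSS subn0.
by move=> x /andP[/andP[h _] _]; rewrite leqNgt h.
Qed.

Variables (n : nat) (X : n.-tuple distr) (sg : rat) (Xm : nat).
Hypothesis sg0 : 0 < sg.
Hypothesis Xd : all is_distr X.
Hypothesis Xint : forall i y, y \in tnth X i -> exists2 w : nat, sg * y.1 = w%:R & (w <= Xm)%N.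

Definition pr (i : 'I_n) (x : nat) : rat := \sum_(y <- tnth X i | x%:R <= sg * y.1) y.2.

Lemma distr_i i : is_distr (tnth X i).
Proof. by move/allP: Xd; apply; apply: mem_tnth. Qed.

Lemma mass_ge0 i y : y \in tnth X i -> 0 <= y.2.
Proof. by have /andP[/allP H _] := distr_i i; move=> /H /andP[]. Qed.

Lemma pr01 i x : in01 (pr i x).
Proof.
have /andP[/allP H /eqP S] := distr_i i; apply/andP; split.
  by rewrite /pr big_seq_cond; apply: sumr_ge0 => y /andP[/H /andP[]].
rewrite -S /pr [leRHS](bigID (fun y => x%:R <= sg * y.1)) /= lerDl big_seq_cond.
by apply: sumr_ge0 => y /andP[/H /andP[]].
Qed.

Lemma pr_mono i x y : (x <= y)%N -> pr i y <= pr i x.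
Proof.
move=> xy; rewrite /pr [leRHS](bigID (fun z => y%:R <= sg * z.1)) /=.
have -> : \sum_(z <- tnth X i | (x%:R <= sg * z.1) && (y%:R <= sg * z.1)) z.2 =
   \sum_(z <- tnth X i | y%:R <= sg * z.1) z.2.
  apply: eq_bigl => z; apply/andP/idP => [[]//|h]; split=> //; apply: le_trans h; by rewrite ler_nat.
rewrite lerDl big_seq_cond; apply: sumr_ge0 => z /andP[hz _]; exact: mass_ge0 hz.
Qed.

Implicit Type S : {set 'I_n}.

Definition above S (x : nat) (o : outcome X) : nat :=
  count (fun v => x%:R <= sg * v) [seq value i o | i <- enum S].

Lemma value_int (i : 'I_n) (o : outcome X) : exists2 w : nat, sg * value i o = w%:R & (w <= Xm)%N.
Proof. exact: (@Xint i _ (mem_tnth (o i) (in_tuple (tnth X i)))). Qed.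

Lemma topE k S (o : outcome X) :
  sg * top k S o = \sum_(1 <= x < Xm.+1) (minn k (above S x o))%:R.
Proof.
rewrite /top mulr_sumr; set L := sort _ _.
have HL : {in take k L, forall v, sg * v = \sum_(1 <= x < Xm.+1) (x%:R <= sg * v)%R%:R}.
  move=> v /mem_take; rewrite mem_sort => /mapP[i _ ->].
  by have [w Ew wX] := value_int i o; apply: layer_cake Ew wX.
rewrite big_seq_cond (eq_bigr _ (fun v (hv : (v \in take k L) && true) => HL v (proj1 (andP hv)))).
rewrite -big_seq_cond exchange_big /=; apply: eq_bigr => x _.
have sL : sorted >=%R L by apply: sort_sorted => u v; exact: le_total.
rewrite (count_sumR (take k L) (fun v => x%:R <= sg * v)) count_take_sorted //; last first.
  by move=> u v uv h; apply: le_trans h _; rewrite ler_pM2l.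
by congr (minn k _)%:R; rewrite /above; apply/permP; rewrite perm_sort.
Qed.

(** Atom [j] of variable [i] contributes its mass, times ['X] if it counts for level [x]. Expanding
    the product over all outcomes gives the law of the count; summing over the atoms first gives the
    factors of [ebern_poly]. *)
Lemma ebern_expectation S x (f : nat -> rat) :
  expectation (fun o => f (above S x o)) = ebern (row pr (enum S) x) f.
Proof.
have Hsz : (size (row pr (enum S) x) < n.+1)%N.
  by rewrite size_map -cardE ltnS -[X in (_ <= X)%N](card_ord n) max_card.
rewrite -(ebern_poly f Hsz) big_map big_enum /=.
pose b (i : 'I_n) (j : 'I_(size (tnth X i))) : nat := (i \in S) && (x%:R <= sg * (tnth (in_tuple (tnth X i)) j).1).
pose F i j : {poly rat} := (tnth (in_tuple (tnth X i)) j).2 *: 'X^(b i j).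
have EF i : \sum_j F i j = if i \in S then (1 - pr i x)%:P + pr i x *: 'X else 1.
  have M : \sum_(j < size (tnth X i)) (tnth (in_tuple (tnth X i)) j).2 = 1.
    have /andP[_ /eqP <-] := distr_i i.
    by rewrite (big_tnth _ _ (tnth X i)).
  case: ifP => iS; last first.
    rewrite (eq_bigr (fun j => (tnth (in_tuple (tnth X i)) j).2 *: 1)); last first.
      by move=> j _; rewrite /F /b iS expr0.
    by rewrite -scaler_suml M scale1r.
  have Pi : pr i x = \sum_(j < size (tnth X i) | x%:R <= sg * (tnth (in_tuple (tnth X i)) j).1) (tnth (in_tuple (tnth X i)) j).2.
    by rewrite /pr (big_tnth _ _ (tnth X i)).
  rewrite (bigID (fun j : 'I__ => x%:R <= sg * (tnth (in_tuple (tnth X i)) j).1)) /= addrC; congr (_ + _).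
    rewrite (eq_bigr (fun j => ((tnth (in_tuple (tnth X i)) j).2)%:P)); last first.
      by move=> j /negbTE h; rewrite /F /b h andbF expr0 alg_polyC.
    rewrite -rmorph_sum /=; congr (_%:P); rewrite Pi; apply/eqP.
    rewrite eq_sym subr_eq -M; apply/eqP.
    by rewrite [RHS]addrC; exact: bigID.
  rewrite Pi scaler_suml; apply: eq_bigr => j h.
  by rewrite /F /b iS h expr1.
have -> : \prod_(i in S) ((1 - pr i x)%:P + pr i x *: 'X) = \prod_i \sum_j F i j.
  by rewrite big_mkcond; apply: eq_bigr => i _; rewrite EF.
rewrite distr_dffun /expectation.
under [RHS]eq_bigr => c _ do rewrite coef_sum mulr_suml.
rewrite exchange_big /=; apply: eq_bigr => o _.
have Hab : above S x o = (\sum_(i < n) b i (o i))%N.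
  rewrite /above count_map -sum1_count big_enum_cond /= big_mkcond /=.
  by apply: eq_bigr => i _; rewrite /b /value /atom_at; case: (i \in S); case: (_ <= _).
have -> : \prod_(i < n) F i (o i) = prob o *: 'X^(above S x o).
  by rewrite /F scaler_prod prodrXr -Hab.
have N : (above S x o < n.+1)%N.
  rewrite ltnS Hab; apply: (@leq_trans (\sum_(i < n) 1)); last by rewrite sum1_card card_ord.
  by apply: leq_sum => i _; exact: leq_b1.
rewrite (bigD1 (Ordinal N)) //= coefZ coefXn eqxx mulr1 big1 ?addr0 // => c.
by rewrite -val_eqE /= coefZ coefXn => /negbTE->; rewrite mulr0 mul0r.
Qed.

Lemma expectation_top k S : sg * expectation (top (X := X) k S) = phi pr Xm k (enum S).
Proof.
rewrite /expectation mulr_sumr /phi.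
under eq_bigr => o _ do rewrite mulrCA topE mulr_sumr.
rewrite exchange_big /=; apply: eq_bigr => x _.
exact: (ebern_expectation S x (fun c => (minn k c)%:R)).
Qed.

End Link.

(** * Query weights and scores *)

Section Algorithm.
Local Open Scope nat_scope.

Definition idist := seq (nat * nat).

(** A product of denominators stands in for the least common multiple; its bit length is still
    linear in that of the input. *)
Definition vden (X : seq distr) : nat := \prod_(D <- X) \prod_(y <- D) `|denq y.1|.
Definition mden (X : seq distr) : nat := \prod_(D <- X) \prod_(y <- D) `|denq y.2|.

Definition intd (c Q : nat) (D : distr) : idist :=
  [seq (`|numq y.1| * c %/ `|denq y.1|, `|numq y.2| * Q %/ `|denq y.2|) | y <- D].

Definition tailmass (D : idist) (x : nat) : nat :=
  \sum_(y <- D) (if x <= y.1 then y.2 else 0).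

Definition exces (D : idist) (t : nat) : nat := \sum_(y <- D) y.2 * (y.1 - t).

Definition horner (B : nat) (ds : seq nat) : nat :=
  foldl (fun acc d => acc * B + d) 0 ds.

(* The scaled distributions, the common mass denominator, [k], and [N >= 1/eps]
   in unary, since the running time may be exponential in the length of [eps]. *)
Definition params := (seq idist * (nat * (nat * seq unit)))%type.

Definition pZ (p : params) := p.1.
Definition pQ (p : params) := p.2.1.
Definition pk (p : params) := p.2.2.1.
Definition pu (p : params) := p.2.2.2.
Definition pn (p : params) := size (pZ p).
Definition pN (p : params) := size (pu p).

(** Product of two unary numbers. *)
Definition utimes T U (s : seq T) (r : seq U) : seq U := flatten [seq r | _ <- s].

Lemma size_utimes T U (s : seq T) (r : seq U) : size (utimes s r) = size s * size r.
Proof. by rewrite /utimes; elim: s => //= a s IH; rewrite size_cat IH. Qed.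

(** Values are scaled by [Q N k] beyond their common denominator: every [exces D 0] is then
    divisible by [Q N k], and the units [r * exces D 0 %/ (Q N k)] of the guesses are exact. *)
Definition mk_params (x : (seq distr * (nat * rat)) * seq unit) : params :=
  let Q := mden x.1.1 in let k := x.1.2.1 in
  let c := vden x.1.1 * (Q * size x.2 * k) in
  ([seq intd c Q D | D <- x.1.1], (Q, (k, x.2))).

Definition levels_fuel (p : params) := utimes (utimes (pu p) (pu p)) (utimes (pu p) (pu p)).
Definition moments_fuel (p : params) := utimes (nseq 100 tt) (utimes (pu p) (pu p)).

(** Rounding loses at most one per element, so a power sum is known up to [n / prec], which is
    exactly the accuracy [(24 N^2) ^- (2 m)] that [level] asks for. *)
Definition prec (p : params) : nat :=
  pn p * (24 * size (utimes (pu p) (pu p))) ^ size (utimes (nseq 2 tt) (moments_fuel p)).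

(** The mean excess in units of [k d / c]. Rounding loses at most [n k d / c] over a set: this is
    [k d] for [c = n], used for small [k], and [k d / N] for [c = n N], used for large [k]. *)
Definition unit_digit (p : params) (d c t : nat) (D : idist) : nat :=
  c * exces D t %/ (pk p * d * pQ p).

Definition moment_digits (p : params) (x : nat) (D : idist) : seq nat :=
  [seq prec p * y.1 %/ y.2 | y <- zip (traject (muln (tailmass D x)) 1 (size (moments_fuel p)))
                                   (traject (muln (pQ p)) 1 (size (moments_fuel p)))].

Definition digits_small (p : params) (d : nat) (D : idist) : seq nat :=
  unit_digit p d (pn p) (size (levels_fuel p) * d) D ::
  flatten [seq moment_digits p x D | x <- traject (addn d) d (size (levels_fuel p))].

Definition digits_large (p : params) (d t : nat) (D : idist) : seq nat :=
  [:: unit_digit p d (pn p * pN p) (t - d) D; unit_digit p d (pn p * pN p) t D;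
      unit_digit p d (pn p * pN p) (t + d) D].

Definition base_small (p : params) : nat := (pn p * prec p).+1.
Definition base_large (p : params) : nat := (pn p * (pn p * pN p * pN p)).+1.
Definition cap_small (p : params) : nat :=
  base_small p ^ size (tt :: utimes (levels_fuel p) (moments_fuel p)).
Definition cap_large (p : params) : nat := base_large p ^ 3.

(* Elements of mean larger than [mu] get the weight [cap], too large to occur in
   a set whose total weight is below [cap]. *)
Definition weight_small (p : params) (g : nat * nat) (D : idist) : nat :=
  if exces D 0 <= g.1 then horner (base_small p) (digits_small p g.2 D) else cap_small p.

Definition weight_large (p : params) (g : nat * nat) (t : nat) (D : idist) : nat :=
  if exces D 0 <= g.1 then horner (base_large p) (digits_large p g.2 t D) else cap_large p.

(** The optimum lies between the largest mean in the optimal set and [n] times this mean, so some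
    multiple of it with [r <= n] is right within a factor 2. The mean itself is kept as the cutoff
    for heavy elements. *)
Definition guesses (p : params) : seq (nat * nat) :=
  flatten [seq [seq (exces D 0, r * exces D 0 %/ (pQ p * pN p * pk p))
               | r <- traject (addn 1) 1 (pn p)] | D <- pZ p].

Definition weights_small (p : params) : seq (seq nat) :=
  [seq [seq weight_small p g D | D <- pZ p] | g <- guesses p].

Definition weights_large (p : params) : seq (seq nat) :=
  flatten [seq [seq [seq weight_large p g t D | D <- pZ p]
               | t <- traject (addn g.2) 0 (size (tt :: utimes (pZ p) (pu p)))]
          | g <- guesses p].

(** The test [1 / eps^2 <= k] with denominators cleared. *)
Definition is_large (k : nat) (eps : rat) : bool :=
  `|denq eps| * `|denq eps| <= k * (`|numq eps| * `|numq eps|).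

Definition insert_nat (v : nat) (l : seq nat) : seq nat :=
  [seq w <- l | w < v] ++ v :: [seq w <- l | v <= w].

Definition sorted_values (Z : seq idist) : seq nat :=
  foldr insert_nat [::] (flatten [seq [seq y.1 | y <- D] | D <- Z]).

Definition trunc_list (p : params) : seq nat :=
  [seq minn (pk p) c | c <- traject (addn 1) 0 (size (tt :: [seq tt | _ <- pZ p]))].

(** Sends the table of a function of the count to [Q] times its mean after one more trial of success
    probability [a / Q]. The table becomes one entry shorter. *)
Definition pstep (Q : nat) (f : seq nat) (a : nat) : seq nat :=
  [seq (Q - a) * xy.1 + a * xy.2 | xy <- zip f (behead f)].

(** Elements outside the set are trials of probability 0, so the value is scaled by [Q ^ n] for
    every set and scores are comparable. *)
Definition level_score (p : params) (S : seq bool) (x : nat) : nat :=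
  head 0 (foldl (fun f a => pstep (pQ p) f a) (trunc_list p)
    [seq (if y.2 then tailmass y.1 x else 0) | y <- zip (pZ p) S]).

(** There may be exponentially many integer levels, but the summand is constant between consecutive
    atom values, so only these are visited. *)
Definition score (p : params) (vs : seq nat) (S : seq bool) : nat :=
  \sum_(ab <- zip (0 :: vs) vs) (ab.2 - ab.1) * level_score p S ab.2.

End Algorithm.

(** * Polynomial-time programs for the weights and the score *)

Section PtAlgorithm.
Local Open Scope nat_scope.

Lemma nat_bits0_enc : @encode nat_encType 0 = Leaf.
Proof. by rewrite /encode /= /enc_nat nat_bits0. Qed.

Definition params_enc := prod_encType (list_encType (list_encType (prod_encType nat_encType nat_encType)))
  (prod_encType nat_encType (prod_encType nat_encType (list_encType unit_encType))).

Lemma pt_c1 (A B C : encType) (g : A -> C) : pt g -> pt (fun x : A * B => g x.1).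
Proof. move=> H; exact: (pt_comp H (pt_fst pt_id)). Qed.

Lemma pt_minn (A : encType) (f g : A -> nat) : pt f -> pt g -> pt (fun a => minn (f a) (g a)).
Proof. by move=> F G; apply: (pt_if (pt_ltn F G) F G). Qed.

Ltac ptt := lazymatch goal with
  | H : pt ?g |- pt ?g => exact H
  | |- pt (fun x => x) => exact pt_id
  | |- pt fst => exact (pt_fst pt_id)
  | |- pt snd => exact (pt_snd pt_id)
  | |- pt (fun x => fst (@?f x)) => apply (pt_fst (f := f)); ptt
  | |- pt (fun x => snd (@?f x)) => apply (pt_snd (f := f)); ptt
  | |- pt (fun x => pair (@?f x) (@?g x)) => apply (pt_pair (f := f) (g := g)); ptt
  | |- pt (fun x => cons (@?f x) (@?g x)) => apply (pt_cons (f := f) (g := g)); ptt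
  | |- pt (fun x => cat (@?f x) (@?g x)) => apply (pt_cat (f := f) (g := g)); ptt
  | |- pt (fun x => addn (@?f x) (@?g x)) => apply (pt_addn (f := f) (g := g)); ptt
  | |- pt (fun x => muln (@?f x) (@?g x)) => apply (pt_muln (f := f) (g := g)); ptt
  | |- pt (fun x => divn (@?f x) (@?g x)) => apply (pt_divn (f := f) (g := g)); ptt
  | |- pt (fun x => subn (@?f x) (@?g x)) => apply (pt_subn (f := f) (g := g)); ptt
  | |- pt (fun x => minn (@?f x) (@?g x)) => apply (pt_minn (f := f) (g := g)); ptt
  | |- pt (fun x => leq (S (@?f x)) (@?g x)) => apply (pt_ltn (f := f) (g := g)); ptt
  | |- pt (fun x => leq (@?f x) (@?g x)) => apply (pt_leq (f := f) (g := g)); ptt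
  | |- pt (fun x => S (@?f x)) => apply (pt_succ (f := f)); ptt
  | |- pt (fun x => behead (@?f x)) => apply (pt_behead (f := f)); ptt
  | H : pt ?g |- pt (fun x => ?g (@?y x)) => apply (pt_comp (g := g) (f := y) H); ptt
  | _ => first [exact (pt_const _) | apply pt_if; ptt | idtac]
  end.

Lemma pt_absnum (A : encType) (f : A -> rat) : pt f -> pt (fun a => `|numq (f a)|).
Proof.
move=> H; apply: (@pt_comp _ rat_encType nat_encType (fun q => `|numq q|) _ _ H).
apply: (@pt_expr _ _ _ (fun x => ETl (EHd (EVar x))) 4) => [s x a /= ->//|//|].
exists 1 => a; rewrite /pb mul1n expn1 /sz /= /enc_rat /enc_int /=; lia.
Qed.

Lemma pt_absden (A : encType) (f : A -> rat) : pt f -> pt (fun a => `|denq (f a)|).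
Proof.
move=> H; apply: (@pt_comp _ rat_encType nat_encType (fun q => `|denq q|) _ _ H).
apply: (@pt_expr _ _ _ (fun x => ETl (ETl (EVar x))) 4) => [s x a /= ->//|//|].
exists 1 => a; rewrite /pb mul1n expn1 /sz /= /enc_rat /enc_int /=; lia.
Qed.

Lemma pt_vden (A : encType) (f : A -> seq distr) : pt f -> pt (fun a => vden (f a)).
Proof.
move=> H; rewrite /vden; apply: (@pt_prod _ (list_encType (prod_encType rat_encType rat_encType))
  (fun _ D => \prod_(y <- D) `|denq y.1|)) => //.
apply: (@pt_prod _ (prod_encType rat_encType rat_encType) (fun _ y => `|denq y.1|)).
  by apply: pt_absden; ptt.
by ptt.
Qed.

Lemma pt_mden (A : encType) (f : A -> seq distr) : pt f -> pt (fun a => mden (f a)).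
Proof.
move=> H; rewrite /mden; apply: (@pt_prod _ (list_encType (prod_encType rat_encType rat_encType))
  (fun _ D => \prod_(y <- D) `|denq y.2|)) => //.
apply: (@pt_prod _ (prod_encType rat_encType rat_encType) (fun _ y => `|denq y.2|)).
  by apply: pt_absden; ptt.
by ptt.
Qed.

Lemma pt_intd (A : encType) (c Q : A -> nat) (D : A -> distr) : pt c -> pt Q -> pt D ->
  pt (fun a => intd (c a) (Q a) (D a)).
Proof.
move=> Hc HQ HD; rewrite /intd.
apply: (@pt_map _ (prod_encType rat_encType rat_encType) (prod_encType nat_encType nat_encType)
 (fun a y => (`|numq y.1| * c a %/ `|denq y.1|, `|numq y.2| * Q a %/ `|denq y.2|))) => //.
have c' := @pt_c1 A (prod_encType rat_encType rat_encType) _ _ Hc.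
have Q' := @pt_c1 A (prod_encType rat_encType rat_encType) _ _ HQ.
apply: pt_pair; apply: pt_divn; first [apply: pt_muln => //; apply: pt_absnum | apply: pt_absden]; ptt.
Qed.

Lemma pt_tailmass (A : encType) (D : A -> idist) (x : A -> nat) : pt D -> pt x ->
  pt (fun a => tailmass (D a) (x a)).
Proof.
move=> HD Hx; rewrite /tailmass.
apply: (@pt_sum _ (prod_encType nat_encType nat_encType) (fun a y => if x a <= y.1 then y.2 else 0)) => //.
by have x' := @pt_c1 A (prod_encType nat_encType nat_encType) _ _ Hx; ptt.
Qed.

Lemma pt_exces (A : encType) (D : A -> idist) (x : A -> nat) : pt D -> pt x ->
  pt (fun a => exces (D a) (x a)).
Proof.
move=> HD Hx; rewrite /exces.
apply: (@pt_sum _ (prod_encType nat_encType nat_encType) (fun a y => y.2 * (y.1 - x a))) => //.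
by have x' := @pt_c1 A (prod_encType nat_encType nat_encType) _ _ Hx; ptt.
Qed.

Lemma pt_horner (A : encType) (B : A -> nat) (ds : A -> seq nat) : pt B -> pt ds ->
  pt (fun a => horner (B a) (ds a)).
Proof.
move=> HB Hd; rewrite /horner; have [e E] := pt_size HB.
apply: (@pt_foldl_nat _ nat_encType (fun a acc d => acc * B a + d) _ _ (e + 1)) => //.
- have B' := @pt_c1 A (prod_encType nat_encType nat_encType) _ _ HB; ptt.
- exact: pt_const.
move=> a s b; apply: leq_trans (blD _ _) _; apply: leq_trans (leq_add (blM _ _) (leqnn _)) _.
rewrite -addnA leq_add2l.
have := E a; have := bl_sz (B a); have := bl_sz b => h1 h2 h3.
have : pb e (sz a) + (sz a + sz b) <= pb (e + 1) (sz a + sz b).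
  rewrite /pb addn1 expnS mulSn addnC leq_add //; last first.
    by rewrite leq_mul // -[X in X <= _]mul1n leq_mul ?addn_gt0 ?sz_gt0 //; case: (e) => // j; rewrite leq_exp2r // leq_addr.
  by rewrite leq_pmulr // expn_gt0 addn_gt0 sz_gt0.
by lia.
Qed.

Lemma pt_utimes (A : encType) (U V : encType) (s : A -> seq U) (r : A -> seq V) : pt s -> pt r ->
  pt (fun a => utimes (s a) (r a)).
Proof.
move=> Hs Hr; rewrite /utimes; apply: pt_flatten.
by apply: (@pt_map _ U (list_encType V) (fun a _ => r a)) => //; exact: pt_c1.
Qed.

Lemma pt_unit_digit (A : encType) (p : A -> params) (d c t : A -> nat) (D : A -> idist) :
  pt p -> pt d -> pt c -> pt t -> pt D ->
  pt (fun a => unit_digit (p a) (d a) (c a) (t a) (D a)).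
Proof.
move=> Hp Hd Hc Ht HD; rewrite /unit_digit /pk /pQ.
by have He := pt_exces HD Ht; ptt.
Qed.

Lemma pt_pu : pt (fun p : params => pu p).
Proof. by rewrite /pu; ptt. Qed.

Lemma pt_levels_fuel : pt (fun p : params => levels_fuel p).
Proof. by rewrite /levels_fuel; apply: pt_utimes; apply: pt_utimes; exact: pt_pu. Qed.

Lemma pt_moments_fuel : pt (fun p : params => moments_fuel p).
Proof.
apply: pt_utimes; first exact: pt_const.
by apply: pt_utimes; exact: pt_pu.
Qed.

Lemma pt_pn : pt (fun p : params => pn p).
Proof. by apply: pt_sizen; rewrite /pZ; ptt. Qed.

Lemma pt_pN : pt (fun p : params => pN p).
Proof. by apply: pt_sizen; exact: pt_pu. Qed.

Lemma pt_prec : pt (fun p : params => prec p).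
Proof.
rewrite /prec; apply: pt_muln; first exact: pt_pn.
apply: pt_expn.
  apply: pt_muln; first exact: pt_const.
  by apply: pt_sizen; apply: pt_utimes; exact: pt_pu.
by apply: pt_utimes; [exact: pt_const | exact: pt_moments_fuel].
Qed.

Lemma pt_moment_digits (A : encType) (p : A -> params) (x : A -> nat) (D : A -> idist) :
  pt p -> pt x -> pt D -> pt (fun a => moment_digits (p a) (x a) (D a)).
Proof.
move=> Hp Hx HD; rewrite /moment_digits.
apply: (@pt_map _ (prod_encType nat_encType nat_encType) nat_encType
  (fun a y => prec (p a) * y.1 %/ y.2)).
  by have Hc := @pt_c1 A (prod_encType nat_encType nat_encType) _ _ (pt_comp pt_prec Hp); ptt.
apply: pt_zip; first exact: nat_bits0_enc.
  by apply: pt_traject_muln; [apply: pt_tailmass | exact: (pt_comp pt_moments_fuel Hp)].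
by apply: pt_traject_muln; [rewrite /pQ; ptt | exact: (pt_comp pt_moments_fuel Hp)].
Qed.

Lemma pt_digits_small : pt (fun x : params * (nat * idist) => digits_small x.1 x.2.1 x.2.2).
Proof.
have H1 : pt (fun x : params * (nat * idist) => pn x.1) by exact: (pt_comp pt_pn (pt_fst pt_id)).
have H2 : pt (fun x : params * (nat * idist) => levels_fuel x.1).
  exact: (pt_comp pt_levels_fuel (pt_fst pt_id)).
have H3 := pt_sizen H2.
rewrite /digits_small; apply: pt_cons.
  by apply: pt_unit_digit; ptt.
apply: pt_flatten.
apply: (@pt_map _ nat_encType (list_encType nat_encType)
  (fun (x : params * (nat * idist)) (y : nat) => moment_digits x.1 y x.2.2)).
  by apply: pt_moment_digits; ptt.
by apply: pt_traject_addn => //; ptt.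
Qed.

Lemma pt_digits_large : pt (fun x : params * ((nat * nat) * idist) => digits_large x.1 x.2.1.1 x.2.1.2 x.2.2).
Proof.
have H1 : pt (fun x : params * ((nat * nat) * idist) => pn x.1 * pN x.1).
  apply: pt_muln; [exact: (pt_comp pt_pn (pt_fst pt_id)) | exact: (pt_comp pt_pN (pt_fst pt_id))].
rewrite /digits_large; apply: pt_cons; first by apply: pt_unit_digit; ptt.
apply: pt_cons; first by apply: pt_unit_digit; ptt.
by apply: pt_cons; [apply: pt_unit_digit; ptt | exact: pt_const].
Qed.

Lemma pt_base_small : pt base_small.
Proof. by apply: pt_succ; apply: pt_muln; [exact: pt_pn | exact: pt_prec]. Qed.

Lemma pt_base_large : pt base_large.
Proof.
apply: pt_succ; apply: pt_muln; first exact: pt_pn.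
by apply: pt_muln; [apply: pt_muln; [exact: pt_pn | exact: pt_pN] | exact: pt_pN].
Qed.

Lemma pt_cap_small : pt cap_small.
Proof.
apply: pt_expn; first exact: pt_base_small.
apply: pt_cons; first exact: pt_const.
by apply: pt_utimes; [exact: pt_levels_fuel | exact: pt_moments_fuel].
Qed.

Lemma pt_cap_large : pt cap_large.
Proof. by apply: (@pt_expn _ unit_encType _ (fun=> nseq 3 tt)); [exact: pt_base_large | exact: pt_const]. Qed.

Lemma pt_guesses : pt guesses.
Proof.
rewrite /guesses; apply: pt_flatten.
apply: (@pt_map params_enc (list_encType (prod_encType nat_encType nat_encType))
  (list_encType (prod_encType nat_encType nat_encType))
  (fun p D => [seq (exces D 0, r * exces D 0 %/ (pQ p * pN p * pk p)) | r <- traject (addn 1) 1 (pn p)])); last first.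
  by rewrite /pZ; ptt.
apply: (@pt_map _ nat_encType (prod_encType nat_encType nat_encType)
  (fun (x : params * idist) r => (exces x.2 0, r * exces x.2 0 %/ (pQ x.1 * pN x.1 * pk x.1)))).
  have He : pt (fun x : params * idist * nat => exces x.1.2 0).
    by apply: pt_exces; [ptt | exact: pt_const].
  have HN : pt (fun x : params * idist * nat => pN x.1.1).
    exact: (pt_comp pt_pN (pt_fst (pt_fst pt_id))).
  by rewrite /pQ /pk; ptt.
apply: (@pt_traject_addn _ (list_encType (prod_encType nat_encType nat_encType)) (fun=> 1) (fun=> 1) (fun x : params * idist => pZ x.1)).
- exact: pt_const.
- exact: pt_const.
- by rewrite /pZ; ptt.
Qed.

Lemma pt_weights_small : pt weights_small.
Proof.
rewrite /weights_small.
apply: (@pt_map params_enc (prod_encType nat_encType nat_encType) (list_encType nat_encType)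
  (fun p g => [seq weight_small p g D | D <- pZ p])); last exact: pt_guesses.
apply: (@pt_map _ (list_encType (prod_encType nat_encType nat_encType)) nat_encType
  (fun (x : params * (nat * nat)) D => weight_small x.1 x.2 D)); last by rewrite /pZ; ptt.
rewrite /weight_small; apply: pt_if.
- apply: pt_leq; last by ptt.
  by apply: pt_exces; [ptt | exact: pt_const].
- apply: pt_horner; first exact: (pt_comp pt_base_small (pt_fst (pt_fst pt_id))).
  exact: (pt_comp pt_digits_small (pt_pair (pt_fst (pt_fst pt_id))
    (pt_pair (pt_snd (pt_snd (pt_fst pt_id))) (pt_snd pt_id)))).
- exact: (pt_comp pt_cap_small (pt_fst (pt_fst pt_id))).
Qed.

Lemma pt_weights_large : pt weights_large.
Proof.
rewrite /weights_large; apply: pt_flatten.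
apply: (@pt_map params_enc (prod_encType nat_encType nat_encType) (list_encType (list_encType nat_encType))
  (fun p g => [seq [seq weight_large p g t D | D <- pZ p]
               | t <- traject (addn g.2) 0 (size (tt :: utimes (pZ p) (pu p)))])); last exact: pt_guesses.
apply: (@pt_map _ nat_encType (list_encType nat_encType)
  (fun (x : params * (nat * nat)) t => [seq weight_large x.1 x.2 t D | D <- pZ x.1])); last first.
  apply: (@pt_traject_addn _ unit_encType (fun x : params * (nat * nat) => x.2.2) (fun=> 0)
    (fun x => tt :: utimes (pZ x.1) (pu x.1))).
  - by ptt.
  - exact: pt_const.
  - apply: pt_cons; first exact: pt_const.
    by apply: pt_utimes; rewrite /pZ /pu; ptt.
apply: (@pt_map _ (list_encType (prod_encType nat_encType nat_encType)) nat_encType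
  (fun (x : params * (nat * nat) * nat) D => weight_large x.1.1 x.1.2 x.2 D)); last by rewrite /pZ; ptt.
rewrite /weight_large; apply: pt_if.
- apply: pt_leq; last by ptt.
  by apply: pt_exces; [ptt | exact: pt_const].
- apply: pt_horner; first exact: (pt_comp pt_base_large (pt_fst (pt_fst (pt_fst pt_id)))).
  exact: (pt_comp pt_digits_large (pt_pair (pt_fst (pt_fst (pt_fst pt_id)))
    (pt_pair (pt_pair (pt_snd (pt_snd (pt_fst (pt_fst pt_id)))) (pt_snd (pt_fst pt_id))) (pt_snd pt_id)))).
- exact: (pt_comp pt_cap_large (pt_fst (pt_fst (pt_fst pt_id)))).
Qed.

Lemma pt_mk_params : pt mk_params.
Proof.
rewrite /mk_params.
have HQ : pt (fun x : (seq distr * (nat * rat)) * seq unit => mden x.1.1) by apply: pt_mden; ptt.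
have HV : pt (fun x : (seq distr * (nat * rat)) * seq unit => vden x.1.1) by apply: pt_vden; ptt.
have Hs : pt (fun x : (seq distr * (nat * rat)) * seq unit => size x.2) by apply: pt_sizen; ptt.
apply: pt_pair; last by ptt.
apply: (@pt_map _ (list_encType (prod_encType rat_encType rat_encType)) (list_encType (prod_encType nat_encType nat_encType))
  (fun (x : (seq distr * (nat * rat)) * seq unit) D =>
     intd (vden x.1.1 * (mden x.1.1 * size x.2 * x.1.2.1)) (mden x.1.1) D)); last by ptt.
apply: pt_intd; last by ptt.
  apply: pt_muln; first exact: (pt_comp HV (pt_fst pt_id)).
  apply: pt_muln; last by ptt.
  by apply: pt_muln; [exact: (pt_comp HQ (pt_fst pt_id)) | exact: (pt_comp Hs (pt_fst pt_id))].
exact: (pt_comp HQ (pt_fst pt_id)).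
Qed.

Lemma pt_is_large (A : encType) (k : A -> nat) (eps : A -> rat) : pt k -> pt eps ->
  pt (fun a => is_large (k a) (eps a)).
Proof.
move=> Hk He; rewrite /is_large; have Hd := pt_absden He; have Hn := pt_absnum He.
by ptt.
Qed.

Lemma pt_sorted_values : pt sorted_values.
Proof.
rewrite /sorted_values.
apply: (@pt_foldr_meas _ nat_encType (list_encType nat_encType) (@sz _)
  (fun (_ : seq idist) v l => insert_nat v l) (fun=> [::]) _ 1).
- rewrite /insert_nat; apply: pt_cat.
    apply: (@pt_filter _ nat_encType (fun (x : seq idist * (seq nat * nat)) w => w < x.2.2)); by ptt.
  apply: pt_cons; first by ptt.
  apply: (@pt_filter _ nat_encType (fun (x : seq idist * (seq nat * nat)) w => x.2.2 <= w)); by ptt.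
- exact: pt_const.
- apply: pt_flatten.
  apply: (@pt_map _ (list_encType (prod_encType nat_encType nat_encType)) (list_encType nat_encType)
    (fun (_ : seq idist) D => [seq y.1 | y <- D])); last by ptt.
  apply: (@pt_map _ (prod_encType nat_encType nat_encType) nat_encType
    (fun (_ : seq idist * idist) y => y.1)); by ptt.
- by move=> s; rewrite /pb mul1n expn1.
- by move=> s; rewrite /pb mul1n expn1.
- move=> Z l v; rewrite /pb mul1n expn1.
  pose SZ := @sz (list_encType nat_encType).
  have h : (SZ ([seq w <- l | w < v] ++ v :: [seq w <- l | v <= w])).+1 =
    SZ [seq w <- l | w < v] + (sz v + SZ [seq w <- l | v <= w]).+1.
    exact: (@sz_cat nat_encType).
  have h2 : SZ [seq w <- l | w < v] + SZ [seq w <- l | v <= w] = (SZ l).+1.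
    have c w r : SZ (w :: r) = (@sz nat_encType w + SZ r).+1 by [].
    elim: l {h} => //= w l IH; rewrite c.
    by case: leqP => Hw; rewrite !c; lia.
  change (SZ (insert_nat v l) <= SZ l + (sz Z + @sz nat_encType v)).
  set zZ := sz Z; have hZ : 0 < zZ by exact: sz_gt0.
  rewrite /insert_nat; move: h h2 hZ; rewrite /insert_nat.
  move: (SZ (_ ++ _)) (SZ (filter _ _)) (SZ (filter _ _)) (SZ l) (@sz nat_encType v) => a b b' c d.
  by clear; lia.
Qed.

Lemma pt_trunc_list : pt trunc_list.
Proof.
rewrite /trunc_list.
apply: (@pt_map params_enc nat_encType nat_encType (fun p c => minn (pk p) c)).
  by rewrite /pk; ptt.
apply: (@pt_traject_addn _ unit_encType (fun=> 1) (fun=> 0)).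
- exact: pt_const.
- exact: pt_const.
- apply: pt_cons; first exact: pt_const.
  apply: (@pt_map params_enc (list_encType (prod_encType nat_encType nat_encType)) unit_encType (fun _ _ => tt)).
    exact: pt_const.
  by rewrite /pZ; ptt.
Qed.

Definition list_le (M L : nat) (f : seq nat) := (size f <= L) && all (fun x => x < 2 ^ M) f.

Lemma sz_list_le M L f : list_le M L f -> sz f <= (L * (4 * M + 2)).+1.
Proof.
case/andP=> HL /allP H.
have : sz f <= (size f * (4 * M + 1).+1).+1.
  by apply: sz_seq_le => i x0 Hi; apply: sz_nat_lt; apply: H; apply: mem_nth.
move/leq_trans; apply; rewrite ltnS; apply: leq_mul => //; lia.
Qed.

(** Each trial adds the bit lengths of [Q] and [a] to the entries, so over all trials their length
    grows linearly instead of compounding. *)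
Lemma pstep_le Q f a M L q b : list_le M L f -> Q < 2 ^ q -> a < 2 ^ b ->
  list_le (M + q + b) L (pstep Q f a).
Proof.
move=> /andP[HL /allP H] HQ Ha; apply/andP; split.
  by rewrite size_map size_zip size_behead; lia.
apply/allP => z /mapP[[x y] xy ->] /=.
have [x1 y1] : x \in f /\ y \in f.
  elim: f {HL H} xy => // c [|d f] IH //=; rewrite in_cons => /orP[/eqP[-> ->]|h].
    by split; rewrite !in_cons eqxx ?orbT.
  by have [h1 h2] := IH h; split; rewrite in_cons ?h1 ?h2 orbT.
have := H _ x1; have := H _ y1; rewrite /= => hy hx.
rewrite !expnD; move: (2 ^ M) (2 ^ q) (2 ^ b) hx hy HQ Ha => m w v hx hy HQ Ha.
have h1 : (Q - a) * x <= (w - 1) * (m - 1) by apply: leq_mul; lia.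
have h2 : a * y <= (v - 1) * (m - 1) by apply: leq_mul; lia.
have h3 : (w - 1) * (m - 1) + (v - 1) * (m - 1) < m * w * v.
  rewrite -mulnDl.
  rewrite -mulnA; have h4 : (w - 1 + (v - 1)) <= w * v - 1 by nia.
  have h5 : 0 < w * v by nia.
  move: (w * v) h4 h5 => u h4 h5; nia.
by lia.
Qed.

Lemma pt_level_score : pt (fun x : (params * seq bool) * nat => level_score x.1.1 x.1.2 x.2).
Proof.
pose PS := prod_encType (prod_encType params_enc (list_encType bool_encType)) nat_encType.
have Hl : pt (fun x : PS => [seq (if y.2 then tailmass y.1 x.2 else 0) | y <- zip (pZ x.1.1) x.1.2]).
  apply: (@pt_map _ (prod_encType (list_encType (prod_encType nat_encType nat_encType)) bool_encType) nat_encType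
    (fun (x : PS) y => if y.2 then tailmass y.1 x.2 else 0)).
    have Ht : pt (fun z : PS * (idist * bool) => tailmass z.2.1 z.1.2) by apply: pt_tailmass; ptt.
    by ptt.
  by apply: (@pt_zip _ _ bool_encType false) => //; rewrite /pZ; ptt.
have Hi : pt (fun x : PS => trunc_list x.1.1).
  exact: (pt_comp pt_trunc_list (pt_fst (pt_fst pt_id))).
apply: (@pt_head _ nat_encType 0); first exact: nat_bits0_enc.
apply: (@pt_foldl PS nat_encType (list_encType nat_encType) (fun x f a => pstep (pQ x.1.1) f a)) => //.
  apply: (@pt_map _ (prod_encType nat_encType nat_encType) nat_encType
    (fun (z : PS * (seq nat * nat)) xy => (pQ z.1.1.1 - z.2.2) * xy.1 + z.2.2 * xy.2)).
    by rewrite /pQ; ptt.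
  by apply: (@pt_zip _ _ nat_encType 0); [exact: nat_bits0_enc | ptt | ptt].
have HQ : pt (fun x : PS => pQ x.1.1) by rewrite /pQ; ptt.
have [e1 E1] := pt_size Hi; have [e2 E2] := pt_size Hl; have [e3 E3] := pt_size HQ.
have [e He] : poly (fun n => (pb e1 n * (4 * (pb e1 n + pb e2 n * (pb e3 n + pb e2 n)) + 2)).+1).
  by solve_poly.
exists e => x i; apply: leq_trans (He _ (sz_gt0 x)).
set l := [seq _ | _ <- _]; set f0 := trunc_list _.
have Hf0 : list_le (pb e1 (sz x)) (pb e1 (sz x)) f0.
  have h := E1 x; rewrite -/f0 in h; apply/andP; split.
    by apply: leq_trans h; apply: ltnW; exact: size_sz.
  apply/allP => y hy; apply: leq_trans (ltn_sz y) _; rewrite leq_exp2l //.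
  apply: leq_trans h; elim: f0 hy {Hi} => //= z f IH; rewrite inE sz_cons => /orP[/eqP->|/IH]; lia.
have Ha (j : nat) : nth 0 l j < 2 ^ pb e2 (sz x).
  have h := E2 x; rewrite -/l in h.
  case: (ltnP j (size l)) => hj; last by rewrite nth_default // expn_gt0.
  apply: leq_trans (ltn_sz _) _; rewrite leq_exp2l //; apply: leq_trans h.
  elim: l j hj => //= z l IH [|j] hj; rewrite sz_cons /=; first by lia.
  by have := IH j hj; lia.
have HQ2 : pQ x.1.1 < 2 ^ pb e3 (sz x).
  by apply: leq_trans (ltn_sz _) _; rewrite leq_exp2l //; exact: E3.
have Hk : forall s, {subset s <= l} ->
   list_le (pb e1 (sz x) + size s * (pb e3 (sz x) + pb e2 (sz x))) (pb e1 (sz x))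
     (foldl (fun f a => pstep (pQ x.1.1) f a) f0 s).
  elim/last_ind => [|s a IH] hs; first by rewrite addn0.
  rewrite foldl_rcons size_rcons mulSn addnCA addnC.
  rewrite [X in list_le X](_ : _ = pb e1 (sz x) + size s * (pb e3 (sz x) + pb e2 (sz x)) + pb e3 (sz x) + pb e2 (sz x)); last by lia.
  apply: pstep_le => //; first by apply: IH => y hy; apply: hs; rewrite mem_rcons inE hy orbT.
  have al : a \in l by apply: hs; rewrite mem_rcons mem_head.
  by rewrite -(nth_index 0 al).
have hl : size (take i l) <= pb e2 (sz x).
  have h := E2 x; rewrite -/l in h; apply: leq_trans h.
  by rewrite size_take_min; apply: leq_trans (geq_minr _ _) _; apply: ltnW; exact: size_sz.
apply: leq_trans (sz_list_le (Hk _ (@mem_take _ _ _))) _.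
by rewrite ltnS leq_mul // leq_add2r leq_mul // leq_add2l leq_mul.
Qed.

Lemma pt_score : pt (fun x : (params * seq nat) * seq bool => score x.1.1 x.1.2 x.2).
Proof.
rewrite /score; apply: (@pt_sum _ (prod_encType nat_encType nat_encType)
  (fun (x : (params * seq nat) * seq bool) ab => (ab.2 - ab.1) * level_score x.1.1 x.2 ab.2)).
  apply: pt_muln; first by ptt.
  exact: (pt_comp pt_level_score (pt_pair (pt_pair (pt_fst (pt_fst (pt_fst pt_id))) (pt_snd (pt_fst pt_id)))
    (pt_snd (pt_snd pt_id)))).
apply: (@pt_zip _ _ nat_encType 0); first exact: nat_bits0_enc.
  by apply: pt_cons; [exact: pt_const | ptt].
by ptt.
Qed.

Definition input := (seq distr * (nat * rat))%type.
(** The loop flag, the current multiple of the numerator of eps, the unary counter and the input. *)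
Definition ustate := (bool * (nat * (seq unit * input)))%type.
(** The weight lists still to do, the current target, the best set so far, and then the constants:
    parameters, sorted values, cap. The best set comes with its score plus one, so that 0 means that
    none has been found. *)
Definition state := (seq (seq nat) * (nat * ((nat * seq bool) * (params * (seq nat * nat)))))%type.

(* Counts in unary up to the least N with N * eps >= 1. *)
Definition unary_step (s : ustate) : ustate :=
  (s.2.1 + `|numq s.2.2.2.2.2| < `|denq s.2.2.2.2.2|,
   (s.2.1 + `|numq s.2.2.2.2.2|, (tt :: s.2.2.1, s.2.2.2))).

Definition cap_of (x : input) (p : params) : nat :=
  if is_large x.2.1 x.2.2 then cap_large p else cap_small p.

Definition weights_of (x : input) (p : params) : seq (seq nat) :=
  if is_large x.2.1 x.2.2 then weights_large p else weights_small p.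

Definition start (x : input * seq unit) : state :=
  (weights_of x.1 (mk_params x), (cap_of x.1 (mk_params x), ((0, [::]),
    (mk_params x, (sorted_values (pZ (mk_params x)), cap_of x.1 (mk_params x)))))).

(* The pending queries are the head weights with target z and below, then the
   remaining weights with every target up to the cap. *)
Definition query (s : state) : seq int * int :=
  ([seq Posz a | a <- head [::] s.1], Posz s.2.1).

Definition best (s : state) (S : seq bool) : nat * seq bool :=
  if s.2.2.1.1 < (score s.2.2.2.1 s.2.2.2.2.1 S).+1
  then ((score s.2.2.2.1 s.2.2.2.2.1 S).+1, S) else s.2.2.1.

(** The optional set returned by a query is read as a list with at most one entry: both have the
    same tree. *)
Definition search_step (x : state * seq (seq bool)) : state :=
  ((if x.1.2.1 == 0 then behead x.1.1 else x.1.1),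
   ((if x.1.2.1 == 0 then x.1.2.2.2.2.2 else x.1.2.1.-1),
    ((if nilp x.2 then x.1.2.2.1 else best x.1 (head [::] x.2)), x.1.2.2.2))).

Lemma pt_Posz (A : encType) (f : A -> nat) : pt f -> pt (fun a => Posz (f a)).
Proof.
apply: (pt_comp (g := Posz)); apply: (@pt_expr _ _ _ (fun x => ENode ELeaf (EVar x)) 4) => //.
  by move=> s x m /= ->.
exists 3 => m; have -> : sz (Posz m) = (sz m).+2 by rewrite /sz /= add1n.
apply: (@leq_trans (3 * sz m)); first by have := sz_gt0 m; lia.
by rewrite /pb leq_mul2l /= -{1}(expn1 (sz m)) leq_pexp2l.
Qed.

Lemma pt_unary_step : pt unary_step.
Proof.
have hn : pt (fun s : ustate => `|numq s.2.2.2.2.2|%N) by apply: pt_absnum; ptt.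
have hd : pt (fun s : ustate => `|denq s.2.2.2.2.2|%N) by apply: pt_absden; ptt.
by rewrite /unary_step; ptt.
Qed.

Lemma pt_start : pt (fun s : ustate => start (s.2.2.2, s.2.2.1)).
Proof.
apply: (pt_comp (g := start) (f := fun s : ustate => (s.2.2.2, s.2.2.1))); last by ptt.
have h := pt_mk_params.
have hl : pt (fun x : input * seq unit => is_large x.1.2.1 x.1.2.2) by apply: pt_is_large; ptt.
have hc : pt (fun x : input * seq unit => cap_of x.1 (mk_params x)).
  by apply: (pt_if hl); [exact: pt_comp pt_cap_large h | exact: pt_comp pt_cap_small h].
have hv : pt (fun x : input * seq unit => sorted_values (pZ (mk_params x))).
  by apply: (pt_comp pt_sorted_values); exact: (pt_fst h).
apply: pt_pair.
  by apply: (pt_if hl); [exact: pt_comp pt_weights_large h | exact: pt_comp pt_weights_small h].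
apply: (pt_pair hc); apply: pt_pair; first exact: pt_const.
exact: (pt_pair h (pt_pair hv hc)).
Qed.

Lemma pt_query : pt query.
Proof.
apply: pt_pair; last by apply: pt_Posz; ptt.
apply: (@pt_map _ nat_encType int_encType (fun _ a => Posz a)); first by apply: pt_Posz; ptt.
by apply: (@pt_head _ (list_encType nat_encType)) => //; ptt.
Qed.

Lemma pt_search_step : pt search_step.
Proof.
have hz : pt (fun x : state * seq (seq bool) => x.1.2.1 == 0).
  by apply: pt_eqn; ptt.
have ha : pt (fun x : state * seq (seq bool) => head [::] x.2).
  by apply: (@pt_head _ (list_encType bool_encType)) => //; ptt.
have hs : pt (fun x : state * seq (seq bool) =>
    (score x.1.2.2.2.1 x.1.2.2.2.2.1 (head [::] x.2)).+1).
  apply: pt_succ; apply: (pt_comp pt_score (f := fun x : state * seq (seq bool) =>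
    ((x.1.2.2.2.1, x.1.2.2.2.2.1), head [::] x.2))).
  by ptt.
apply: pt_pair; first by apply: (pt_if hz); ptt.
apply: pt_pair; first by apply: (pt_if hz); [ptt | apply: pt_pred; ptt].
apply: pt_pair; last by ptt.
apply: pt_if; [by apply: pt_nilp; ptt | by ptt |].
rewrite /best; apply: pt_if; [apply: pt_ltn; [ptt | exact: hs] | | by ptt].
exact: (pt_pair hs ha).
Qed.

End PtAlgorithm.

(** * Correctness of the query weights *)

Section HornerLemmas.
Local Open Scope nat_scope.

Lemma horner_rcons B s d : horner B (rcons s d) = horner B s * B + d.
Proof. by rewrite /horner foldl_rcons. Qed.

Lemma horner_lt B s : all (fun d => d < B) s -> horner B s < B ^ size s.
Proof.
elim/last_ind: s => // s d IH; rewrite all_rcons => /andP[dB /IH h].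
rewrite horner_rcons size_rcons expnSr.
by apply: (@leq_trans ((horner B s).+1 * B)); [rewrite mulSn; lia | rewrite leq_mul2r h orbT].
Qed.

Lemma horner_inj B s t : size s = size t -> all (fun d => d < B) s -> all (fun d => d < B) t ->
  horner B s = horner B t -> s = t.
Proof.
elim/last_ind: s t => [|s d IH] t; first by case: t.
case/lastP: t => [|t e]; first by rewrite size_rcons.
rewrite !size_rcons !all_rcons !horner_rcons => -[Hs] /andP[dB Hd] /andP[eB He] H.
have B0 : 0 < B by lia.
have E1 : d = e.
  by have := congr1 (modn^~ B) H; rewrite !modnMDl !modn_small.
have E2 : horner B s = horner B t.
  by move: H; rewrite E1 => /addIn /eqP; rewrite eqn_pmul2r // => /eqP.
by rewrite E1 (IH t).
Qed.

Lemma horner_sum (I : Type) (s : seq I) (dg : I -> seq nat) B L : (forall i, size (dg i) = L) ->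
  \sum_(i <- s) horner B (dg i) = horner B (mkseq (fun j => \sum_(i <- s) nth 0 (dg i) j) L).
Proof.
move=> H.
have E i : dg i = mkseq (nth 0 (dg i)) L.
  by rewrite -(H i); apply: (@eq_from_nth _ 0) => [|j Hj]; rewrite ?size_mkseq // nth_mkseq.
rewrite (eq_bigr (fun i => horner B (mkseq (nth 0 (dg i)) L))); last by move=> i _; rewrite -E.
elim: L {H E} => [|L IH]; first by rewrite /horner /= big1.
rewrite mkseqS horner_rcons -IH big_distrl -big_split /=.
by apply: eq_bigr => i _; rewrite mkseqS horner_rcons.
Qed.

Lemma nth_flatten_block (T : Type) (x0 : T) (ss : seq (seq T)) L l j :
  (forall i, i < size ss -> size (nth [::] ss i) = L) -> l < size ss -> j < L ->
  nth x0 (flatten ss) (l * L + j) = nth x0 (nth [::] ss l) j.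
Proof.
elim: ss l => // s ss IH [|l] H Hl Hj /=.
  by have /= H0 := H 0 isT; rewrite mul0n add0n nth_cat H0 Hj.
have /= H0 := H 0 isT.
rewrite nth_cat H0 mulSn -addnA ltnNge leq_addr /= addKn; apply: IH => // i Hi; exact: (H i.+1).
Qed.

(** The total of [S] is below [cap], so an equal total excludes elements of weight [cap] from [S'].
    Then no digit sum of either set reaches [B], and expansions in base [B] are unique. *)
Lemma digits_determined (n B L cap M : nat) (dg : 'I_n -> seq nat) (good : pred 'I_n)
    (w : 'I_n -> nat) (S S' : {set 'I_n}) :
  (forall i, size (dg i) = L) -> B = (n * M).+1 -> cap = B ^ L ->
  (forall i j, good i -> nth 0 (dg i) j <= M) ->
  (forall i, w i = if good i then horner B (dg i) else cap) ->
  (forall i, i \in S -> good i) ->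
  \sum_(i in S) w i < cap /\
  (\sum_(i in S') w i = \sum_(i in S) w i ->
   (forall i, i \in S' -> good i) /\
   forall j, j < L -> \sum_(i in S) nth 0 (dg i) j = \sum_(i in S') nth 0 (dg i) j).
Proof.
move=> HL HB Hcap HM Hw HS.
have sumB (T : {set 'I_n}) j : (forall i, i \in T -> good i) -> \sum_(i in T) nth 0 (dg i) j < B.
  move=> HT; rewrite HB ltnS; apply: (@leq_trans (\sum_(i in T) M)).
    by apply: leq_sum => i iT; apply: HM; exact: HT.
  by rewrite sum_nat_const leq_mul // -[X in _ <= X](card_ord n) max_card.
pose ds (T : {set 'I_n}) := mkseq (fun j => \sum_(i in T) nth 0 (dg i) j) L.
have hs (T : {set 'I_n}) : (forall i, i \in T -> good i) -> \sum_(i in T) w i = horner B (ds T).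
  move=> HT; rewrite (eq_bigr (fun i => horner B (dg i))); last by move=> i iT; rewrite Hw HT.
  rewrite -big_enum (horner_sum _ _ HL) /ds; congr horner; apply: eq_mkseq => j.
  by rewrite -big_enum.
have lt (T : {set 'I_n}) : (forall i, i \in T -> good i) -> all (fun d => d < B) (ds T).
  move=> HT; apply/allP => d /mapP[j _ ->]; exact: sumB.
have Slt : \sum_(i in S) w i < cap.
  rewrite hs // Hcap; apply: leq_trans (horner_lt (lt _ HS)) _; by rewrite size_mkseq.
split=> // E.
have HS' i : i \in S' -> good i.
  move=> iS; apply: contraTT Slt => ng; rewrite -leqNgt -E (bigD1 i) //= Hw (negbTE ng).
  exact: leq_addr.
split=> // j Hj.
have : ds S = ds S'.
  by apply: (horner_inj _ (lt _ HS) (lt _ HS')); rewrite ?size_mkseq // -!hs.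
by move/(congr1 (fun s => nth 0 s j)); rewrite !nth_mkseq.
Qed.

Lemma floor_close (I : finType) (S S' : {set I}) (e : I -> nat) (M : nat) : 0 < M ->
  \sum_(i in S) (e i %/ M) = \sum_(i in S') (e i %/ M) ->
  \sum_(i in S) e i <= \sum_(i in S') e i + #|I| * M.
Proof.
move=> M0 E.
apply: (@leq_trans (\sum_(i in S) (e i %/ M * M + M))).
  by apply: leq_sum => i _; rewrite {1}(divn_eq (e i) M) leq_add2l ltnW // ltn_pmod.
rewrite big_split /= -big_distrl /= E sum_nat_const leq_add //; last by rewrite leq_mul // max_card.
by rewrite big_distrl /=; apply: leq_sum => i _; exact: leq_trunc_div.
Qed.

End HornerLemmas.

(** * Exact evaluation of E[Top_k] *)

Section ScoreLemmas.
Local Open Scope ring_scope.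

Lemma eq_ebern_le ps (f g : nat -> rat) : (forall c, (c <= size ps)%N -> f c = g c) ->
  ebern ps f = ebern ps g.
Proof.
elim: ps f g => [|p ps IH] f g H /=; first exact: H.
by rewrite (IH f g) ?(IH (fun c => f c.+1) (fun c => g c.+1)) // => c hc; apply: H => //; exact: leqW.
Qed.

Lemma pstep_ebern (Q : nat) f l : (0 < Q)%N -> all (fun a => a <= Q)%N l -> (size l < size f)%N ->
  (head 0%N (foldl (fun f a => pstep Q f a) f l))%:R =
  Q%:R ^+ size l * ebern [seq a%:R / Q%:R | a <- l] (fun c => (nth 0%N f c)%:R) :> rat.
Proof.
move=> Q0; have Qn : Q%:R != 0 :> rat by rewrite pnatr_eq0 -lt0n.
elim: l f => [|a l IH] f /=; first by rewrite mul1r nth0.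
case/andP=> aQ hl hs.
have Hz : size (pstep Q f a) = (size f).-1.
  by rewrite size_map size_zip size_behead; apply/minn_idPr; exact: leq_pred.
rewrite IH //; last by rewrite Hz; case: (size f) hs.
rewrite exprS -mulrA; have E c : (c <= size l)%N ->
   (nth 0%N (pstep Q f a) c)%:R = Q%:R * ((1 - a%:R / Q%:R) * (nth 0%N f c)%:R + a%:R / Q%:R * (nth 0%N f c.+1)%:R) :> rat.
  move=> hc; rewrite (nth_map (0%N, 0%N)); last first.
    by rewrite -(size_map (fun xy => ((Q - a) * xy.1 + a * xy.2)%N)) -/(pstep Q f a) Hz; case: (size f) hs => // m hm; apply: leq_ltn_trans hc hm.
  rewrite nth_zip_cond size_zip size_behead.
  have -> : (c < minn (size f) (size f).-1)%N.
    by rewrite (minn_idPr (leq_pred _)); case: (size f) hs => // m hm; apply: leq_ltn_trans hc hm.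
  rewrite /= nth_behead natrD !natrM natrB //; field.
  by [].
rewrite (@eq_ebern_le _ _ (fun c => Q%:R * ((1 - a%:R / Q%:R) * (nth 0%N f c)%:R + a%:R / Q%:R * (nth 0%N f c.+1)%:R))); last first.
  by move=> c; rewrite size_map => hc; exact: E.
set q := a%:R / Q%:R.
rewrite (@eq_ebern _ _ (fun c => (Q%:R * (1 - q)) * (nth 0%N f c)%:R + (Q%:R * q) * (nth 0%N f c.+1)%:R)); last first.
  by move=> c; ring.
by rewrite ebern_lin; ring.
Qed.

Lemma ebern_mask (T : Type) (s : seq T) (a : pred T) (q : T -> rat) f :
  ebern [seq (if a i then q i else 0) | i <- s] f = ebern [seq q i | i <- s & a i] f.
Proof.
elim: s f => //= i s IH f; rewrite !IH; case: (a i) => //=.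
by rewrite subr0 mul1r mul0r addr0.
Qed.

(** Repeated breakpoints have width 0, so the sorted list may contain duplicates. Beyond the last
    one [F] vanishes. *)
Lemma zip_sum (F : nat -> nat) a vs Xm : path leq a vs -> (forall v, v \in vs -> v <= Xm)%N ->
  (forall x y, (a < x)%N -> (x <= y)%N -> (forall v, v \in vs -> (x <= v) = (y <= v))%N -> F x = F y) ->
  (forall x, (a < x)%N -> (forall v, v \in vs -> v < x)%N -> F x = 0%N) ->
  (\sum_(ab <- zip (a :: vs) vs) (ab.2 - ab.1) * F ab.2 = \sum_(a.+1 <= x < Xm.+1) F x)%N.
Proof.
elim: vs a => [|b vs IH] a /=.
  by move=> _ _ _ H; rewrite big_nil big_nat_cond big1 // => x /andP[/andP[ax _] _]; apply: H.
case/andP => ab hp hX hc h0; rewrite big_cons /= IH //; last first.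
- move=> x bx H; apply: h0; first exact: leq_ltn_trans ab bx.
  by move=> v; rewrite in_cons => /orP[/eqP->//|]; exact: H.
- move=> x y bx xy H; apply: hc => //; first exact: leq_ltn_trans ab bx.
  move=> v; rewrite in_cons => /orP[/eqP->|]; last exact: H.
  by rewrite leqNgt bx leqNgt (leq_trans bx xy).
- by move=> v hv; apply: hX; rewrite in_cons hv orbT.
have bX : (b <= Xm)%N by apply: hX; rewrite mem_head.
rewrite (@big_cat_nat _ _ _ b.+1 a.+1) //=; congr (_ + _)%N.
rewrite (@eq_big_nat _ _ _ _ _ _ (fun=> F b)); first by rewrite sum_nat_const_nat subSS.
move=> x /andP[ax xb]; apply: hc => // v hv.
have bv : (b <= v)%N.
  move: hv; rewrite in_cons => /orP[/eqP->//|hv].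
  by have /allP := order_path_min leq_trans hp; apply.
by rewrite bv (leq_trans _ bv).
Qed.

Lemma mem_insert v l x : (x \in insert_nat v l) = (x == v) || (x \in l).
Proof.
rewrite /insert_nat mem_cat in_cons !mem_filter; case: (ltnP x v) => h /=; last by [].
by rewrite orbF orbC.
Qed.

Lemma insert_sorted v l : sorted leq l -> sorted leq (insert_nat v l).
Proof.
rewrite !(sorted_pairwise leq_trans) /insert_nat pairwise_cat /= => h.
rewrite !pairwise_filter //; apply/and4P; split=> //.
- apply/allrelP => x y; rewrite mem_filter in_cons => /andP[xv _] /orP[/eqP->|]; first exact: ltnW.
  by rewrite mem_filter => /andP[vy _]; apply: leq_trans vy; exact: ltnW.
- by apply/allP => x; rewrite mem_filter => /andP[].
Qed.

Lemma sorted_values_sorted Z : sorted leq (sorted_values Z).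
Proof. by rewrite /sorted_values; elim: (flatten _) => //= v l; exact: insert_sorted. Qed.

Lemma mem_sorted_values Z v :
  (v \in sorted_values Z) = (v \in flatten [seq [seq y.1 | y <- D] | D <- Z]).
Proof.
by rewrite /sorted_values; elim: (flatten _) => //= w l IH; rewrite mem_insert in_cons IH.
Qed.
End ScoreLemmas.

(** * The scaled integer instance and its guesses *)

Section Integers.
Local Open Scope ring_scope.

Lemma scale_rat (q : rat) (c : nat) : 0 <= q -> (`|denq q| %| c)%N ->
  q * c%:R = (`|numq q| * c %/ `|denq q|)%N%:R.
Proof.
move=> q0 /dvdnP[b ->].
have d0 : (0 < `|denq q|)%N by rewrite absz_gt0 denq_neq0.
rewrite mulnA mulnK //.
have En : (`|numq q|%N%:R : rat) = (numq q)%:~R by rewrite -{2}(gez0_abs (_ : 0 <= numq q)) ?numq_ge0.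
have Ed : (`|denq q|%N%:R : rat) = (denq q)%:~R by rewrite -{2}(gez0_abs (denq_ge0 q)).
by rewrite !natrM En Ed numqE; ring.
Qed.

Lemma dvdn_prod_seq (T : eqType) (s : seq T) (F : T -> nat) x : x \in s -> (F x %| \prod_(y <- s) F y)%N.
Proof. by move=> H; rewrite (big_rem x) //= dvdn_mulr. Qed.

Lemma den_vden (X : seq distr) D y : D \in X -> y \in D -> (`|denq y.1| %| vden X)%N.
Proof.
move=> HD Hy; apply: dvdn_trans (dvdn_prod_seq (fun D => \prod_(y <- D) `|denq y.1|)%N HD).
exact: (dvdn_prod_seq (fun y : rat * rat => `|denq y.1|%N) Hy).
Qed.

Lemma den_mden (X : seq distr) D y : D \in X -> y \in D -> (`|denq y.2| %| mden X)%N.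
Proof.
move=> HD Hy; apply: dvdn_trans (dvdn_prod_seq (fun D => \prod_(y <- D) `|denq y.2|)%N HD).
exact: (dvdn_prod_seq (fun y : rat * rat => `|denq y.2|%N) Hy).
Qed.

Lemma vden_gt0 (X : seq distr) : (0 < vden X)%N.
Proof. by rewrite prodn_gt0 // => D; rewrite prodn_gt0 // => y; rewrite absz_gt0 denq_neq0. Qed.

Lemma mden_gt0 (X : seq distr) : (0 < mden X)%N.
Proof. by rewrite prodn_gt0 // => D; rewrite prodn_gt0 // => y; rewrite absz_gt0 denq_neq0. Qed.

Variables (n : nat) (X : n.-tuple distr) (k : nat) (eps : rat) (u : seq unit).
Hypothesis n0 : (0 < n)%N.
Hypothesis Xd : all is_distr X.
Hypothesis k0 : (0 < k)%N.
Hypothesis u0 : (0 < size u)%N.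

Let N := size u.
Definition the_params := mk_params ((X : seq distr, (k, eps)), u).
Let p := the_params.
Let Q := mden X.
Definition factor : nat := Q * N * k.
Definition sg : rat := (vden X * factor)%:R.
Definition Zi (i : 'I_n) : idist := intd (vden X * factor) Q (tnth X i).

Lemma pQ_E : pQ p = Q. Proof. by []. Qed.
Lemma pk_E : pk p = k. Proof. by []. Qed.
Lemma pN_E : pN p = N. Proof. by []. Qed.
Lemma pn_E : pn p = n. Proof. by rewrite /pn /= size_map size_tuple. Qed.

Lemma nth_pZ (i : 'I_n) : nth [::] (pZ p) i = Zi i.
Proof. by rewrite /= (nth_map [::]) ?size_tuple // -(tnth_nth [::] X i). Qed.

Lemma Q0 : (0 < Q)%N. Proof. exact: mden_gt0. Qed.
Lemma factor_gt0 : (0 < factor)%N. Proof. by rewrite !muln_gt0 Q0 u0. Qed.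
Lemma sg_gt0 : 0 < sg. Proof. by rewrite ltr0n muln_gt0 vden_gt0 factor_gt0. Qed.

Definition ival (y : rat * rat) : nat := (`|numq y.1| * (vden X * factor) %/ `|denq y.1|)%N.
Definition imass (y : rat * rat) : nat := (`|numq y.2| * Q %/ `|denq y.2|)%N.

Lemma Zi_E i : Zi i = [seq (ival y, imass y) | y <- tnth X i].
Proof. by []. Qed.

Lemma atom_ge0 i y : y \in tnth X i -> 0 <= y.1.
Proof. by have /andP[/allP H _] := distr_i Xd i; move=> /H /andP[]. Qed.

Lemma ivalE i y : y \in tnth X i -> sg * y.1 = (ival y)%:R.
Proof.
move=> Hy; rewrite mulrC /sg scale_rat ?(atom_ge0 Hy) //.
by apply: dvdn_mulr; exact: den_vden (mem_tnth i X) Hy.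
Qed.

Lemma imassE i y : y \in tnth X i -> y.2 * Q%:R = (imass y)%:R.
Proof.
move=> Hy; rewrite scale_rat //; first by have := mass_ge0 Xd Hy.
exact: den_mden (mem_tnth i X) Hy.
Qed.

Lemma ival_dvd i y : y \in tnth X i -> (factor %| ival y)%N.
Proof.
move=> Hy; have /dvdnP[b E] := den_vden (mem_tnth i X) Hy.
have d0 : (0 < `|denq y.1|)%N by rewrite absz_gt0 denq_neq0.
by rewrite /ival E mulnAC mulnA mulnK // mulnA dvdn_mull.
Qed.

Definition vmax : nat := (\sum_(i < n) \sum_(y <- tnth X i) ival y)%N.

Lemma ival_vmax i y : y \in tnth X i -> (ival y <= vmax)%N.
Proof.
move=> Hy; rewrite /vmax (bigD1 i) //= (big_rem y) //= -addnA; exact: leq_addr.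
Qed.

Lemma Xint Xm : (vmax <= Xm)%N -> forall i y, y \in tnth X i ->
  exists2 w : nat, sg * y.1 = w%:R & (w <= Xm)%N.
Proof.
move=> h i y Hy; exists (ival y); first exact: ivalE Hy.
by apply: leq_trans (ival_vmax Hy) h.
Qed.

Definition prX := pr X sg.

Lemma prE i x : prX i x = (tailmass (Zi i) x)%:R / Q%:R.
Proof.
have Qn : Q%:R != 0 :> rat by rewrite pnatr_eq0 -lt0n Q0.
apply: (canRL (mulfK Qn)); rewrite /prX /pr /tailmass Zi_E big_map mulr_suml natr_sum.
rewrite big_seq_cond [RHS]big_seq_cond big_mkcondr /= [RHS]big_mkcondr /=.
apply: eq_bigr => y Hy; rewrite (ivalE Hy) ler_nat; case: ifP => // _; exact: imassE Hy.
Qed.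

Lemma tailmass_leQ i x : (tailmass (Zi i) x <= Q)%N.
Proof.
have Qp : 0 < Q%:R :> rat by rewrite ltr0n Q0.
have /andP[_ h] := pr01 sg Xd i x.
by rewrite -(ler_nat rat) -[leRHS]mul1r -ler_pdivrMr // -prE.
Qed.

Lemma sum_tailmass i t Xm : (vmax <= Xm)%N ->
  (\sum_(t.+1 <= x < Xm.+1) tailmass (Zi i) x)%N = exces (Zi i) t.
Proof.
move=> h; rewrite /tailmass /exces Zi_E exchange_big /= !big_map big_seq [RHS]big_seq.
apply: eq_bigr => y Hy /=.
have vX : (ival y <= Xm)%N by apply: leq_trans (ival_vmax Hy) h.
rewrite -big_mkcond /=.
have [lt|le] := ltnP t (ival y); last first.
  rewrite (_ : ival y - t = 0)%N ?muln0; last by lia.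
  by rewrite big_nat_cond big1 // => x; lia.
rewrite (@big_cat_nat _ _ _ (ival y).+1) //=; last by lia.
rewrite [X in (_ + X)%N]big_nat_cond [X in (_ + X)%N]big1 ?addn0; last by move=> x; lia.
rewrite big_nat_cond (eq_bigl (fun x => (t.+1 <= x < (ival y).+1)%N)); last by move=> x; lia.
by rewrite -big_nat sum_nat_const_nat mulnC subSS.
Qed.

Lemma excessE Xm s t : (vmax <= Xm)%N ->
  excess prX Xm s t = (\sum_(i <- s) exces (Zi i) t)%N%:R / Q%:R.
Proof.
move=> h; rewrite /excess.
rewrite (eq_bigr (fun x => \sum_(i <- s) prX i x)); last by move=> x _; exact: lam_row.
rewrite exchange_big /= natr_sum mulr_suml; apply: eq_bigr => i _.
rewrite -(sum_tailmass i t h) natr_sum mulr_suml; apply: eq_bigr => x _; exact: prE.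
Qed.

Lemma exces_dvd i : (factor %| exces (Zi i) 0)%N.
Proof.
rewrite /exces Zi_E big_map big_seq; apply: (big_ind (fun v => (factor %| v)%N)) => //.
  by move=> a b ha hb; rewrite dvdn_add.
by move=> y Hy /=; rewrite subn0 dvdn_mull // (ival_dvd Hy).
Qed.

Lemma exces_mono D a b : (a <= b)%N -> (exces D b <= exces D a)%N.
Proof. by move=> h; apply: leq_sum => y _; rewrite leq_mul2l leq_sub2l ?orbT. Qed.

Implicit Type S : {set 'I_n}.

Definition Phi Xm S := phi prX Xm k (enum S).

Lemma PhiE Xm S : (vmax <= Xm)%N -> Phi Xm S = sg * expectation (top (X := X) k S).
Proof. by move=> h; rewrite (expectation_top sg_gt0 Xd (Xint h)). Qed.

Lemma Phi_ge0 Xm S : 0 <= Phi Xm S.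
Proof. by apply: sumr_ge0 => x _; apply: etrunc_ge0; apply: row01 => i y; exact: pr01. Qed.

Lemma Phi_le Xm S : (vmax <= Xm)%N -> Phi Xm S <= (\sum_(i in S) exces (Zi i) 0)%N%:R / Q%:R.
Proof.
move=> h; rewrite -big_enum -(excessE _ _ h); apply: ler_sum => x _; apply: etrunc_lelam.
by apply: row01 => i y; exact: pr01.
Qed.

(** The truncated count is at least 1 as soon as trial [i] succeeds, and the other trials can only
    increase it. *)
Lemma etrunc_ge1 (s : seq 'I_n) i x : i \in s -> prX i x <= etrunc k (row prX s x).
Proof.
have H i' y : in01 (prX i' y) by exact: pr01.
rewrite /etrunc; set f := (fun c => (minn k c)%:R).
suff gen (s' : seq 'I_n) (g : nat -> rat) : (forall c, g c <= g c.+1) -> 0 <= g 0%N -> 1 <= g 1%N -> i \in s' ->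
    prX i x <= ebern (row prX s' x) g.
  move=> hi; apply: gen => //; rewrite /f.
  - by move=> c; rewrite ler_nat; lia.
  - by rewrite ler1n; lia.
elim: s' g => // j s' IH g gm g0 g1; rewrite in_cons => ij /=.
have /andP[p0 p1] := H j x.
have mon (b : nat -> rat) (a : rat) : (forall c, a <= b c) -> a <= ebern (row prX s' x) b.
  by move=> hb; rewrite -[leLHS](ebern_cst (row prX s' x)); apply: ebern_mono => //; exact: row01.
have ginc c c' : (c <= c')%N -> g c <= g c'.
  by elim: c' => [|c' IH']; [rewrite leqn0 => /eqP-> | rewrite leq_eqVlt => /orP[/eqP->//|/IH' h]; apply: le_trans h (gm _)].
case/orP: ij => [/eqP->|hi].
  have A1 := mon (fun c => g c.+1) 1 (fun c => le_trans g1 (ginc 1%N c.+1 isT)).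
  have A2 := mon g 0 (fun c => le_trans g0 (ginc 0%N c isT)).
  have := ler_wpM2l p0 A1; have : 0 <= (1 - prX j x) * ebern (row prX s' x) g by apply: mulr_ge0 => //; lra.
  by lra.
have A1 := IH g gm g0 g1 hi.
have A2 : ebern (row prX s' x) g <= ebern (row prX s' x) (fun c => g c.+1).
  by apply: ebern_mono => //; exact: row01.
have := ler_wpM2l p0 A2; lra.
Qed.

Lemma Phi_ge Xm S i : (vmax <= Xm)%N -> i \in S -> (exces (Zi i) 0)%:R / Q%:R <= Phi Xm S.
Proof.
move=> h iS; have := @excessE Xm [:: i] 0 h; rewrite big_seq1 => <-.
apply: ler_sum => x _; have -> : lam (row prX [:: i] x) = prX i x by rewrite lam_row big_seq1.
by apply: etrunc_ge1; rewrite mem_enum.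
Qed.

Definition mu (i : 'I_n) : nat := exces (Zi i) 0.

(** Take [i] of largest mean in [S] and [r] the integer part of [Phi] divided by that mean. When
    [Phi] vanishes, any set is good enough, but a guess is still provided so that the search sees
    the weight of [S]. *)
Lemma guess_exists Xm S : (vmax <= Xm)%N -> exists i r d, [/\ (0 < r <= n)%N,
  forall j, j \in S -> (mu j <= mu i)%N, d = (r * mu i %/ factor)%N, (mu i <= factor * d)%N
  & Phi Xm S = 0 \/ ((0 < d)%N /\ (N * k * d)%:R <= Phi Xm S <= 2 * (N * k * d)%:R)].
Proof.
move=> h.
have Qp : 0 < Q%:R :> rat by rewrite ltr0n Q0.
have Qn : Q%:R != 0 :> rat by rewrite gt_eqF.
have dvd i r : (r * mu i %/ factor = r * (mu i %/ factor))%N.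
  by rewrite muln_divA ?exces_dvd.
have le_fd i r : (0 < r)%N -> (mu i <= factor * (r * mu i %/ factor))%N.
  by move=> r0; rewrite dvd mulnCA (mulnC factor) divnK ?exces_dvd // leq_pmull.
have zero i : Phi Xm S = 0 -> (forall j, j \in S -> (mu j <= mu i)%N) ->
  exists i r d, [/\ (0 < r <= n)%N, forall j, j \in S -> (mu j <= mu i)%N,
    d = (r * mu i %/ factor)%N, (mu i <= factor * d)%N
   & Phi Xm S = 0 \/ ((0 < d)%N /\ (N * k * d)%:R <= Phi Xm S <= 2 * (N * k * d)%:R)].
  move=> P0 Hi; exists i, 1%N, (1 * mu i %/ factor)%N; split => //; [exact: le_fd | by left].
have [S0|[i0 Hi0]] := set_0Vmem S.
  apply: (zero (Ordinal n0)); last by move=> j; rewrite S0 inE.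
  apply/le_anti; rewrite Phi_ge0 andbT; apply: le_trans (Phi_le _ h) _.
  by rewrite S0 big_set0 mul0r.
have [i iS imax] := @arg_maxnP _ i0 (mem S) mu Hi0.
have Pn : Phi Xm S <= n%:R * ((mu i)%:R / Q%:R).
  apply: le_trans (Phi_le _ h) _; rewrite mulrA ler_pM2r ?invr_gt0 // -natrM ler_nat.
  apply: (@leq_trans (\sum_(j in S) mu i)%N); first by apply: leq_sum => j jS; exact: imax.
  by rewrite sum_nat_const leq_mul // -[X in (_ <= X)%N](card_ord n) max_card.
have P1 : (mu i)%:R / Q%:R <= Phi Xm S by apply: Phi_ge.
have [mu0|mu0] := posnP (mu i).
  apply: (zero i) => //; apply/le_anti; rewrite Phi_ge0 andbT.
  by apply: le_trans Pn _; rewrite mu0 mul0r mulr0.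
set m : rat := (mu i)%:R / Q%:R in Pn P1.
have m0 : 0 < m by rewrite divr_gt0 // ltr0n.
pose r := Num.truncn (Phi Xm S / m).
have /andP[r1 r2] := truncn_itv (divr_ge0 (Phi_ge0 Xm S) (ltW m0)).
rewrite -/r ler_pdivlMr // in r1; rewrite -/r ltr_pdivrMr // in r2.
have r0 : (0 < r)%N by rewrite /r truncn_gt0 ler_pdivlMr // mul1r.
have rn : (r <= n)%N.
  by have := le_trans r1 Pn; rewrite ler_pM2r // ler_nat.
(* Divisibility by [factor] makes this an equality, so the factor 2 comes only from truncating to
   [r]. *)
have V : (N * k * (r * mu i %/ factor))%:R = r%:R * m.
  have Em : mu i = (mu i %/ factor * (Q * N * k))%N by rewrite divnK ?exces_dvd.
  rewrite dvd /m [in RHS]Em; move: (mu i %/ _)%N => q.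
  by rewrite !natrM; field.
exists i, r, (r * mu i %/ factor)%N; split => //; first by rewrite r0.
  exact: le_fd.
right; rewrite V; split.
  by rewrite dvd muln_gt0 r0 divn_gt0 ?factor_gt0 //; apply: dvdn_leq => //; exact: exces_dvd.
rewrite r1 /=; apply: le_trans (ltW r2) _.
have : 1 <= r%:R :> rat by rewrite ler1n.
by rewrite -natr1 => hr; have := ler_wpM2r (ltW m0) hr; lra.
Qed.

Lemma guess_mem i r : (0 < r <= n)%N -> (mu i, r * mu i %/ factor)%N \in guesses p.
Proof.
move=> /andP[r0 rn]; apply/flattenP.
exists [seq (exces (Zi i) 0, r * exces (Zi i) 0 %/ (pQ p * pN p * pk p))%N | r <- traject (addn 1) 1%N (pn p)].
  apply/mapP; exists (Zi i) => //; rewrite -nth_pZ; apply: mem_nth.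
  by rewrite -/(pn p) pn_E ltn_ord.
apply/mapP; exists r => //; apply/trajectP; exists r.-1; first by rewrite pn_E; lia.
by rewrite iter_addn mul1n; lia.
Qed.

Definition wsum (w : seq nat) S : nat := (\sum_(i in S) nth 0%N w i)%N.

Lemma unit_digit_le i c t d : (mu i <= factor * d)%N -> (unit_digit p d c t (Zi i) <= c * N)%N.
Proof.
move=> h; rewrite /unit_digit; have [->|M0] := posnP (pk p * d * pQ p); first by rewrite divn0.
rewrite -(leq_pmul2r M0); apply: leq_trans (leq_trunc_div _ _) _.
rewrite -mulnA leq_mul2l; apply/orP; right.
apply: leq_trans (exces_mono _ (leq0n t)) _; apply: leq_trans h _.
by rewrite pk_E pQ_E /factor -/Q; lia.
Qed.

Lemma unit_digit_close S S' c t d : (0 < d)%N ->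
  (\sum_(i in S) unit_digit p d c t (Zi i) = \sum_(i in S') unit_digit p d c t (Zi i))%N ->
  c%:R * ((\sum_(i in S) exces (Zi i) t)%N%:R / Q%:R) <=
  c%:R * ((\sum_(i in S') exces (Zi i) t)%N%:R / Q%:R) + (n * (k * d))%:R :> rat.
Proof.
move=> d0 E; have M0 : (0 < pk p * d * pQ p)%N by rewrite !muln_gt0 k0 d0 Q0.
have := floor_close M0 E; rewrite card_ord -!big_distrr /= pk_E pQ_E -/Q.
rewrite -(ler_nat rat) natrD !natrM => H.
have Qp : 0 < Q%:R :> rat by rewrite ltr0n Q0.
rewrite -(ler_pM2r Qp) mulrDl -!mulrA !mulVf ?gt_eqF // !mulr1.
by move: H; rewrite !mulrA.
Qed.

Lemma psum_row S x j : psum (row prX (enum S) x) j =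
  \sum_(i in S) (tailmass (Zi i) x)%:R ^+ j / Q%:R ^+ j.
Proof.
rewrite /psum /row big_map big_enum /=; apply: eq_bigr => i _.
by rewrite prE expr_div_n.
Qed.

Lemma moment_close S S' x j : (0 < prec p)%N ->
  (\sum_(i in S) (prec p * tailmass (Zi i) x ^ j %/ Q ^ j) =
   \sum_(i in S') (prec p * tailmass (Zi i) x ^ j %/ Q ^ j))%N ->
  psum (row prX (enum S) x) j - psum (row prX (enum S') x) j <= n%:R / (prec p)%:R.
Proof.
move: (prec p) => A A0 E; have M0 : (0 < Q ^ j)%N by rewrite expn_gt0 Q0.
have := floor_close M0 E; rewrite card_ord -!big_distrr /= -(ler_nat rat) natrD !natrM.
have Qp : 0 < (Q ^ j)%:R :> rat by rewrite ltr0n.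
have Ap : 0 < A%:R :> rat by rewrite ltr0n.
have Es (T : {set 'I_n}) : psum (row prX (enum T) x) j = (\sum_(i in T) tailmass (Zi i) x ^ j)%N%:R / (Q ^ j)%:R.
  by rewrite psum_row -mulr_suml natr_sum natrX; congr (_ / _); apply: eq_bigr => i _; rewrite natrX.
rewrite !Es; move: (\sum_(i in S) _)%N%:R (\sum_(i in S') _)%N%:R ((Q ^ j)%:R) Qp => a b q Qp H.
rewrite -mulrBl ler_pdivrMr // mulrAC ler_pdivlMr //; lra.
Qed.

Lemma nth_w (f : idist -> nat) (i : 'I_n) : nth 0%N [seq f D | D <- pZ p] i = f (Zi i).
Proof. by rewrite (nth_map [::]) ?nth_pZ // -/(pn p) pn_E. Qed.

Lemma size_levels : size (levels_fuel p) = (N ^ 4)%N.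
Proof. by rewrite /levels_fuel !size_utimes -/(pN p) pN_E !mulnn -expnM. Qed.

Lemma size_moments : size (moments_fuel p) = (100 * N ^ 2)%N.
Proof. by rewrite /moments_fuel !size_utimes -/(pN p) pN_E mulnn size_nseq. Qed.

Lemma prec_E : prec p = (n * (24 * N ^ 2) ^ (2 * size (moments_fuel p)))%N.
Proof. by rewrite /prec pn_E !size_utimes -/(pN p) pN_E mulnn size_nseq. Qed.

Lemma prec_gt0 : (0 < prec p)%N.
Proof. by rewrite prec_E muln_gt0 n0 expn_gt0 muln_gt0 expn_gt0 u0. Qed.

(** The excess digit is at most [n * N], so it fits under the same digit bound as the moments. *)
Lemma nN_prec : (n * N <= prec p)%N.
Proof.
rewrite prec_E leq_mul //; have m0 : (0 < size (moments_fuel p))%N.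
  by rewrite size_moments muln_gt0 expn_gt0 u0.
move: (size _) m0 => m m0.
have gen a : (0 < a -> a <= 24 * a ^ 2)%N by rewrite -mulnn; nia.
have h := gen _ u0.
have g : (0 < 24 * N ^ 2)%N by apply: leq_trans h; exact: u0.
apply: leq_trans h _; rewrite -[X in (X <= _)%N]expn1 leq_pexp2l //; lia.
Qed.

Lemma size_flatten_map (T U : Type) (f : T -> seq U) (s : seq T) L :
  (forall x, size (f x) = L) -> size (flatten [seq f x | x <- s]) = (size s * L)%N.
Proof. by move=> H; elim: s => //= x s IH; rewrite size_cat IH H mulSn. Qed.

Lemma size_moment_digits x D : size (moment_digits p x D) = size (moments_fuel p).
Proof. by rewrite size_map size_zip !size_traject minnn. Qed.

Lemma nth_moment_digits x D j : (j < size (moments_fuel p))%N ->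
  nth 0%N (moment_digits p x D) j = (prec p * tailmass D x ^ j %/ Q ^ j)%N.
Proof.
move=> Hj; rewrite (nth_map (1%N, 1%N)) ?size_zip ?size_traject ?minnn // nth_zip ?size_traject //=.
by rewrite !nth_traject // !iter_muln_1 pQ_E.
Qed.

Lemma size_digits_small d D :
  size (digits_small p d D) = size (tt :: utimes (levels_fuel p) (moments_fuel p)).
Proof.
rewrite /= size_utimes (@size_flatten_map _ _ _ _ (size (moments_fuel p))) ?size_traject //.
by move=> x; exact: size_moment_digits.
Qed.

Lemma nth_digits_small d D l j : (0 < l <= size (levels_fuel p))%N -> (j < size (moments_fuel p))%N ->
  nth 0%N (digits_small p d D) (l.-1 * size (moments_fuel p) + j).+1 =
  (prec p * tailmass D (l * d) ^ j %/ Q ^ j)%N.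
Proof.
move=> /andP[l0 Hl] Hj; have l1 : (l.-1 < size (levels_fuel p))%N by case: (l) l0 Hl.
rewrite /= (@nth_flatten_block _ 0%N _ (size (moments_fuel p))).
- rewrite (nth_map d) ?size_traject // nth_moment_digits // nth_traject // iter_addn.
  by rewrite -mulnSr prednK // (mulnC d).
- move=> i; rewrite size_map size_traject => Hi.
  by rewrite (nth_map 0%N) ?size_traject // size_moment_digits.
- by rewrite size_map size_traject.
- by [].
Qed.

Lemma index_digits_small l j : (0 < l <= size (levels_fuel p))%N -> (j < size (moments_fuel p))%N ->
  ((l.-1 * size (moments_fuel p) + j).+1 < size (tt :: utimes (levels_fuel p) (moments_fuel p)))%N.
Proof.
move=> /andP[l0 Hl] Hj; rewrite /= ltnS size_utimes.
move: (size (levels_fuel p)) (size (moments_fuel p)) Hl Hj => a b Hl Hj.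
apply: (@leq_trans (l.-1.+1 * b)); first by rewrite mulSn addnC ltn_add2r.
by rewrite prednK // leq_mul2r Hl orbT.
Qed.

Lemma digits_small_le i d j : (mu i <= factor * d)%N -> (nth 0%N (digits_small p d (Zi i)) j <= prec p)%N.
Proof.
move=> h; have H : all (fun x => x <= prec p)%N (digits_small p d (Zi i)).
  rewrite /=; apply/andP; split.
    by apply: leq_trans (unit_digit_le _ _ h) _; rewrite pn_E nN_prec.
  apply/allP => x /flattenP[s /mapP[y _ ->]] hx.
  have [e He <-] : exists2 e, (e < size (moments_fuel p))%N & nth 0%N (moment_digits p y (Zi i)) e = x.
    by exists (index x (moment_digits p y (Zi i))); rewrite ?nth_index // -(size_moment_digits y (Zi i)) index_mem.
  rewrite nth_moment_digits //; apply: (@leq_trans (prec p * Q ^ e %/ Q ^ e)).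
    by apply: leq_div2r; rewrite leq_mul2l; apply/orP; right; case: (e) => // e'; rewrite leq_exp2r // tailmass_leQ.
  by rewrite mulnK // expn_gt0 Q0.
case: (ltnP j (size (digits_small p d (Zi i)))) => hj; last by rewrite nth_default.
by move/allP: H; apply; apply: mem_nth.
Qed.

Lemma excess_enum Xm S t : (vmax <= Xm)%N ->
  excess prX Xm (enum S) t = (\sum_(i in S) exces (Zi i) t)%N%:R / Q%:R.
Proof. by move=> h; rewrite excessE // big_enum. Qed.

Definition Eopt S := expectation (top (X := X) k S).

Lemma Phi_transfer Xm S S' (c c' : rat) : (vmax <= Xm)%N -> 0 <= c' - c ->
  (1 - c) * Phi Xm S <= Phi Xm S' -> (1 - c') * Eopt S <= Eopt S'.
Proof.
move=> h cc; rewrite !PhiE // mulrCA ler_pM2l ?sg_gt0 // => H.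
apply: le_trans H; rewrite ler_wpM2r //; last by lra.
by have := Phi_ge0 Xm S; rewrite PhiE // pmulr_rge0 // sg_gt0.
Qed.

Lemma weights_small_ok S : exists w,
  [/\ w \in weights_small p, (wsum w S < cap_small p)%N
   & (4 <= N)%N -> (k <= N ^ 2)%N ->
     forall S', wsum w S' = wsum w S -> (1 - 11 / N%:R) * Eopt S <= Eopt S'].
Proof.
have [i0 [r [d [rn Hmu Hd Hfd HP]]]] := guess_exists S (leqnn vmax).
pose w := [seq weight_small p (mu i0, d) D | D <- pZ p].
pose good (i : 'I_n) := (mu i <= mu i0)%N.
have Hgood i : good i -> (mu i <= factor * d)%N by move=> h; apply: leq_trans h Hfd.
have Hw (i : 'I_n) : nth 0%N w i = if good i then horner (base_small p) (digits_small p d (Zi i)) else cap_small p.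
  by rewrite /w nth_w.
have HB : base_small p = (n * prec p).+1 by rewrite /base_small pn_E.
have DD S' := @digits_determined n (base_small p) _ (cap_small p) (prec p) (fun i => digits_small p d (Zi i))
  good (fun i => nth 0%N w i) S S' (fun i => size_digits_small d (Zi i)) HB erefl
  (fun i j gi => digits_small_le j (Hgood i gi)) Hw Hmu.
have Hlt := (DD S).1.
exists w; split.
- apply/mapP; exists (mu i0, d) => //; rewrite Hd; exact: guess_mem.
- exact: Hlt.
move=> N4 kN S' Hsum.
have [_ H] := DD S'.
have [Hg' Hdig] := H Hsum.
(* The range of levels has to reach the top threshold; beyond [vmax] it does not change [Phi]. *)
pose Xm := (vmax + size (levels_fuel p) * d)%N.
have hX : (vmax <= Xm)%N by exact: leq_addr.
have EP T : Phi Xm T = Phi vmax T by rewrite !PhiE.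
case: HP => [P0|[d0 HP]].
  have E0 : Eopt S = 0.
    by apply/eqP; move/eqP: P0; rewrite PhiE // mulf_eq0 gt_eqF ?sg_gt0.
  by rewrite E0 mulr0; have := Phi_ge0 vmax S'; rewrite PhiE // pmulr_rge0 // sg_gt0.
have iN0 : 0 <= N%:R^-1 :> rat by rewrite invr_ge0 ler0n.
(* [6 / N] is weakened to the ratio [11 / N] of the large regime, so that both share one
   constant. *)
apply: (@Phi_transfer Xm S S' (6 / N%:R) _ hX); first by lra.
have A0 := prec_gt0.
have prec_inv : n%:R / (prec p)%:R = (24 * (N ^ 2)%:R) ^- (2 * size (moments_fuel p)) :> rat.
  rewrite prec_E; move: (2 * _)%N => e; rewrite natrM natrX natrM invfM mulrA mulfV ?mul1r //.
  by rewrite pnatr_eq0 -lt0n.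
apply: (phi_small (fun i x => pr01 sg Xd i x) (fun i x y h => pr_mono sg Xd i h)
  N4 _ size_moments size_levels d0 (leq_addl _ _)).
- by rewrite k0 kN.
- by rewrite -/(Phi Xm S) EP.
- move=> l j Hl /andP[j0 Hj]; rewrite -prec_inv.
  have Ej := Hdig _ (index_digits_small Hl Hj).
  have Ed T : (\sum_(i in T) nth 0%N (digits_small p d (Zi i)) (l.-1 * size (moments_fuel p) + j).+1
     = \sum_(i in T) (prec p * tailmass (Zi i) (l * d) ^ j %/ Q ^ j))%N.
    by apply: eq_bigr => i _; exact: nth_digits_small.
  rewrite !Ed in Ej; rewrite ler_norml; apply/andP; split; last exact: moment_close.
  by rewrite lerNl opprB; apply: moment_close.
- have Ed := Hdig 0%N isT; have := unit_digit_close d0 Ed.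
  rewrite !excess_enum // natrM pn_E.
  have np : 0 < n%:R :> rat by rewrite ltr0n.
  by rewrite -mulrDr ler_pM2l // lerBlDr.
Qed.

Lemma digits_large_le i d t j : (mu i <= factor * d)%N ->
  (nth 0%N (digits_large p d t (Zi i)) j <= n * N * N)%N.
Proof.
move=> h; have H a := unit_digit_le (n * N) a h.
by case: j => [|[|[|j]]] /=; rewrite ?pn_E ?pN_E ?H // nth_nil.
Qed.

(* [Q] times the objective whose minimum over [t] approximates Top_k when [k] is
   large. *)
Definition dual (S : {set 'I_n}) (t : nat) : nat := (k * t * Q + \sum_(i in S) exces (Zi i) t)%N.

Lemma dualE Xm S t : (vmax <= Xm)%N ->
  (k * t)%:R + excess prX Xm (enum S) t = (dual S t)%:R / Q%:R.
Proof.
move=> h; have Qn : Q%:R != 0 :> rat by rewrite pnatr_eq0 -lt0n Q0.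
by rewrite excess_enum // /dual natrD mulrDl [(k * t * Q)%:R]natrM mulfK.
Qed.

(** A minimizer among the multiples [j d] with [j <= n N]. At the left end truncated subtraction
    makes the comparison trivial; at the right end [k j d Q] alone already exceeds the value at 0,
    which is at most [n * factor * d]. *)
Lemma dual_min S d : (forall i, i \in S -> (mu i <= factor * d)%N) -> exists j, [/\ (j <= n * N)%N,
  (dual S (j * d) <= dual S (j * d - d))%N & (dual S (j * d) <= dual S (j * d + d))%N].
Proof.
move=> H; have [j _ jmin] := @arg_minnP 'I_(n * N).+1 ord0 predT (fun j => dual S (j * d)) isT.
exists j; split; first by rewrite -ltnS.
  case: (val j) (ltn_ord j) (fun i => jmin i isT) => [|j'] Hj Hmin; first by rewrite mul0n.
  have h : (j' < (n * N).+1)%N by apply: ltnW.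
  by have /= := Hmin (Ordinal h); rewrite mulSn addKn.
have [lt|ge] := ltnP j (n * N).
  have h : (j.+1 < (n * N).+1)%N by [].
  by have /= := jmin (Ordinal h) isT; rewrite mulSn addnC.
apply: leq_trans (jmin ord0 isT) _; rewrite /= mul0n /dual muln0 mul0n add0n.
apply: (@leq_trans (k * (j * d) * Q)); last first.
  by apply: leq_trans (leq_addr _ _); rewrite leq_mul2r leq_mul2l leq_addr !orbT.
apply: (@leq_trans (\sum_(i in S) factor * d)%N); first by apply: leq_sum => i iS; exact: H.
rewrite sum_nat_const; apply: (@leq_trans (n * (factor * d))).
  by rewrite leq_mul2r -[X in (_ <= X)%N](card_ord n) max_card orbT.
apply: (@leq_trans (k * (n * N * d) * Q)); first by rewrite /factor; lia.
by rewrite leq_mul2r leq_mul2l leq_mul2r ge !orbT.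
Qed.

Lemma weights_large_ok S : exists w,
  [/\ w \in weights_large p, (wsum w S < cap_large p)%N
   & (4 <= N)%N -> (N ^ 2 <= 4 * k)%N ->
     forall S', wsum w S' = wsum w S -> (1 - 11 / N%:R) * Eopt S <= Eopt S'].
Proof.
have [i0 [r [d [rn Hmu Hd Hfd HP]]]] := guess_exists S (leqnn vmax).
have HS i : i \in S -> (mu i <= factor * d)%N by move=> h; apply: leq_trans (Hmu i h) Hfd.
have [j [jn OL OR]] := dual_min HS.
pose t := (j * d)%N.
pose w := [seq weight_large p (mu i0, d) t D | D <- pZ p].
pose good (i : 'I_n) := (mu i <= mu i0)%N.
have Hgood i : good i -> (mu i <= factor * d)%N by move=> h; apply: leq_trans h Hfd.
have Hw (i : 'I_n) : nth 0%N w i = if good i then horner (base_large p) (digits_large p d t (Zi i)) else cap_large p.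
  by rewrite /w nth_w.
have HB : base_large p = (n * (n * N * N)).+1 by rewrite /base_large pn_E pN_E.
have DD S' := @digits_determined n (base_large p) 3 (cap_large p) (n * N * N) (fun i => digits_large p d t (Zi i))
  good (fun i => nth 0%N w i) S S' (fun i => erefl) HB erefl
  (fun i j gi => digits_large_le t j (Hgood i gi)) Hw Hmu.
have Hlt := (DD S).1.
exists w; split.
- apply/flattenP; exists [seq [seq weight_large p (mu i0, d) t D | D <- pZ p]
     | t <- traject (addn d) 0 (size (tt :: utimes (pZ p) (pu p)))].
    by apply/mapP; exists (mu i0, d) => //; rewrite Hd; exact: guess_mem.
  apply/mapP; exists t => //; apply/trajectP; exists j; last by rewrite iter_addn addn0 mulnC.
  by rewrite /= size_utimes -/(pn p) pn_E -/(pN p) pN_E ltnS.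
- exact: Hlt.
move=> N4 kN S' Hsum.
have [_ H] := DD S'.
have [Hg' Hdig] := H Hsum.
pose Xm := (vmax + (t + d))%N.
have hX : (vmax <= Xm)%N by exact: leq_addr.
have EP T : Phi Xm T = Phi vmax T by rewrite !PhiE.
case: HP => [P0|[d0 HP]].
  have E0 : Eopt S = 0.
    by apply/eqP; move/eqP: P0; rewrite PhiE // mulf_eq0 gt_eqF ?sg_gt0.
  by rewrite E0 mulr0; have := Phi_ge0 vmax S'; rewrite PhiE // pmulr_rge0 // sg_gt0.
apply: (@Phi_transfer Xm S S' (11 / N%:R) _ hX); first by rewrite subrr.
have Qp : 0 < Q%:R^-1 :> rat by rewrite invr_gt0 ltr0n Q0.
have np : 0 < n%:R :> rat by rewrite ltr0n.
have Np : 0 < N%:R :> rat by rewrite ltr0n.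
have close e a : (e < 3)%N -> nth 0%N [:: t - d; t; t + d]%N e = a ->
    `|excess prX Xm (enum S) a - excess prX Xm (enum S') a| <= (k * d)%:R / N%:R.
  move=> He Ea.
  have Ed : (\sum_(i in S) unit_digit p d (n * N) a (Zi i) = \sum_(i in S') unit_digit p d (n * N) a (Zi i))%N.
    by rewrite -Ea; case: e He {Ea} (Hdig e He) => [|[|[|e]]] // _; rewrite /= !pn_E !pN_E.
  rewrite !excess_enum //.
  have U1 := unit_digit_close d0 Ed; have U2 := unit_digit_close d0 (esym Ed).
  set x := _ / Q%:R in U1 U2 *; set y := _ / Q%:R in U1 U2 *.
  have E1 : (n * (k * d))%:R = (n * N)%:R * ((k * d)%:R / N%:R) :> rat.
    by rewrite !natrM; field; rewrite gt_eqF.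
  have nN : 0 < (n * N)%:R :> rat by rewrite natrM mulr_gt0.
  rewrite E1 -mulrDr ler_pM2l // in U1; rewrite E1 -mulrDr ler_pM2l // in U2.
  by rewrite ler_norml; apply/andP; split; lra.
apply: (phi_large (fun i x => pr01 sg Xd i x) (fun i x y h => pr_mono sg Xd i h)
  N4 k0 kN d0 (t := t)).
- by rewrite /t; case: (j) => [|j']; rewrite ?mul0n // mulSn leq_addr orbT.
- exact: leq_addl.
- by rewrite -/(Phi Xm S) EP; case/andP: HP.
- by rewrite !dualE // ler_pM2r // ler_nat.
- by rewrite !dualE // ler_pM2r // ler_nat.
move=> a; rewrite !inE => /or3P[/eqP->|/eqP->|/eqP->].
- exact: (close 0%N).
- exact: (close 1%N).
- exact: (close 2%N).
Qed.

Definition bits S : seq bool := [seq i \in S | i <- enum 'I_n].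

Lemma pZ_enum : pZ p = [seq Zi i | i <- enum 'I_n].
Proof.
transitivity [seq intd (vden X * factor) Q D | D <- [seq tnth X i | i <- enum 'I_n]].
  by rewrite map_tnth_enum.
by rewrite -map_comp.
Qed.

Lemma mem_values i y : y \in tnth X i -> ival y \in sorted_values (pZ p).
Proof.
move=> Hy; rewrite mem_sorted_values; apply/flattenP; exists [seq z.1 | z <- Zi i].
  by apply: map_f; rewrite -nth_pZ; apply: mem_nth; rewrite -/(pn p) pn_E.
by rewrite Zi_E -map_comp; apply: (map_f (fun y => ival y)).
Qed.

Lemma values_vmax v : v \in sorted_values (pZ p) -> (v <= vmax)%N.
Proof.
rewrite mem_sorted_values pZ_enum => /flattenP[s /mapP[D /mapP[i _ ->] ->]].
by rewrite Zi_E -map_comp => /mapP[y Hy ->]; exact: ival_vmax Hy.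
Qed.

Lemma level_scoreE S x :
  (level_score p (bits S) x)%:R = Q%:R ^+ n * etrunc k (row prX (enum S) x) :> rat.
Proof.
rewrite /level_score; set l := [seq _ | _ <- _].
have El : l = [seq (if i \in S then tailmass (Zi i) x else 0%N) | i <- enum 'I_n].
  by rewrite /l pZ_enum zip_map -map_comp.
have sl : size l = n by rewrite El size_map size_enum_ord.
have st : size (trunc_list p) = n.+1.
  by rewrite size_map size_traject /= size_map -/(pn p) pn_E.
rewrite pQ_E pstep_ebern ?Q0 ?sl ?st //; last first.
  by rewrite El; apply/allP => a /mapP[i _ ->]; case: ifP => // _; exact: tailmass_leQ.
congr (_ * _); rewrite (@eq_ebern_le _ _ (fun c => (minn k c)%:R)); last first.
  move=> c; rewrite size_map sl -ltnS => hc.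
  have Ez : size (tt :: [seq tt | _ <- pZ p]) = n.+1 by rewrite /= size_map -/(pn p) pn_E.
  rewrite /trunc_list Ez (nth_map 0%N) ?size_traject // nth_traject //.
  by rewrite iter_addn mul1n addn0.
have -> : [seq a%:R / Q%:R | a <- l] = [seq (if i \in S then prX i x else 0) | i <- enum 'I_n].
  rewrite El -map_comp; apply: eq_map => i /=.
  by case: ifP => _; rewrite ?prE // mul0r.
rewrite ebern_mask /etrunc /row; congr ebern; congr map.
by rewrite enumT; apply: eq_filter.
Qed.

Lemma scoreE S : (score p (sorted_values (pZ p)) (bits S))%:R = Q%:R ^+ n * Phi vmax S :> rat.
Proof.
rewrite /score (@zip_sum (level_score p (bits S)) _ _ vmax).
- by rewrite natr_sum /Phi /phi mulr_sumr; apply: eq_bigr => x _; exact: level_scoreE.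
- by have := sorted_values_sorted (pZ p); case: (sorted_values _).
- exact: values_vmax.
- move=> x y x0 xy H; rewrite /level_score; congr (head _ (foldl _ _ _)).
  rewrite pZ_enum zip_map -!map_comp; apply: eq_map => i /=; case: ifP => // _.
  rewrite /tailmass Zi_E !big_map big_seq [RHS]big_seq; apply: eq_bigr => z hz /=.
  by rewrite (H _ (mem_values hz)).
- move=> x x0 H; apply/eqP; rewrite -(eqr_nat rat) level_scoreE mulf_eq0; apply/orP; right.
  apply/eqP; apply/le_anti; rewrite etrunc_ge0 ?andbT; last by apply: row01 => i y; exact: pr01.
  apply: (@le_trans _ _ (lam (row prX (enum S) x))).
    by apply: etrunc_lelam; apply: row01 => i y; exact: pr01.
  rewrite lam_row big1 // => i _; rewrite prE /tailmass Zi_E big_map big_seq big1 ?mul0r //.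
  by move=> z hz /=; rewrite leqNgt (H _ (mem_values hz)).
Qed.

Lemma score_le S S' : (score p (sorted_values (pZ p)) (bits S) <= score p (sorted_values (pZ p)) (bits S'))%N ->
  Eopt S <= Eopt S'.
Proof.
have Qp : 0 < Q%:R ^+ n :> rat by rewrite exprn_gt0 // ltr0n Q0.
by rewrite -(ler_nat rat) !scoreE ler_pM2l // !PhiE // ler_pM2l // sg_gt0.
Qed.

Lemma guessesP g : g \in guesses p -> exists i r, (0 < r)%N /\ g = (mu i, (r * mu i %/ factor)%N).
Proof.
move=> /flattenP[s /mapP[D hD ->]] /mapP[r hr ->].
have [i ->] : exists i, D = Zi i.
  by move: hD; rewrite pZ_enum => /mapP[i _ ->]; exists i.
exists i, r; split; last by [].
by case/trajectP: hr => j _ ->; rewrite iter_addn addn1.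
Qed.

Lemma guess_bound i j r : (0 < r)%N -> (mu j <= mu i)%N -> (mu j <= factor * (r * mu i %/ factor))%N.
Proof.
move=> r0 h; apply: leq_trans h _.
have dvd : (r * mu i %/ factor = r * (mu i %/ factor))%N by rewrite muln_divA ?exces_dvd.
by rewrite dvd mulnCA (mulnC factor) divnK ?exces_dvd // leq_pmull.
Qed.

Lemma weights_small_bound w : w \in weights_small p ->
  size w = n /\ forall x, x \in w -> (x <= cap_small p)%N.
Proof.
move=> /mapP[g /guessesP[i [r [r0 ->]]] ->]; split; first by rewrite size_map -/(pn p) pn_E.
move=> x /mapP[D]; rewrite pZ_enum => /mapP[j _ ->] ->; rewrite /weight_small; case: ifP => // h.
apply: ltnW; have := @horner_lt (base_small p) (digits_small p (r * mu i %/ factor) (Zi j)).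
rewrite size_digits_small; apply; apply/allP => y /(nthP 0%N)[e _ <-].
rewrite /base_small ltnS; apply: leq_trans (digits_small_le _ (guess_bound r0 h)) _.
by rewrite leq_pmull // pn_E.
Qed.

Lemma weights_large_bound w : w \in weights_large p ->
  size w = n /\ forall x, x \in w -> (x <= cap_large p)%N.
Proof.
move=> /flattenP[s /mapP[g /guessesP[i [r [r0 ->]]] ->]] /mapP[t _ ->].
split; first by rewrite size_map -/(pn p) pn_E.
move=> x /mapP[D]; rewrite pZ_enum => /mapP[j _ ->] ->; rewrite /weight_large; case: ifP => // h.
apply: ltnW; have := @horner_lt (base_large p) (digits_large p (r * mu i %/ factor) t (Zi j)).
apply; apply/allP => y /(nthP 0%N)[e _ <-].
rewrite /base_large ltnS; apply: leq_trans (digits_large_le _ _ (guess_bound r0 h)) _.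
by rewrite pn_E pN_E leq_pmull.
Qed.

Lemma size_guesses : size (guesses p) = (n * n)%N.
Proof.
rewrite /guesses (@size_flatten_map _ _ _ _ n) -/(pn p) ?pn_E // => D.
by rewrite size_map size_traject.
Qed.

Lemma size_weights_small : size (weights_small p) = (n * n)%N.
Proof. by rewrite size_map size_guesses. Qed.

Lemma size_weights_large : size (weights_large p) = (n * n * (n * N).+1)%N.
Proof.
rewrite /weights_large (@size_flatten_map _ _ _ _ (n * N).+1) ?size_guesses // => g.
by rewrite size_map size_traject /= size_utimes -/(pn p) pn_E.
Qed.

Lemma cap_small_E : cap_small p = ((n * (n * (24 * N ^ 2) ^ (2 * (100 * N ^ 2)))).+1 ^ (N ^ 4 * (100 * N ^ 2)).+1)%N.
Proof.
rewrite /cap_small /base_small prec_E pn_E.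
have -> : size (tt :: utimes (levels_fuel p) (moments_fuel p)) = (N ^ 4 * (100 * N ^ 2)).+1.
  by rewrite -size_levels -size_moments -size_utimes.
by rewrite size_moments.
Qed.

Lemma cap_large_E : cap_large p = ((n * (n * N * N)).+1 ^ 3)%N.
Proof. by rewrite /cap_large /base_large pn_E pN_E. Qed.

End Integers.

(** * The search program *)

Section Run.
Local Open Scope nat_scope.

(** The body of [pt] with its program and exponent exposed, since the search is assembled from fixed
    programs. *)
Definition computes (A B : encType) (f : A -> B) (p : regs) (e : nat) : Prop :=
  forall call x s a, s x = encode a ->
    exists s' t, [/\ exec call (p x) s s' t [::], s' x = encode (f a),
      (forall y, y < x -> s' y = s y), t <= pb e (sz a) & sz (f a) <= pb e (sz a)].

(** [1 / eps] rounded up. *)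
Definition inverse_ceil (eps : rat) : nat := (`|denq eps|.-1 %/ `|numq eps|).+1.

Definition ustate_at (x : input) (i : nat) : ustate :=
  (i < inverse_ceil x.2.2, (i * `|numq x.2.2|, (nseq i tt, x))).

Lemma sz_nseq_tt i : sz (nseq i tt) = i.*2.+1.
Proof. by elim: i => //= i IH; rewrite sz_cons IH /= doubleS. Qed.

Lemma sz_ustate_at x i : i <= inverse_ceil x.2.2 ->
  sz (ustate_at x i) <= 14 * (sz x + inverse_ceil x.2.2).
Proof.
move=> hi; rewrite !sz_pair sz_nseq_tt.
have h1 := sz_nat (i * `|numq x.2.2|); have h2 := blM i `|numq x.2.2|.
have h3 : bl i <= i by apply: bl_min; exact: ltn_expl.
have h4 : bl `|numq x.2.2| < sz x.
  apply: leq_trans (bl_sz _) _; case: x {hi h1 h2} => D [k e] /=; rewrite !sz_pair.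
  have -> : sz e = (sz (numq e) + sz (denq e)).+1 by [].
  have -> : sz (numq e) = (sz (numq e < 0)%R + sz `|numq e|%N).+1 by [].
  lia.
have h5 : sz (i < inverse_ceil x.2.2) <= 3 by rewrite sz_bool; case: ifP.
by have := sz_gt0 x; lia.
Qed.

Lemma unary_phase call pu eu s (x : input) : computes unary_step pu eu ->
  (0 < numq x.2.2)%R -> s 1 = encode (ustate_at x 0) ->
  exists s' t, [/\ exec call (CWhile (EHd (EVar 1)) (pu 1)) s s' t [::], s' 0 = s 0,
    s' 1 = encode (ustate_at x (inverse_ceil x.2.2))
    & t <= (inverse_ceil x.2.2).+1 * (pb eu (14 * (sz x + inverse_ceil x.2.2))).+3].
Proof.
move=> P num0 s1; set N := inverse_ceil _.
pose Inv m s' := [/\ m <= N, s' 0 = s 0 & s' 1 = encode (ustate_at x (N - m))].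
have [|m s2 [hm E0 E1]||s' [t [qs [X [_ E0 E1] T _ Q]]]] :=
  @while_rule call (EHd (EVar 1)) (pu 1) Inv (fun=> False)
    (pb eu (14 * (sz x + N))) _ _ N s _.
- by move=> s2 [_ _ E]; rewrite /= E subn0 /= ltnn.
- split; first by rewrite /= E1 /= -/N; have -> : (N - m.+1 < N) by lia.
  have [s3 [t3 [X3 V3 F3 T3 _]]] := P call 1 s2 _ E1.
  exists s3, t3, [::]; split=> //; last first.
    by apply: leq_trans T3 _; apply: pb_mono; apply: sz_ustate_at; rewrite leq_subr.
  split; [by lia | by rewrite F3 |rewrite V3].
  have -> : N - m = (N - m.+1).+1 by lia.
  have n0 : 0 < `|numq x.2.2| by rewrite absz_gt0 gt_eqF.
  have d0 : 0 < `|denq x.2.2| by rewrite absz_gt0 denq_neq0.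
  congr encode; rewrite /unary_step /ustate_at /= addnC -mulSn; congr (_, _).
  by rewrite /inverse_ceil ltnS leq_divRL // -[in LHS](prednK d0) ltnS.
- by split; rewrite ?subnn ?leqnn.
exists s', t; split=> //; first by case: qs Q X => // q qs Q; case: (Q q); left.
by apply: leq_trans T _; rewrite leq_mul2l /=; lia.
Qed.

(** * Invariant of the search loop *)

Section Search.
Variables (n : nat) (X : n.-tuple distr) (k : nat) (eps : rat) (u : seq unit).
Variables (F : {set {set 'I_n}}) (code : data) (call : data -> data -> nat -> Prop) (Mc : nat).

Let x : input := (X : seq distr, (k, eps)).
Let p := mk_params (x, u).
Let vs := sorted_values (pZ p).
Let cap := cap_of x p.
Let ws0 := weights_of x p.

Definition answers (w : seq nat) (z : nat) (o : option {set 'I_n}) : Prop :=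
  if o is Some A then A \in F /\ wsum w A = z else forall S, S \in F -> wsum w S <> z.

Hypothesis weights_ok : forall w, w \in ws0 -> size w = n /\ forall a, a \in w -> a <= cap.
Hypothesis oracle : forall w z, size w = n -> (forall a, a \in w -> a <= cap) -> z <= cap ->
  exists o m, [/\ call (Node code (encode ([seq Posz a | a <- w], Posz z))) (enc_option (@enc_set n) o) m,
    answers w z o & m <= Mc].

Definition good_call (q : data * nat) : Prop :=
  q.2 <= Mc /\ exists w z, [/\ size w = n, forall a, a \in w -> a <= cap
    & q.1 = Node code (encode ([seq Posz a | a <- w], Posz z))].

(** The number of queries still to be made: the index of the invariant in [while_rule]. *)
Definition remaining (ws : seq (seq nat)) (z : nat) : nat :=
  if ws is _ :: r then size r * cap.+1 + z.+1 else 0.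

(** [bs] is a score plus one, so the strict inequality says that the best set is at least as good as
    some set of the same weight as [S]. *)
Definition found (bs : nat) (w : seq nat) (S : {set 'I_n}) : Prop :=
  exists2 S', S' \in F & wsum w S' = wsum w S /\ score p vs (bits S') < bs.

(** The query of the list [w] with the weight of [S] as target has not been made yet. *)
Definition pending (ws : seq (seq nat)) (z : nat) (w : seq nat) (S : {set 'I_n}) : bool :=
  if ws is v :: r then (w \in r) || (w == v) && (wsum w S <= z) else false.

Definition best_ok (b : nat * seq bool) : Prop :=
  b = (0, [::]) \/ exists2 S, S \in F & b = ((score p vs (bits S)).+1, bits S).

(** The last clause ranges over all sets of the family, since the program knows neither the optimal
    set nor the right guess. *)
Definition search_inv (m : nat) (st : state) : Prop :=
  exists ws z b, st = (ws, (z, (b, (p, (vs, cap))))) /\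
    [/\ m = remaining ws z, (exists pre, ws0 = pre ++ ws) /\ z <= cap, best_ok b
      & forall w S, w \in ws0 -> S \in F -> wsum w S <= cap -> pending ws z w S \/ found b.1 w S].

Definition final_ok (b : nat * seq bool) : Prop := best_ok b /\
  forall w S, w \in ws0 -> S \in F -> wsum w S <= cap -> found b.1 w S.

Definition answer (o : option {set 'I_n}) : seq (seq bool) := if o is Some A then [:: bits A] else [::].

Lemma found_mono b b' w S : b <= b' -> found b w S -> found b' w S.
Proof. by move=> h [S' h1 [h2 h3]]; exists S' => //; split=> //; apply: leq_trans h3 h. Qed.

Lemma search_inv_step m st w z o : search_inv m.+1 st -> head [::] st.1 = w -> st.2.1 = z ->
  answers w z o -> search_inv m (search_step (st, answer o)).
Proof.
move=> [ws [z' [b [-> [hm [[pre hp] hz] hb hc]]]]] /= hw <- {z} ho.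
case: ws hp hm hw hc => [//|w' ws] hp hm /= ew hc; rewrite -{}ew in ho *.
rewrite /search_step /=; set b' := if nilp _ then b else _.
have best_ge A : b.1 <= (best (w' :: ws, (z', (b, (p, (vs, cap))))) A).1.
  by rewrite /best /=; case: ifP => //= /ltnW.
have hbb : b.1 <= b'.1 by rewrite /b'; case: (o) => [A|] //=; exact: best_ge.
have hb' : best_ok b'.
  rewrite /b'; case: o ho {b' hbb} => [A|] //= [AF _]; rewrite /best /=; case: ifP => // _.
  by right; exists A.
have hfound A : A \in F -> wsum w' A = z' -> found b'.1 w' A.
  move=> AF Az; rewrite /b'; case: o ho {b' hbb hb'} => [A'|] /= ho; last by case: (ho A AF).
  case: ho => A'F A'z /=; exists A' => //; split; first by rewrite A'z.
  by rewrite /best /=; case: ifP => //= /negbT; rewrite -leqNgt.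
clearbody b'; clear best_ge ho.
exists (if z' == 0 then ws else w' :: ws), (if z' == 0 then cap else z'.-1), b'; split=> //.
split=> //.
- case: (posnP z') hm => [->|z0] /= hm.
    case: ws hm {hp hc} => [|v ws] /=; first by case.
    by rewrite mulSn; lia.
  by lia.
- case: (posnP z') => [_|z0]; last by split; [exists pre | lia].
  by split=> //; exists (rcons pre w'); rewrite cat_rcons hp.
- move=> v S vw SF Sc; case: (hc v S vw SF Sc) => [|h]; last by right; exact: found_mono h.
  case/orP=> [h|/andP[/eqP-> h]].
    left; case: ifP => _ /=; last by rewrite h.
    case: ws h {hp hm hc} => // v' ws; rewrite inE /= => /orP[/eqP e|->//].
    by rewrite e eqxx -e Sc orbT.
  case: (eqVneq (wsum w' S) z') => [e|ne]; first by right; exact: hfound.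
  have lt : wsum w' S < z' by rewrite ltn_neqAle ne.
  left; have z0 : 0 < z' by apply: leq_ltn_trans lt.
  by rewrite (gtn_eqF z0) /= eqxx /= -ltnS prednK ?lt ?orbT.
Qed.

Definition state_bound (V es M : nat) : nat := 5 * V + pb es (2 * V + 8 * M) + 8 * M.

(** The state does not grow with the rounds: the lists are a suffix of the initial ones, the target
    stays below [cap], and the best set is one set with its score. *)
Lemma search_inv_size m st V es M : search_inv m st -> sz (start (x, u)) <= V ->
  (forall y : (params * seq nat) * seq bool, sz (score y.1.1 y.1.2 y.2).+1 <= pb es (sz y)) ->
  sz x <= M -> sz st <= state_bound V es M.
Proof.
move=> [ws [z [b [-> [_ [[pre hp] hz] hb _]]]]] hV hs hM.
have nx : n < sz x.
  by rewrite sz_pair ltnS; apply: leq_trans (leq_addr _ _); rewrite -{1}(size_tuple X); apply/ltnW; exact: size_sz.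
have hz' := sz_nat_mono hz.
have hws : sz ws <= sz ws0 by have := sz_cat pre ws; rewrite -hp; have := sz_gt0 pre; lia.
have s0 : sz 0 = 1 by rewrite /sz nat_bits0_enc.
have hst : sz (start (x, u)) = sz ws0 + sz cap + sz p + sz vs + sz cap + 8.
  have -> : sz (start (x, u)) = sz (ws0, (cap, ((0, [::] : seq bool), (p, (vs, cap))))) by [].
  by rewrite !sz_pair s0 sz_nil; lia.
rewrite hst in hV; have gp := sz_gt0 p; have gv := sz_gt0 vs; have gw := sz_gt0 ws0.
have hb1 : sz b <= pb es (2 * V + 8 * M) + 4 * M + 4.
  case: hb => [->|[S _ ->]]; rewrite !sz_pair ?s0 ?sz_nil; first by lia.
  have hbS : sz (bits S) <= 4 * n + 1.
    by have := sz_bits (bits S); rewrite size_map size_enum_ord.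
  have h1 : pb es (sz ((p, vs), bits S)) <= pb es (2 * V + 8 * M).
    apply: pb_mono; have -> : sz ((p, vs), bits S) = sz p + sz vs + sz (bits S) + 2 by rewrite !sz_pair; lia.
    by lia.
  have /= h2 := hs ((p, vs), bits S); lia.
have -> : sz (ws, (z, (b, (p, (vs, cap))))) = sz ws + sz z + sz b + sz p + sz vs + sz cap + 5.
  by rewrite !sz_pair; lia.
by rewrite /state_bound; lia.
Qed.

Lemma search_inv_start : search_inv (remaining ws0 cap) (start (x, u)).
Proof.
exists ws0, cap, (0, [::]); split=> //; split=> //; first by split=> //; exists [::].
  by left.
by move=> w S hw _ hS; left; case: ws0 hw => //= v r; rewrite inE hS andbT orbC.
Qed.

Lemma remaining_start : remaining ws0 cap = size ws0 * cap.+1.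
Proof. by case: ws0 => //= v r; rewrite mulSn addnC. Qed.

(** Register 0 keeps the code of the family, register 1 the state; register 2 holds the query and
    then its answer. *)
Definition search_body (pq pd : regs) : cmd :=
  CSeq (CAssign 2 (EVar 1)) (CSeq (pq 2) (CSeq (CCall 2 (ENode (EVar 0) (EVar 2)))
    (CSeq (CAssign 1 (ENode (EVar 1) (EVar 2))) (pd 1)))).

Definition step_bound (eq ed B : nat) : nat := pb eq B + pb ed (B + 4 * B) + 30.

Lemma search_phase pq eq pd ed es V M s :
  computes query pq eq -> computes search_step pd ed ->
  (forall y : (params * seq nat) * seq bool, sz (score y.1.1 y.1.2 y.2).+1 <= pb es (sz y)) ->
  sz (start (x, u)) <= V -> sz x <= M -> s 0 = code -> s 1 = encode (start (x, u)) ->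
  exists s' t qs b, [/\ exec call (CWhile (EHd (EVar 1)) (search_body pq pd)) s s' t qs,
    eval s' (ETl (EHd (ETl (ETl (EVar 1))))) = encode b.2 /\ final_ok b,
    t <= (size ws0 * cap.+1).+1 * (step_bound eq ed (state_bound V es M) + 3),
    size qs <= size ws0 * cap.+1 & forall q, List.In q qs -> good_call q].
Proof.
move=> Pq Pd hs hV hM s0 s1; set B := state_bound V es M.
have nB : 4 * n + 3 <= B.
  have nx : n < sz x.
    by rewrite sz_pair ltnS; apply: leq_trans (leq_addr _ _); rewrite -{1}(size_tuple X); apply/ltnW; exact: size_sz.
  by rewrite /B /state_bound; lia.
pose Inv m s' := s' 0 = code /\ exists2 st, s' 1 = encode st & search_inv m st.
have [|m s2 [E0 [st E1 I]]||s' [t [qs [X' [_ [st E1 I]] T Q G]]]] :=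
  @while_rule call (EHd (EVar 1)) (search_body pq pd) Inv good_call
    (step_bound eq ed B) _ _ (size ws0 * cap.+1) s _.
- move=> s2 [_ [st E1 [ws [z [b [Est [hm _ _ _]]]]]]]; rewrite /= E1 Est /=.
  by case: ws hm {Est} => //= v r; rewrite addnS.
- have hB := search_inv_size I hV hs hM; rewrite -/B in hB.
  case: (I) => ws [z [b [Est [hm [[pre hp] hz] hb hc]]]].
  have [w [r Ews]] : exists w r, ws = w :: r.
    by case: (ws) hm => // w r _; exists w, r.
  split; first by rewrite /= E1 Est Ews.
  have ww : w \in ws0 by rewrite hp Ews mem_cat inE eqxx orbT.
  have [sw aw] := weights_ok ww.
  have [o [mc [hcall ho hmc]]] := @oracle w z sw aw hz.
  pose s3 := upd s2 2 (s2 1).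
  have [s4 [t4 [X4 V4 F4 T4 _]]] : exists s4 t4, [/\ exec call (pq 2) s3 s4 t4 [::], s4 2 = encode (query st),
      (forall y, y < 2 -> s4 y = s3 y), t4 <= pb eq (sz st) & sz (query st) <= pb eq (sz st)].
    by apply: Pq; rewrite /s3 updE.
  pose s5 := upd s4 2 (enc_option (@enc_set n) o).
  pose s6 := upd s5 1 (Node (s5 1) (s5 2)).
  have E6 : s6 1 = encode (st, answer o).
    rewrite /s6 updE /s5 updE updN // F4 // /s3 updN // E1.
    by case: (o).
  have [s7 [t7 [X7 V7 F7 T7 _]]] := Pd call 1 s6 _ E6.
  have Ec : eval s4 (ENode (EVar 0) (EVar 2)) = Node code (encode ([seq Posz a | a <- w], Posz z)).
    by rewrite /= V4 F4 // /s3 updN // E0 Est Ews.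
  exists s7, (2 + (t4 + (4 + (4 + t7).+1).+1).+1).+1.
  exists [:: (Node code (encode ([seq Posz a | a <- w], Posz z)), mc)]; split.
  + apply: (ExSeq (qs1 := [::]) (ExAssign call s2 2 (EVar 1))).
    apply: (ExSeq (qs1 := [::]) X4).
    apply: (ExSeq (qs1 := [:: _]) (s1 := s5)).
      by rewrite -Ec in hcall *; exact: ExCall.
    apply: (ExSeq (qs1 := [::]) (ExAssign call s5 1 (ENode (EVar 1) (EVar 2)))).
    exact: X7.
  + split; first by rewrite F7 // /s6 updN // /s5 updN // F4.
    exists (search_step (st, answer o)) => //.
    by apply: (search_inv_step I) ho; rewrite Est Ews.
  + have T7' : t7 <= pb ed (B + 4 * B).
      apply: leq_trans T7 (pb_mono _ _); rewrite sz_pair.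
      suff : sz (answer o) <= 4 * n + 2 + 1 by lia.
      rewrite /answer; case: (o) => [S|]; last by rewrite sz_nil; lia.
      have -> : sz [:: bits S] = sz (bits S) + 2 by rewrite sz_cons sz_nil; lia.
      by have := sz_bits (bits S); rewrite size_map size_enum_ord; lia.
    have T4' : t4 <= pb eq B by apply: leq_trans T4 (pb_mono _ _).
    by rewrite /step_bound; lia.
  + by [].
  + by move=> q [<-|//]; split=> //=; exists w, z.
- by split=> //; exists (start (x, u)) => //; rewrite -remaining_start; exact: search_inv_start.
case: I => ws [z [b [Est [hm _ hb hc]]]].
exists s', t, qs, b; split=> //; last by apply: leq_trans T _; rewrite leq_mul2l /=; lia.
split; first by rewrite /= E1 Est.
split=> // w S hw hS hw'; case: (hc w S hw hS hw') => //.
by case: (ws) hm => //= v r; rewrite addnS.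
Qed.
End Search.
End Run.

Section Main.
Local Open Scope nat_scope.

(** Register 0 is reduced to the code of the family, which only the queries need, and register 1
    becomes the initial state of the unary counter. The final expression projects the best set out
    of the search state. *)
Definition main (pu pp pq pd : regs) : cmd :=
  CSeq (CSeq (CAssign 1 (ETl (EVar 0))) (CSeq (CAssign 0 (EHd (EVar 0)))
    (CAssign 1 (ENode (ENode ELeaf ELeaf) (ENode ELeaf (ENode ELeaf (EVar 1)))))))
  (CSeq (CWhile (EHd (EVar 1)) (pu 1))
  (CSeq (pp 1)
  (CSeq (CWhile (EHd (EVar 1)) (search_body pq pd))
    (CAssign 0 (ETl (EHd (ETl (ETl (EVar 1))))))))).

Lemma main_run : exists P e, forall n (X : n.-tuple distr) k eps (F : {set {set 'I_n}}) code call Mc,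
  let x : input := (X : seq distr, (k, eps)) in
  let N := inverse_ceil eps in
  let p := mk_params (x, nseq N tt) in
  let I := size (weights_of x p) * (cap_of x p).+1 in
  (0 < eps)%R ->
  (forall w, w \in weights_of x p -> size w = n /\ forall a, a \in w -> a <= cap_of x p) ->
  (forall w z, size w = n -> (forall a, a \in w -> a <= cap_of x p) -> z <= cap_of x p ->
    exists o m, [/\ call (Node code (encode ([seq Posz a | a <- w], Posz z))) (enc_option (@enc_set n) o) m,
      answers F w z o & m <= Mc]) ->
  exists b t qs, [/\ runs call P (Node code (enc_data X k eps)) (encode b.2) t qs,
    final_ok X k eps (nseq N tt) F b,
    t <= (I + N + 2) * pb e (dsize (enc_data X k eps) + N),
    size qs <= I & forall q, List.In q qs -> good_call X k eps (nseq N tt) code Mc q].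
Proof.
have [pu [eu Pu]] := pt_unary_step; have [pp [ep Pp]] := pt_start.
have [pq [eq Pq]] := pt_query; have [pd [ed Pd]] := pt_search_step.
have [es Hs] := pt_size (pt_succ pt_score).
pose T M := pb eu (14 * M) + pb ep (14 * M)
  + step_bound eq ed (state_bound (pb ep (14 * M)) es M) + 60.
have [e He] : poly T by rewrite /T /step_bound /state_bound; solve_poly.
exists (main pu pp pq pd), e => n X k eps F code call Mc x N p I eps0 Hw Ho.
set M := dsize _ + N.
have num0 : (0 < numq x.2.2)%R by rewrite numq_gt0.
have Dx : dsize (enc_data X k eps) = sz x by [].
pose s0 := upd (fun=> Leaf) 0 (Node code (enc_data X k eps)).
pose s1 := upd s0 1 (eval s0 (ETl (EVar 0))).
pose s2 := upd s1 0 (eval s1 (EHd (EVar 0))).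
pose s3 := upd s2 1 (eval s2 (ENode (ENode ELeaf ELeaf) (ENode ELeaf (ENode ELeaf (EVar 1))))).
have E3 : s3 1 = encode (ustate_at x 0).
  have -> : encode (ustate_at x 0) = Node (Node Leaf Leaf) (Node (encode 0) (Node Leaf (encode x))) by [].
  by rewrite nat_bits0_enc.
have [s4 [t4 [X4 F4 V4 T4]]] := unary_phase call Pu num0 E3.
have [s5 [t5 [X5 V5 F5 T5 S5]]] := Pp call 1 s4 _ V4.
have h14 := sz_ustate_at (leqnn (inverse_ceil x.2.2)).
have hV : sz (start (x, nseq N tt)) <= pb ep (14 * M) by apply: leq_trans S5 (pb_mono _ h14).
have hM : sz x <= M by rewrite /M Dx leq_addr.
have E50 : s5 0 = code by rewrite F5 // F4.
have [s6 [t6 [qs [b [X6 [E6 B6] T6 Q6 G6]]]]] :=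
  search_phase Hw Ho Pq Pd Hs hV hM E50 V5.
exists b; eexists; exists qs; split.
- exists (upd s6 0 (eval s6 (ETl (EHd (ETl (ETl (EVar 1))))))); last by rewrite updE E6.
  apply: (ExSeq (qs1 := [::])).
    apply: (ExSeq (qs1 := [::]) (qs2 := [::])); first exact: ExAssign.
    by apply: (ExSeq (qs1 := [::]) (qs2 := [::])); exact: ExAssign.
  apply: (ExSeq (qs1 := [::])); first exact: X4.
  apply: (ExSeq (qs1 := [::])); first exact: X5.
  rewrite -[qs]cats0; apply: ExSeq; first exact: X6.
  exact: ExAssign.
- exact: B6.
- apply: (@leq_trans ((I + N + 2) * T M)); last first.
    by rewrite leq_mul2l He ?orbT // /M Dx; have := sz_gt0 x; lia.
  have h5 : t5 <= pb ep (14 * M) by apply: leq_trans T5 (pb_mono _ h14).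
  rewrite -Dx -/N -/M in T4; rewrite -/M in T6; simpl ecost.
  rewrite /T; move: (pb eu _) (pb ep _) (step_bound _ _ _) T4 h5 T6 => a1 a2 a3.
  have -> : size (weights_of x (mk_params (x, nseq (inverse_ceil eps) tt)))
    * (cap_of x (mk_params (x, nseq (inverse_ceil eps) tt))).+1 = I by [].
  move: (I) (N); clear=> I' N' h4 h5 h6.
  by nia.
- exact: Q6.
- exact: G6.
Qed.
End Main.

(** * Rounding of 1/eps *)

Section InverseCeil.
Local Open Scope ring_scope.
Variables (k : nat) (eps : rat).
Hypothesis eps01 : 0 < eps < 1.

Let N := inverse_ceil eps.

Lemma inverse_ceil_num : (`|denq eps| <= N * `|numq eps| < 2 * `|denq eps|)%N.
Proof.
have [e0 e1] := andP eps01.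
have d0 : (0 < `|denq eps|)%N by rewrite absz_gt0 denq_neq0.
have nu0 : (0 < `|numq eps|)%N by rewrite absz_gt0 gt_eqF // numq_gt0.
have nd : (`|numq eps| < `|denq eps|)%N.
  move: e1; rewrite -{1}(divq_num_den eps) ltr_pdivrMr ?ltr0z ?denq_gt0 // mul1r ltr_int.
  have num0 : 0 < numq eps by rewrite numq_gt0.
  by rewrite -ltz_nat !abszE !gtr0_norm ?denq_gt0.
rewrite /N /inverse_ceil; set a := `|denq eps|%N in d0 nd *; set b := `|numq eps|%N in nu0 nd *.
have := divn_eq a.-1 b; have := ltn_pmod a.-1 nu0; rewrite mulSn; lia.
Qed.

Lemma eps_num_den : eps * `|denq eps|%N%:R = `|numq eps|%N%:R.
Proof.
have [e0 _] := andP eps01.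
have nu0 : 0 < numq eps by rewrite numq_gt0.
by rewrite -{1}(divq_num_den eps) !natr_absz !gtr0_norm ?denq_gt0 // divfK // intr_eq0 denq_neq0.
Qed.

Lemma inverse_ceil_bounds : 1 <= N%:R * eps < 2.
Proof.
have /andP[h1 h2] := inverse_ceil_num.
have d0 : 0 < `|denq eps|%N%:R :> rat by rewrite ltr0n absz_gt0 denq_neq0.
move: h1 h2; rewrite -(ler_nat rat) -(ltr_nat rat) !natrM -eps_num_den mulrA.
by rewrite ltr_pM2r // -{1}[X in X <= _]mul1r ler_pM2r // => -> ->.
Qed.

(** Rounding [1 / eps] up at most doubles it, which costs the factor 4. *)
Lemma is_large_sqr : is_large k eps -> (N ^ 2 <= 4 * k)%N.
Proof.
rewrite /is_large; have /andP[_ h] := inverse_ceil_num.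
move=> h'; have d0 : (0 < `|denq eps|)%N by rewrite absz_gt0 denq_neq0.
move: h h' d0; move: (`|numq eps|)%N (`|denq eps|)%N => b a h1 h2 d0.
have b0 : (0 < b)%N by case: (b) h2 => //; rewrite !muln0; case: (a) d0.
rewrite -(@leq_pmul2r (b * b)) ?muln_gt0 ?b0 //.
have h3 : ((N * b) * (N * b) <= (2 * a) * (2 * a))%N by rewrite leq_mul // ltnW.
by rewrite expnS expn1; move: h3 h2; clear; move: N => N' h3 h2; nia.
Qed.

Lemma is_small_sqr : ~~ is_large k eps -> (k <= N ^ 2)%N.
Proof.
rewrite /is_large; have /andP[h _] := inverse_ceil_num.
rewrite -ltnNge => h'; apply: ltnW; move: h h'; move: (`|numq eps|)%N (`|denq eps|)%N => b a h1 h2.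
have b0 : (0 < b * b)%N by case: (b) h1 h2 => //; rewrite !muln0 leqn0 => /eqP->.
rewrite -(@ltn_pmul2r (b * b)) //; apply: leq_trans h2 _.
by apply: leq_trans (leq_mul h1 h1) _; rewrite expnS expn1 mulnACA.
Qed.

End InverseCeil.

(** * The approximation ratio *)

Section Approximation.
Local Open Scope ring_scope.
Variables (n : nat) (X : n.-tuple distr) (k : nat) (eps : rat) (F : {set {set 'I_n}}).
Hypothesis n0 : (0 < n)%N.
Hypothesis Xd : all is_distr X.
Hypothesis k0 : (0 < k)%N.
Hypothesis eps01 : 0 < eps < 1.

Let N := inverse_ceil eps.
Let u := nseq N tt.
Let x : input := (X : seq distr, (k, eps)).
Let p := mk_params (x, u).

Lemma weights_of_ok S : exists w, [/\ w \in weights_of x p, (wsum w S < cap_of x p)%N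
  & (4 <= N)%N -> forall S', wsum w S' = wsum w S ->
     (1 - 11 / N%:R) * Eopt X k S <= Eopt X k S'].
Proof.
have u0 : (0 < size u)%N by rewrite size_nseq.
have Nu : size u = N by rewrite size_nseq.
rewrite /weights_of /cap_of; case: ifP => h.
  have [w [h1 h2 h3]] := weights_large_ok eps n0 Xd k0 u0 S; rewrite Nu in h3.
  exists w; split; [exact: h1 | exact: h2 | move=> N4; apply: (h3 N4); exact: is_large_sqr eps01 h].
have [w [h1 h2 h3]] := weights_small_ok eps n0 Xd k0 u0 S; rewrite Nu in h3.
exists w; split; [exact: h1 | exact: h2 | move=> N4; apply: (h3 N4); apply: (is_small_sqr eps01); exact: negbT].
Qed.

Lemma Eopt_ge0 S : 0 <= Eopt X k S.
Proof.
have u0 : (0 < size u)%N by rewrite size_nseq.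
have := Phi_ge0 k u Xd (vmax X k u) S; rewrite PhiE // pmulr_rge0 //.
exact: sg_gt0.
Qed.

Lemma final_ok_approximates b : F != set0 -> final_ok X k eps u F b ->
  exists2 S, S \in F & b.2 = bits S /\ (1 - 11 * eps) * opt X k F <= Eopt X k S.
Proof.
move=> /set0Pn[S0 S0F] [hb hf].
have u0 : (0 < size u)%N by rewrite size_nseq.
have [e0 e1] := andP eps01.
(* Some set of the family has weight below [cap] in some list, so the search cannot end without a
   set. *)
have [w0 [w0in w0c _]] := weights_of_ok S0.
case: hb => [eb|[S SF eb]].
  by have [S' _ [_]] := hf w0 S0 w0in S0F (ltnW w0c); rewrite eb.
exists S; first exact: SF.
split; first by rewrite eb.
have Sge S1 : S1 \in F -> (4 <= N)%N -> (1 - 11 / N%:R) * Eopt X k S1 <= Eopt X k S.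
  move=> S1F N4; have [w [win wc hw]] := weights_of_ok S1.
  have [S' S'F [e]] := hf w S1 win S1F (ltnW wc); rewrite eb ltnS => hs.
  exact: (le_trans (hw N4 S' e) (score_le Xd k0 u0 hs)).
(* For [eps >= 1/11] the claim is trivial; otherwise [N] exceeds 11, which gives the [4 <= N] that
   both regimes assume. *)
have [hneg|hpos] := lerP (1 - 11 * eps) 0.
  apply: le_trans (Eopt_ge0 S); rewrite mulr_le0_ge0 //.
  exact: bigmax_ge_id.
have Ne : 1 <= N%:R * eps by have /andP[] := (inverse_ceil_bounds eps01).
have N4 : (4 <= N)%N by rewrite -(ler_nat rat); nra.
rewrite mulrC -ler_pdivlMr //; apply: bigmax_le.
  by apply: divr_ge0; [exact: Eopt_ge0 | exact: ltW].
move=> A AF; rewrite ler_pdivlMr // mulrC; apply: le_trans (Sge A AF N4).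
apply: ler_wpM2r; first exact: Eopt_ge0.
have N0 : 0 < N%:R :> rat by rewrite ltr0n.
rewrite lerD2l lerN2 ler_pdivrMr; last exact: N0.
have alg (r e : rat) : 1 <= r * e -> 11 <= 11 * e * r by move=> h; lra.
exact: alg Ne.
Qed.

End Approximation.

(** * Running time *)

Section Bounds.
Local Open Scope nat_scope.

(** Separates the power of [n] from a factor that depends on eps only. *)
Lemma succ_mul_le n A L : 0 < n -> (n * (n * A)).+1 ^ L <= n ^ (2 * L) * A.+1 ^ L.
Proof.
move=> n0; rewrite expnM -expnMn; case: L => // L; rewrite leq_exp2r //.
rewrite mulnA -[n ^ 2]mulnn mulnS addnC -addn1 leq_add2l muln_gt0 n0.
by [].
Qed.

(** The number of digits for small [k]. It governs the power of [n] in the cap and is of order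
    [N^6], whence [1 / eps^6]. *)
Definition level_count (N : nat) : nat := (N ^ 4 * (100 * N ^ 2)).+1.

(** The part of the cap that depends on eps only. The two summands belong to small and large [k], so
    that one bound covers both. *)
Definition cap_factor (N : nat) : nat :=
  ((24 * N ^ 2) ^ (2 * (100 * N ^ 2))).+1 ^ level_count N + (N * N).+1 ^ 3.

Lemma cap_factor_gt0 N : 0 < cap_factor N.
Proof. by rewrite /cap_factor addn_gt0 [X in _ || X]expn_gt0 orbT. Qed.

Lemma level_count_le N : 0 < N -> level_count N <= 101 * N ^ 6.
Proof.
move=> N0; rewrite /level_count mulnCA -expnD -[in X in _ < X](addn1 100) mulnDl mul1n -addn1.
by rewrite leq_add2l expn_gt0 N0.
Qed.

Lemma level_count_ge N : 0 < N -> 3 <= level_count N.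
Proof.
move=> N0; rewrite /level_count ltnS mulnCA -expnD.
apply: (@leq_trans (100 * 1)); first by [].
by rewrite leq_mul2l expn_gt0 N0 orbT.
Qed.

Section Instance.
Variables (n : nat) (X : n.-tuple distr) (k : nat) (eps : rat) (N : nat).
Hypotheses (n0 : 0 < n) (Xd : all is_distr X) (k0 : 0 < k) (N0 : 0 < N).

Let x : input := (X : seq distr, (k, eps)).
Let u := nseq N tt.
Let p := mk_params (x, u).

Lemma weights_of_bound w : w \in weights_of x p ->
  size w = n /\ forall a, a \in w -> a <= cap_of x p.
Proof.
have u0 : 0 < size u by rewrite size_nseq.
rewrite /weights_of /cap_of; case: ifP => _ h.
  exact: (weights_large_bound n0 Xd k0 u0 h).
exact: (weights_small_bound n0 Xd k0 u0 h).
Qed.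

Lemma cap_of_largeE : is_large k eps -> cap_of x p = (n * (n * N * N)).+1 ^ 3.
Proof.
move=> h; have := cap_large_E X k eps u.
by rewrite /cap_of /= h size_nseq.
Qed.

Lemma cap_of_smallE : ~~ is_large k eps -> cap_of x p =
  (n * (n * (24 * N ^ 2) ^ (2 * (100 * N ^ 2)))).+1 ^ level_count N.
Proof.
move=> /negbTE h; have := cap_small_E X k eps u.
by rewrite size_nseq /cap_of [x.2.1]/= [x.2.2]/= h /level_count => E; exact: E.
Qed.

Lemma cap_of_le : cap_of x p <= n ^ (2 * level_count N) * cap_factor N.
Proof.
rewrite /cap_factor mulnDr; have h3 := level_count_ge N0.
case hl : (is_large k eps); last first.
  rewrite cap_of_smallE ?hl //.
  by apply: leq_trans (succ_mul_le _ _ n0) _; exact: leq_addr.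
rewrite cap_of_largeE // -mulnA; apply: leq_trans (succ_mul_le _ _ n0) _.
apply: leq_trans (leq_addl _ _); rewrite leq_mul2r; apply/orP; right.
by rewrite leq_pexp2l // leq_mul2l.
Qed.

Lemma size_weights_of_le : size (weights_of x p) <= n ^ 3 * N.+1.
Proof.
have h : n * n * (n * N).+1 <= n ^ 3 * N.+1.
  by rewrite !expnS expn0 muln1 mulnA -[X in _ <= X]mulnA leq_mul2l mulnS -addn1 addnC leq_add2r n0 orbT.
rewrite /weights_of; case: ifP => _.
  by have := size_weights_large X k eps u; rewrite size_nseq => ->.
have -> := size_weights_small X k eps u; apply: leq_trans h.
by rewrite leq_pmulr.
Qed.

End Instance.

Lemma total_time_le (qs : seq (data * nat)) t I M :
  size qs <= I -> (forall q, List.In q qs -> q.2 <= M) -> total_time t qs <= t + I * M.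
Proof.
move=> hI hM; rewrite /total_time leq_add2l; apply: leq_trans (leq_mul hI (leqnn M)).
elim: qs hM {hI} => //= q qs IH h; rewrite mulSn leq_add //; first by apply: h; left.
by apply: IH => q' hq'; apply: h; right.
Qed.

Definition time_factor (a e N : nat) : nat :=
  (2 * (N.+1 * cap_factor N) + N + 2) * (e * N.+1 ^ e)
  + 2 * (N.+1 * cap_factor N) * (a * cap_factor N ^ a).

(** The power of [n] collects [2 L] for the targets, 3 for the weight lists, and [2 L a] for the
    degree [a] of the exact-sum algorithm in the magnitude. *)
Lemma time_le a e a' n N D sc cap L m t Mc :
  0 < n -> 0 < D -> a <= a' -> e <= a' ->
  cap <= n ^ (2 * L) * cap_factor N -> m <= n ^ 3 * N.+1 ->
  t <= (m * cap.+1 + N + 2) * pb e (D + N) ->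
  Mc <= a * sc.+1 ^ a * (maxn 1 cap) ^ a ->
  t + m * cap.+1 * Mc <= time_factor a e N * n ^ (2 * L + 3 + 2 * L * a) * sc.+1 ^ a' * D ^ a'.
Proof.
rewrite /time_factor; move: (cap_factor N) (cap_factor_gt0 N) => w w0 n0 D0 aa ea hc hm ht hMc.
set g := n ^ (2 * L) in hc *.
have g0 : 0 < g by rewrite expn_gt0 n0.
have gw : 0 < g * w by rewrite muln_gt0 g0.
set h := n ^ (2 * L + 3).
have Eh : h = g * n ^ 3 by rewrite /h expnD.
have h0 : 0 < h by rewrite expn_gt0 n0.
have I1 : m * cap.+1 <= h * (2 * (N.+1 * w)).
  apply: (@leq_trans (n ^ 3 * N.+1 * (g * w + g * w))); first by apply: leq_mul => //; lia.
  by rewrite Eh; apply: eq_leq; nia.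
have I2 : m * cap.+1 + N + 2 <= h * (2 * (N.+1 * w) + N + 2).
  rewrite (mulnDr h (_ + N)) (mulnDr h _ N).
  by apply: leq_add (leq_pmull 2 h0); apply: leq_add I1 (leq_pmull N h0).
have P1 : pb e (D + N) <= e * N.+1 ^ e * D ^ a'.
  rewrite /pb -mulnA leq_mul2l; apply/orP; right.
  apply: (@leq_trans ((N.+1 * D) ^ e)).
    by case: (e) => // e'; rewrite leq_exp2r // mulSn leq_add2l leq_pmulr.
  by rewrite expnMn leq_mul2l leq_pexp2l ?orbT.
have M1 : Mc <= a * sc.+1 ^ a' * (n ^ (2 * L * a) * w ^ a).
  apply: leq_trans hMc _; apply: leq_mul; first by rewrite leq_mul2l leq_pexp2l ?orbT.
  rewrite expnM -expnMn; case: (a) => // a1; rewrite leq_exp2r //.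
  by rewrite geq_max gw.
set q := n ^ (2 * L * a) in M1.
have q0 : 0 < q by rewrite expn_gt0 n0.
have -> : n ^ (2 * L + 3 + 2 * L * a) = h * q by rewrite expnD.
have s0 : 0 < sc.+1 ^ a' by rewrite expn_gt0.
have d0 : 0 < D ^ a' by rewrite expn_gt0 D0.
have T1 := leq_trans ht (leq_mul I2 P1).
have T2 := leq_mul I1 M1.
apply: leq_trans (leq_add T1 T2) _.
set S := sc.+1 ^ a' in s0 *; set DD := D ^ a' in d0 *.
set c1 := 2 * (N.+1 * w) + N + 2; set c2 := e * N.+1 ^ e; set c3 := 2 * (N.+1 * w).
clear T1 T2 M1 P1 I2 I1 Eh; clearbody c1 c2 c3 S DD q h; rewrite !mulnDl; apply: leq_add.
  apply: (@leq_trans (c1 * c2 * h * DD * (q * S))); last by apply: eq_leq; ring.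
  apply: leq_trans (leq_pmulr _ _); last by rewrite muln_gt0 q0.
  by apply: eq_leq; ring.
apply: (@leq_trans (c3 * h * (a * w ^ a) * q * S * DD)); last by apply: eq_leq; ring.
apply: leq_trans (leq_pmulr _ d0).
by apply: eq_leq; ring.
Qed.

End Bounds.

(** * The program run on an exact-sum algorithm *)

Section Conclusion.
Local Open Scope ring_scope.

Lemma wsum_tuple n (w : seq nat) (v : n.-tuple int) (S : {set 'I_n}) :
  v = [seq Posz a | a <- w] :> seq int -> \sum_(i in S) tnth v i = (wsum w S)%:Z.
Proof.
move=> Ev; rewrite /wsum (big_morph Posz PoszD (erefl (Posz 0))); apply: eq_bigr => i _.
have sw : size w = n by rewrite -(size_map Posz) -Ev size_tuple.
by rewrite (tnth_nth 0) Ev (nth_map 0%N) // sw.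
Qed.

Lemma magnitude_tuple n (w : seq nat) (v : n.-tuple int) m :
  v = [seq Posz a | a <- w] :> seq int -> (forall a, a \in w -> (a <= m)%N) ->
  (magnitude v <= m)%N.
Proof.
move=> Ev h; rewrite /magnitude Ev big_map; apply/bigmax_leqP_seq => a aw _; exact: h.
Qed.

Lemma oracle_answers (Fam : family_class) (E : cmd) a c n (w : seq nat) z m :
  (forall (w : (ground Fam c).-tuple int) (z : int),
      exists (o : option {set 'I_(ground Fam c)}) (t : nat),
        [/\ runs_plain E (enc_query c w z) (enc_option (@enc_set _) o) t,
            exact_sum_answer (Defs.family Fam c) w z o
          & (t <= a * (size c).+1 ^ a * (maxn 1 (magnitude w)) ^ a)%N]) ->
  n = ground Fam c -> size w = n -> (forall b, b \in w -> (b <= m)%N) ->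
  exists (o : option {set 'I_(ground Fam c)}) t,
    [/\ runs_plain E (Node (enc_seq enc_bool c) (encode ([seq Posz a | a <- w], Posz z)))
          (enc_option (@enc_set _) o) t,
        answers (Defs.family Fam c) w z o & (t <= a * (size c).+1 ^ a * (maxn 1 m) ^ a)%N].
Proof.
move=> H -> sw hm; have sv : size [seq Posz a | a <- w] == ground Fam c by rewrite size_map sw.
have [o [t [h1 h2 h3]]] := H (Tuple sv) (Posz z).
exists o, t; split; first exact: h1.
  move: h2; rewrite /exact_sum_answer /answers; case: o {h1} => [A|].
    by rewrite (@wsum_tuple _ w) // => -[hA [hw]].
  by move=> h S SF hw; apply: (h S SF); rewrite (@wsum_tuple _ w) // hw.
apply: leq_trans h3 _; rewrite leq_mul2l; apply/orP; right.
have hv : (magnitude (Tuple sv) <= m)%N by apply: (@magnitude_tuple _ w).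
case: (a) => // a1; rewrite leq_exp2r // geq_max leq_maxl /=.
exact: leq_trans hv (leq_maxr _ _).
Qed.

(** The program and the exponent [e] of its own steps come before the family; only [a] depends on
    the exact-sum algorithm. This is what makes the degree in the large regime absolute. *)
Lemma program_correct : exists P e, forall (Fam : family_class) (E : cmd),
  exact_sum_algorithm Fam E -> exists a, forall (c : seq bool) (X : (ground Fam c).-tuple distr)
    (k : nat) (eps : rat), instance X k eps ->
  let x : input := (X : seq distr, (k, eps)) in
  let N := inverse_ceil eps in
  let p := mk_params (x, nseq N tt) in
  let cap := cap_of x p in
  let I := (size (weights_of x p) * cap.+1)%N in
  exists t qs, [/\ approximates E P 11 X k eps t qs,
    (t <= (I + N + 2) * pb e (dsize (enc_data X k eps) + N))%N,
    (size qs <= I)%N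
    & forall q, List.In q qs -> (q.2 <= a * (size c).+1 ^ a * (maxn 1 cap) ^ a)%N /\
        exists2 v : (ground Fam c).-tuple int * int,
          q.1 = enc_query c v.1 v.2 & (magnitude v.1 <= cap)%N].
Proof.
have [P [e HP]] := main_run; exists P, e => Fam E [a Ha]; exists a => c X k eps hI x N p cap I.
have [hc n0 F0 Xd [k0 e01]] := hI; have [e0 _] := andP e01.
have N0 : (0 < N)%N by [].
have [] := HP _ X k eps (Defs.family Fam c) (enc_seq enc_bool c) (runs_plain E)
  (a * (size c).+1 ^ a * (maxn 1 cap) ^ a)%N e0.
- by move=> w; exact: (@weights_of_bound _ X k eps N n0 Xd k0 N0 w).
- by move=> w z sw hw _; exact: (@oracle_answers Fam E a c _ w z cap (fun w z => Ha c w z hc) erefl sw hw).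
move=> b [t [qs [hr hb ht hq hg]]].
have [S SF [eb hS]] := final_ok_approximates n0 Xd k0 e01 F0 hb.
exists t, qs; split; [| exact: ht | exact: hq |].
  by exists S; [rewrite eb in hr | split].
move=> q /hg[h1 [w [z [sw hw ->]]]]; split; first exact: h1.
have sv : size [seq Posz a | a <- w] == ground Fam c by rewrite size_map sw.
by exists (Tuple sv, Posz z) => //=; apply: (@magnitude_tuple _ w).
Qed.
End Conclusion.

(** * Bounds in terms of eps *)

Section Rates.
Local Open Scope ring_scope.

Lemma pb_le_rat e d (b : nat) (y : rat) : 1 <= y -> b%:R <= 2 * y -> (e + e * 2 ^ e <= d)%N ->
  (pb e b)%:R <= d%:R * y ^+ d.
Proof.
move=> y1 hb hd; have y0 : 0 <= y by apply: le_trans y1.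
rewrite /pb natrM natrX; apply: (@le_trans _ _ (e%:R * (2 * y) ^+ e)).
  by rewrite ler_wpM2l ?ler0n // lerXn2r // ?nnegrE ?ler0n // mulr_ge0.
rewrite exprMn mulrA -natrX -natrM; apply: ler_pM; rewrite ?ler0n ?exprn_ge0 //.
  by rewrite ler_nat; apply: leq_trans hd; exact: leq_addl.
by rewrite ler_weXn2l //; apply: leq_trans hd; exact: leq_addr.
Qed.

(** [6464 = 101 * 64]: there are at most [101 N^6] digits, and [N < 2 / eps] gives
    [N^6 < 64 / eps^6]. *)
Lemma exponent_le a a' eps : 0 < eps < 1 -> ((5 + 2 * a) * 6464 <= a')%N ->
  (2 * level_count (inverse_ceil eps) + 3 + 2 * level_count (inverse_ceil eps) * a
    <= Num.truncn (a'%:R / eps ^+ 6 : rat))%N.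
Proof.
move=> e01 ha; have [e0 _] := andP e01; have N0 : (0 < inverse_ceil eps)%N by [].
have /andP[_ h2] := inverse_ceil_bounds e01.
have h101 := level_count_le N0; have h3 := level_count_ge N0.
set L := level_count _ in h101 h3 *; set N := inverse_ceil eps in N0 h2 h101 *.
have [Z hX hZ] : exists2 Z, (2 * L + 3 + 2 * L * a <= Z * N ^ 6)%N & (Z * 2 ^ 6 <= a')%N.
  exists ((5 + 2 * a) * 101)%N; last by rewrite -mulnA.
  rewrite -[X in (_ <= X)%N]mulnA; apply: (@leq_trans ((5 + 2 * a) * L)); last by rewrite leq_mul2l h101 orbT.
  by rewrite mulnDl leq_add //; [lia | rewrite mulnAC].
clear h101 h3 ha; rewrite truncn_ge_nat; last by rewrite divr_ge0 ?ler0n // exprn_ge0 // ltW.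
rewrite ler_pdivlMr ?exprn_gt0 //.
apply: (@le_trans _ _ ((Z * N ^ 6)%N%:R * eps ^+ 6)).
  by rewrite ler_wpM2r ?ler_nat // exprn_ge0 // ltW.
rewrite natrM natrX -mulrA -exprMn; apply: (@le_trans _ _ (Z%:R * 2 ^+ 6)).
  rewrite ler_wpM2l ?ler0n // lerXn2r // ?nnegrE ?ler0n ?mulr_ge0 ?ler0n //; exact: ltW.
by rewrite -natrX -natrM ler_nat.
Qed.

Lemma queries_list (T : Type) (U : eqType) (f : U -> T) (Q : U -> Prop) (qs : seq (T * nat)) :
  (forall q, List.In q qs -> exists2 v, q.1 = f v & Q v) ->
  exists2 ws, [seq q.1 | q <- qs] = [seq f v | v <- ws] & size ws = size qs /\ forall v, v \in ws -> Q v.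
Proof.
elim: qs => [|q qs IH] H; first by exists [::].
have [v Ev Qv] := H q (or_introl erefl).
have [ws E [sw Qw]] := IH (fun q' h => H q' (or_intror h)).
exists (v :: ws); first by rewrite /= Ev E.
split; first by rewrite /= sw.
by move=> v'; rewrite inE => /orP[/eqP->|/Qw].
Qed.

Lemma ground_lt_size n (X : n.-tuple distr) k eps : (n < dsize (enc_data X k eps))%N.
Proof.
have -> : dsize (enc_data X k eps) = (sz (X : seq distr) + sz (k, eps)).+1 by [].
rewrite ltnS; apply: leq_trans (leq_addr _ _); rewrite -{1}(size_tuple X); apply/ltnW; exact: size_sz.
Qed.

Lemma is_large_of_le k eps : 0 < eps < 1 -> 1 / eps ^+ 2 <= k%:R -> is_large k eps.
Proof.
move=> e01; have [e0 _] := andP e01; rewrite ler_pdivrMr ?exprn_gt0 // => h.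
rewrite /is_large -(ler_nat rat) !natrM -(eps_num_den e01).
have d0 : 0 <= `|denq eps|%N%:R :> rat by rewrite ler0n.
have -> : k%:R * (eps * `|denq eps|%N%:R * (eps * `|denq eps|%N%:R))
  = (k%:R * eps ^+ 2) * (`|denq eps|%N%:R * `|denq eps|%N%:R) :> rat by ring.
by rewrite ler_peMl // mulr_ge0.
Qed.

(** Valid for every [k], since [cap_of_le] covers both regimes; so it serves the PTAS bound as
    well. *)
Lemma small_k_total a e n (X : n.-tuple distr) k eps (sc t : nat) (qs : seq (data * nat)) a' :
  let N := inverse_ceil eps in
  let x : input := (X : seq distr, (k, eps)) in
  let p := mk_params (x, nseq N tt) in
  let cap := cap_of x p in
  let I := (size (weights_of x p) * cap.+1)%N in
  (0 < n)%N -> all is_distr X -> (0 < k)%N -> (a <= a')%N -> (e <= a')%N ->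
  (t <= (I + N + 2) * pb e (dsize (enc_data X k eps) + N))%N -> (size qs <= I)%N ->
  (forall q, List.In q qs -> (q.2 <= a * sc.+1 ^ a * (maxn 1 cap) ^ a)%N) ->
  (total_time t qs <= time_factor a e N *
    n ^ (2 * level_count N + 3 + 2 * level_count N * a) * sc.+1 ^ a' * dsize (enc_data X k eps) ^ a')%N.
Proof.
move=> N x p cap I n0 Xd k0 ha he ht hq hm.
have N0 : (0 < N)%N by [].
apply: (leq_trans (total_time_le t hq hm)).
apply: (time_le n0 _ ha he (cap_of_le X k eps n0 N0) (size_weights_of_le X k eps N n0) ht (leqnn _)).
exact: leq_ltn_trans (ground_lt_size X k eps).
Qed.

End Rates.

Section LargeRegime.
Local Open Scope ring_scope.

(** Written with products of a single variable, standing for [n + N], so that [solve_poly]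
    applies. *)
Definition poly_cap (b : nat) : nat := ((b * (b * b * b)).+1 * (b * (b * b * b)).+1 * (b * (b * b * b)).+1)%N.
Definition poly_calls (b : nat) : nat := (b * b * (b * b).+1 * (poly_cap b).+1)%N.

Lemma large_cap_le n (X : n.-tuple distr) k eps N : (0 < n)%N -> is_large k eps -> (0 < N)%N ->
  (cap_of (X : seq distr, (k, eps)) (mk_params ((X : seq distr, (k, eps)), nseq N tt)) <= poly_cap (n + N))%N.
Proof.
move=> n0 hl N0; rewrite cap_of_largeE // !expnS expn0 muln1 mulnA /poly_cap.
have h : ((n * (n * N * N)).+1 <= ((n + N) * ((n + N) * (n + N) * (n + N))).+1)%N.
  by rewrite ltnS; do ?apply: leq_mul; rewrite ?leq_addr ?leq_addl.
exact: (leq_mul (leq_mul h h) h).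
Qed.

Lemma large_calls_le n (X : n.-tuple distr) k eps N : (0 < n)%N -> is_large k eps -> (0 < N)%N ->
  (size (weights_of (X : seq distr, (k, eps)) (mk_params ((X : seq distr, (k, eps)), nseq N tt)))
   * (cap_of (X : seq distr, (k, eps)) (mk_params ((X : seq distr, (k, eps)), nseq N tt))).+1
   <= poly_calls (n + N))%N.
Proof.
move=> n0 hl N0; have hc := large_cap_le X n0 hl N0; apply: leq_mul; last by [].
have := size_weights_large X k eps (nseq N tt); rewrite size_nseq /weights_of /= hl => ->.
by apply: leq_mul; [apply: leq_mul; exact: leq_addr | rewrite ltnS; apply: leq_mul; rewrite ?leq_addr ?leq_addl].
Qed.

End LargeRegime.

Local Open Scope ring_scope.

Theorem corollary4p15 :
  exists (C K : rat) (d : nat), [/\ 0 < C, 0 < K &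
    forall (Fam : family_class) (E : cmd), exact_sum_algorithm Fam E ->
      exists P : cmd,
        is_ptas Fam E P K /\
        exists (a : nat) (f : rat -> nat),
          forall (c : seq bool) (X : (ground Fam c).-tuple distr) (k : nat) (eps : rat),
            instance X k eps ->
            exists (t : nat) (qs : seq (data * nat)),
              [/\ approximates E P K X k eps t qs,
                  k%:R <= C / eps ^+ 2 -> small_k_bound a f X k eps t qs
                & C / eps ^+ 2 <= k%:R -> large_k_bound d X k eps t qs]].
Proof.
have [P [e HP]] := program_correct.
have [e1 He1] : poly (fun b => poly_cap b + poly_calls b)%N.
  by rewrite /poly_calls /poly_cap; solve_poly.
have [e2 He2] : poly (fun b => (poly_calls b + b + 2) * pb e b)%N.
  by rewrite /poly_calls /poly_cap; solve_poly.
(* [C = 1] matches the test [is_large]; at [k = 1 / eps^2] both bounds hold, as the first is proved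
   for every [k]. The two parts of [d] are what [pb_le_rat] needs for [e1], the number and magnitude
   of the calls, and for [e2], the steps outside them. *)
exists 1, 11, (e1 + e1 * 2 ^ e1 + (e2 + e2 * 2 ^ e2))%N; set d := (_ + _)%N; split=> // Fam E HE.
have [a HQ] := HP Fam E HE; exists P.
pose a' := ((5 + 2 * a) * 6464 + e + a)%N.
have aa : (a <= a')%N by exact: leq_addl.
have ea : (e <= a')%N by rewrite /a' -addnA addnCA leq_addr.
have a6 : ((5 + 2 * a) * 6464 <= a')%N by rewrite /a' -addnA leq_addr.
clearbody a'.
split.
  move=> eps; set N := inverse_ceil eps.
  set L := level_count N; set E0 := (2 * L + 3 + 2 * L * a)%N; set tf := time_factor a e N.
  (* For fixed eps both [tf] and the exponent [E0] are constants, and [n] is below the length of the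
     input. *)
  exists (tf + (E0 + a' + a'))%N => c X k hI.
  have [t [qs [h1 h2 h3 h4]]] := HQ c X k eps hI; exists t, qs; split=> //.
  have [_ n0 _ Xd [k0 e01]] := hI.
  have hT := small_k_total n0 Xd k0 aa ea h2 h3 (fun q hq => proj1 (h4 q hq)).
  apply: leq_trans hT _; rewrite -/N -/L -/E0 -/tf; clearbody tf E0.
  have nD := ground_lt_size X k eps; set D := dsize _ in nD *.
  have D0 : (0 < D)%N by case: (D) nD.
  apply: (@leq_trans (tf * ((size c + D) ^ E0 * (size c + D) ^ a' * (size c + D) ^ a'))).
    rewrite -!mulnA leq_mul2l; apply/orP; right.
    have mono x y m : (x <= y)%N -> (x ^ m <= y ^ m)%N by move=> h; case: (m) => // m'; rewrite leq_exp2r.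
    by apply: leq_mul (mono _ _ _ _) (leq_mul (mono _ _ _ _) (mono _ _ _ _)); move: nD D0; clear; lia.
  rewrite -!expnD; apply: leq_mul; first exact: leq_addr.
  by rewrite leq_pexp2l ?leq_addl // addn_gt0 D0 orbT.
exists a', (fun eps => time_factor a e (inverse_ceil eps)) => c X k eps hI.
have [t [qs [h1 h2 h3 h4]]] := HQ c X k eps hI; exists t, qs.
have [_ n0 _ Xd [k0 e01]] := hI; have [e0 _] := andP e01.
have N0 : (0 < inverse_ceil eps)%N by [].
split=> // hk.
  have hT := small_k_total n0 Xd k0 aa ea h2 h3 (fun q hq => proj1 (h4 q hq)).
  apply: leq_trans hT _; rewrite !leq_mul2r; apply/orP; right; apply/orP; right.
  by rewrite leq_mul2l leq_pexp2l ?orbT //; apply: exponent_le.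
have hl := is_large_of_le e01 hk.
have hc := large_cap_le X n0 hl N0; have hi := large_calls_le X n0 hl N0.
set N := inverse_ceil eps in h2 h3 h4 hc hi N0.
set n := ground Fam c in n0 X hI h1 h2 h3 h4 Xd hc hi *.
have n1 : 1 <= n%:R :> rat by rewrite ler1n.
have ei0 : 0 < eps^-1 by rewrite invr_gt0.
have hN : N%:R <= 2 * eps^-1.
  by rewrite ler_pdivlMr //; have /andP[_ /ltW] := inverse_ceil_bounds e01.
set y := n%:R + eps^-1; have y1 : 1 <= y by rewrite /y; lra.
have hb : (n + N)%:R <= 2 * y by rewrite natrD /y; lra.
have hB b : (b <= pb e1 (n + N))%N -> b%:R <= d%:R * y ^+ d.
  move=> hb'; apply: le_trans (pb_le_rat y1 hb (leq_addr _ _)).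
  by rewrite ler_nat.
have h5 := He1 (n + N)%N; have {}h5 := h5 (ltn_addr _ n0).
have [ws Ews [sws Qws]] := queries_list (fun q hq => proj2 (h4 q hq)).
split.
  exists ws; first exact: Ews.
  split; first by apply: hB; rewrite sws; apply: leq_trans h3 _; apply: leq_trans hi (leq_trans (leq_addl _ _) h5).
  by move=> v /Qws hv; apply: hB; apply: leq_trans hv (leq_trans hc (leq_trans (leq_addr _ _) h5)).
set D := dsize _ in h2 *.
have D0 : 0 <= D%:R :> rat by rewrite ler0n.
have h6 : (t <= pb e2 (n + N + D))%N.
  have bN : (0 < n + N + D)%N by rewrite -addnA ltn_addr.
  apply: leq_trans (He2 _ bN); apply: leq_trans h2 _; apply: leq_mul; last first.
    by apply: pb_mono; rewrite addnC; apply: leq_add (leqnn D); exact: leq_addl.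
  rewrite leq_add2r; apply: leq_add; last exact: leq_trans (leq_addl n N) (leq_addr D _).
  apply: leq_trans hi _; rewrite /poly_calls /poly_cap.
  by do ?[apply: leq_mul | rewrite ltnS]; rewrite leq_addr.
apply: (@le_trans _ _ (pb e2 (n + N + D))%:R); first by rewrite ler_nat.
apply: pb_le_rat (leq_addl _ _); first by lra.
by rewrite natrD; lra.
Qed.
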